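(* Let $n\ge2$, let $\Omega$ be a domain in $\mathbb{R}^n$, and let $\boldsymbol{\mathfrak{U}}(\Omega)$ be the set of $n$-component vector-valued functions $\boldsymbol{u}$ whose components are harmonic in $\Omega$, with $\sup_\Omega|\boldsymbol{u}|\le1$. Suppose that a point $\xi\in\partial\Omega$ can be touched by an interior ball $B$. Then $$\limsup_{x\to\xi}\ \sup_{\boldsymbol{u}\in\boldsymbol{\mathfrak{U}}(\Omega)}|x-\xi|\,|\mathrm{div}\,\boldsymbol{u}(x)|\le D_n,$$ where $x$ is a point on the radius of $B$ directed from the center of $B$ to $\xi$, and $$D_n=\frac{2\,\omega_{n-1}}{\omega_n}\int_0^{\pi/2}\bigl[1+n(n-2)\cos^2\vartheta\bigr]^{1/2}\sin^{n-2}\vartheta\,d\vartheta .$$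
   Context: $|\cdot|$ is the Euclidean length of a vector or the absolute value of a scalar. $\omega_n$ is the area of the $(n-1)$-dimensional unit sphere in $\mathbb{R}^n$ (so $\omega_1=2$, $\omega_2=2\pi$). Functions are real-valued. ''$\xi\in\partial\Omega$ can be touched by an interior ball $B$'' means that there is an open ball $B\subset\Omega$ with $\xi\in\partial B$. The limit is taken as $x$ tends to $\xi$ along the segment joining the center of $B$ to $\xi$. *)

(* Defs.v *)
From HB Require Import structures.
From mathcomp Require Import all_boot all_order all_algebra.
From mathcomp Require Import all_classical all_reals all_analysis.
Set Implicit Arguments.
Unset Strict Implicit.
Unset Printing Implicit Defensive.
Import Order.TTheory GRing.Theory Num.Theory.
Import numFieldNormedType.Exports.
Local Open Scope classical_set_scope.
Local Open Scope ring_scope.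

(* The norm that MathComp-Analysis puts on 'rV[R]_n is the sup norm: it induces
   the usual topology and derivatives, but not the Euclidean length. *)
Definition enorm (R : realType) (n : nat) (x : 'rV[R]_n) : R :=
  Num.sqrt (\sum_(i < n) x 0 i ^+ 2).

Definition eball (R : realType) (n : nat) (c : 'rV[R]_n) (r : R) :
    set 'rV[R]_n :=
  [set x | enorm (x - c) < r].

Definition boundary (T : topologicalType) (A : set T) : set T :=
  closure A `\` interior A.

Definition domain (R : realType) (n : nat) (Omega : set 'rV[R]_n) : Prop :=
  [/\ open Omega, connected Omega & Omega !=set0].

Definition partial (R : realType) (n : nat) (i : 'I_n) (f : 'rV[R]_n -> R) :
    'rV[R]_n -> R :=
  fun x => 'D_(delta_mx 0 i : 'rV[R]_n) f x.

(* Meant for open Omega, where the conditions depend on the values of f in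
   Omega only. *)
Definition C1_on (R : realType) (n : nat) (Omega : set 'rV[R]_n)
    (f : 'rV[R]_n -> R) : Prop :=
  forall (i : 'I_n) (x : 'rV[R]_n), Omega x ->
    derivable f x (delta_mx 0 i) /\ {for x, continuous (partial i f)}.

Definition C2_on (R : realType) (n : nat) (Omega : set 'rV[R]_n)
    (f : 'rV[R]_n -> R) : Prop :=
  C1_on Omega f /\ forall i : 'I_n, C1_on Omega (partial i f).

Definition laplacian (R : realType) (n : nat) (f : 'rV[R]_n -> R)
    (x : 'rV[R]_n) : R :=
  \sum_(i < n) partial i (partial i f) x.

Definition harmonic_on (R : realType) (n : nat) (Omega : set 'rV[R]_n)
    (f : 'rV[R]_n -> R) : Prop :=
  C2_on Omega f /\ forall x, Omega x -> laplacian f x = 0.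

Definition divergence (R : realType) (n : nat) (u : 'rV[R]_n -> 'rV[R]_n)
    (x : 'rV[R]_n) : R :=
  \sum_(i < n) partial i (fun y => u y 0 i) x.

(* A function on Omega is represented by an arbitrary extension to the whole
   space; its values outside Omega are irrelevant. *)
Definition harmonic_unit_fields (R : realType) (n : nat)
    (Omega : set 'rV[R]_n) : set ('rV[R]_n -> 'rV[R]_n) :=
  [set u : 'rV[R]_n -> 'rV[R]_n |
           (forall i : 'I_n, harmonic_on Omega (fun x => u x 0 i)) /\
           (ereal_sup [set (enorm (u x))%:E | x in Omega] <= 1)%E].

(* n-dimensional Lebesgue measure of a Borel set: the n-fold product of
   one-dimensional Lebesgue measure, written as the iterated integral of
   sections which defines the product measure.  'rV_0 is a single point, of
   measure 1. *)
Fixpoint volume (R : realType) (n : nat) : set 'rV[R]_n -> \bar R :=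
  match n return set 'rV[R]_n -> \bar R with
  | 0%N => fun A => (\1_A (0 : 'rV[R]_0))%:E
  | m.+1 => fun A => (\int[@lebesgue_measure R]_t
      volume [set y : 'rV[R]_m | A (row_mx (t%:M : 'rV[R]_1) y)])%E
  end.

Definition unit_sphere (R : realType) (n : nat) : set 'rV[R]_n :=
  [set x | enorm x = 1].

Definition cone (R : realType) (n : nat) (A : set 'rV[R]_n) : set 'rV[R]_n :=
  [set z | exists (t : R) (x : 'rV[R]_n), [/\ 0 < t <= 1, A x & z = t *: x]].

(* Surface measure on the unit sphere of R^n, normalized by the polar
   coordinates formula dx = t^(n-1) dt dsigma: the cone over A with apex 0 has
   volume sigma(A) / n. *)
Definition sphere_measure (R : realType) (n : nat) (A : set 'rV[R]_n) :
    \bar R :=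
  (n%:R%:E * volume (cone A))%E.

Definition omega (R : realType) (n : nat) : R :=
  fine (sphere_measure (@unit_sphere R n)).

Definition D_const (R : realType) (n : nat) : R :=
  2 * omega R n.-1 / omega R n *
  \int[@lebesgue_measure R]_(t in `[0, pi / 2])
    (Num.sqrt (1 + n%:R * (n%:R - 2) * cos t ^+ 2) * sin t ^+ (n - 2)).

Definition open_radius (R : realType) (n : nat) (c xi : 'rV[R]_n) :
    set 'rV[R]_n :=
  [set x | exists2 t : R, 0 <= t < 1 & x = c + t *: (xi - c)].

(* Main.v *)
Require Import Defs.
From mathcomp Require Import all_boot all_order all_algebra.
From mathcomp Require Import all_classical all_reals all_analysis.
From mathcomp Require Import measurable_realfun.
From mathcomp Require Import ring lra zify.
Import Order.TTheory GRing.Theory Num.Theory.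
Import numFieldNormedType.Exports.
Local Open Scope classical_set_scope.
Local Open Scope ring_scope.

(** Why the bound holds. Put [d = |x - xi|] and let [e] be the unit vector from
    [xi] to the center of the ball. A similarity whose ratio is slightly less than
    [d], and whose orthogonal part is a Householder reflection, maps the origin to
    [x] and the half-cube [-1, L] x [-L, L]^(n-1) into the ball: the bottom face
    [y_0 = -1] becomes a piece of a hyperplane orthogonal to [e], slightly inside
    the tangent plane at [xi] ([half_box_in_ball]). Pulling back multiplies the
    divergence by the ratio ([pull_divergence]), so that the theorem reduces to a
    bound on [div u (0)] for a harmonic field of length at most one near this
    half-cube, in the limit of large [L] ([half_box_estimate]).

    That bound is a duality argument. Let [psi_i] be the [i]-th
    derivative of the fundamental solution with pole at the origin, up to a
    constant factor and smoothed by a parameter [c]. Subtract its mirror image in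
    the bottom face, with a sign such that the difference [phi_i] vanishes there. Its
    Laplacian is the [i]-th derivative of an approximate identity [rho], up to
    terms of order [c]. Green's identity against [phi_i], multiplied by a cutoff
    [chi] that removes the other faces and costs [O(1 / L)], expresses
    [div u (0)] times the mass of [rho] by the integral over the bottom face of
    the scalar product of [u] with twice the normal derivative of [psi]
    ([div_rho_bound]). The length of this normal derivative at [z] is at most
    [pole_mass z = q^(-n/2) sqrt (1 + n (n - 2) / q)] where [q = 1 + |z|^2], by
    Cauchy-Schwarz and [psi1_bottom_sqr], and the mass of [rho] is at least twice
    the integral of [q^(-n/2)] in the limit [c -> 0] ([rho_mass]). Hence
    [|div u (0)|] is at most the quotient of the integrals of [pole_mass] and of
    [q^(-n/2)] over [R^(n-1)].

    It remains to identify this quotient with the constant. By the divergence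
    theorem the integrals of [q^(-n/2-j)] satisfy, up to [O(1 / L)], the same
    recurrence in [j] as the integrals of [cos^(2j) sin^(n-2)] over [0, pi/2]
    ([moment_asymptotics]); approximating the square root by polynomials
    ([sqrt_approx]) gives the quotient of the integrals of
    [sqrt (1 + n (n - 2) cos^2) sin^(n-2)] and [sin^(n-2)] ([pole_mass_bound]).
    The factor [2 omega_(n-1) / omega_n] is the inverse of the second integral,
    by slicing balls ([D_constE]). *)

(** * Iterated integrals over boxes *)

Section Box.
Context {R : realType}.
Notation mu := (@lebesgue_measure R).
Implicit Types a b : nat -> R.

Definition vcons {m} (t : R) (y : 'rV[R]_m) : 'rV[R]_m.+1 :=
  \row_i (if unlift ord0 i is Some j then y 0 j else t).

Lemma vcons0 m t (y : 'rV[R]_m) : vcons t y 0 ord0 = t.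
Proof. by rewrite mxE unlift_none. Qed.

Lemma vconsS m t (y : 'rV[R]_m) j : vcons t y 0 (lift ord0 j) = y 0 j.
Proof. by rewrite mxE liftK. Qed.

Lemma vcons_eta m (y : 'rV[R]_m.+1) :
  y = vcons (y 0 ord0) (\row_j y 0 (lift ord0 j)).
Proof.
apply/rowP => i; case: (unliftP ord0 i) => [j|] ->.
  by rewrite vconsS mxE.
by rewrite vcons0.
Qed.

Lemma sum_vcons m t (y : 'rV[R]_m) (f : R -> R) :
  \sum_i f (vcons t y 0 i) = f t + \sum_i f (y 0 i).
Proof.
rewrite big_ord_recl vcons0; congr (_ + _).
by apply: eq_bigr => i _; rewrite vconsS.
Qed.

Definition in_box {n} a b : set 'rV[R]_n :=
  [set y | forall i : 'I_n, a i <= y 0 i <= b i].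

(** Iterated integral in the order of the coordinates. For continuous
    integrands the divergence theorem then follows one coordinate at a time, by
    differentiation under the integral sign. *)
Fixpoint box_int {n} : (nat -> R) -> (nat -> R) -> ('rV[R]_n -> R) -> R :=
  match n return (nat -> R) -> (nat -> R) -> ('rV[R]_n -> R) -> R with
  | 0%N => fun _ _ f => f 0
  | m.+1 => fun a b f => \int[mu]_(t in `[a 0%N, b 0%N])
      box_int (fun i => a i.+1) (fun i => b i.+1) (fun y => f (vcons t y))
  end.

Lemma in_box_vcons m a b t (y : 'rV[R]_m) : a 0%N <= t <= b 0%N ->
  in_box (fun i => a i.+1) (fun i => b i.+1) y -> in_box a b (vcons t y).
Proof.
move=> ht hy i; case: (unliftP ord0 i) => [j|] ->; last by rewrite vcons0.
by rewrite vconsS; exact: hy.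
Qed.

Lemma box_int_ext n a b (f g : 'rV[R]_n -> R) :
  (forall y, in_box a b y -> f y = g y) -> box_int a b f = box_int a b g.
Proof.
elim: n a b f g => [|m IH] a b f g fg /=; first by apply: fg => -[].
apply: eq_Rintegral => t; rewrite inE/= in_itv/= => ht.
by apply: IH => y hy; apply: fg; exact: in_box_vcons.
Qed.

Definition clamp {n} a b (y : 'rV[R]_n) : 'rV[R]_n :=
  \row_i Num.max (a i) (Num.min (y 0 i) (b i)).

Lemma clamp_id n a b (y : 'rV[R]_n) : in_box a b y -> clamp a b y = y.
Proof.
move=> hy; apply/rowP => i; rewrite mxE.
by have /andP[h1 h2] := hy i; rewrite min_l// max_r.
Qed.

Lemma in_box_clamp n a b (y : 'rV[R]_n) : (forall i, a i <= b i) ->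
  in_box a b (clamp a b y).
Proof.
move=> ab i; rewrite mxE le_max lexx/= ge_max ab/=.
by rewrite ge_min lexx orbT.
Qed.

Lemma cvg_row n (T : topologicalType) (f : T -> 'rV[R]_n) (x : T) :
  (forall i, {for x, continuous (fun z => f z 0 i)}) -> {for x, continuous f}.
Proof.
move=> H; apply/cvg_ballP => e e0.
have : \forall z \near x, forall i, ball (f x 0 i) e (f z 0 i).
  apply: filter_forall => i.
  by move/cvg_ballP: (H i) => /(_ e e0).
apply: filterS => z Hz; split => // i j; rewrite (ord1 i); exact: Hz.
Qed.

Lemma continuous_entry n (i : 'I_n) : continuous (fun y : 'rV[R]_n => y 0 i).
Proof. exact: coord_continuous. Qed.

Lemma clamp_continuous n a b : continuous (@clamp n a b).
Proof.
move=> y; apply: cvg_row => i.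
rewrite (_ : (fun z => _) =
  (fun z : 'rV[R]_n => Num.max (a i) (Num.min (z 0 i) (b i)))); last first.
  by apply/funext => z; rewrite mxE.
apply: (@continuous_max R 'rV[R]_n (cst (a i))); first exact: cst_continuous.
apply: (@continuous_min R 'rV[R]_n _ (cst (b i))); last exact: cst_continuous.
exact: continuous_entry.
Qed.

Lemma vcons_continuous m :
  continuous (fun p : 'rV[R]_m * R => vcons p.2 p.1).
Proof.
move=> p; apply: cvg_row => i; case: (unliftP ord0 i) => [j|] ->.
  rewrite (_ : (fun z => _) = (fun z : 'rV[R]_m * R => z.1 0 j)); last first.
    by apply/funext => z; rewrite vconsS.
  apply: (@continuous_comp _ _ _ fst (fun y : 'rV[R]_m => y 0 j)).
    exact: cvg_fst.
  exact: continuous_entry.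
rewrite (_ : (fun z => _) = snd); last by apply/funext => z; rewrite vcons0.
exact: cvg_snd.
Qed.

Lemma vconsr_continuous m t : continuous (@vcons m t).
Proof.
move=> y; apply: cvg_row => i; case: (unliftP ord0 i) => [j|] ->.
  rewrite (_ : (fun z => _) = (fun z : 'rV[R]_m => z 0 j)); last first.
    by apply/funext => z; rewrite vconsS.
  exact: continuous_entry.
rewrite (_ : (fun z => _) = cst t); last by apply/funext => z; rewrite vcons0.
exact: cst_continuous.
Qed.

(** Continuity on the closed box, phrased through the projection onto the box
    so that restricting to slices and pointwise algebra are immediate. *)
Definition box_continuous {n} a b (f : 'rV[R]_n -> R) :=
  continuous (f \o clamp a b).

Lemma box_continuousW n a b (f : 'rV[R]_n -> R) : (forall i, a i <= b i) ->
  (forall y, in_box a b y -> {for y, continuous f}) -> box_continuous a b f.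
Proof.
move=> ab cf y; apply: continuous_comp; first exact: clamp_continuous.
by apply: cf; exact: in_box_clamp.
Qed.

Lemma continuous_box n a b (f : 'rV[R]_n -> R) :
  continuous f -> box_continuous a b f.
Proof. by move=> cf y; apply: continuous_comp; [exact: clamp_continuous|exact: cf]. Qed.

Lemma clamp_vcons m a b t (y : 'rV[R]_m) : a 0%N <= t <= b 0%N ->
  clamp a b (vcons t y) =
  vcons t (clamp (fun i => a i.+1) (fun i => b i.+1) y).
Proof.
move=> /andP[ht1 ht2]; apply/rowP => i; case: (unliftP ord0 i) => [j|] ->.
  by rewrite vconsS !mxE liftK.
by rewrite vcons0 mxE vcons0 min_l// max_r.
Qed.

Lemma box_continuous_slice m a b (f : 'rV[R]_m.+1 -> R) t : a 0%N <= t <= b 0%N ->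
  box_continuous a b f ->
  box_continuous (fun i => a i.+1) (fun i => b i.+1)
    (fun y => f (vcons t y)).
Proof.
move=> ht cf.
rewrite /box_continuous (_ : _ \o _ = (fun y => (f \o clamp a b) (vcons t y))).
  move=> y; apply: (@continuous_comp _ _ _ (vcons t) (f \o clamp a b)).
    exact: vconsr_continuous.
  exact: cf.
by apply/funext => y /=; rewrite clamp_vcons.
Qed.

(** Uniform continuity in the first coordinate, by compactness of the box. *)
Lemma near_slice m a b (f : 'rV[R]_m.+1 -> R) t0 e : continuous f -> 0 < e ->
  \forall t \near t0, forall y : 'rV[R]_m, in_box a b y ->
    `|f (vcons t y) - f (vcons t0 y)| <= e.
Proof.
move=> cf e0.
have cK : compact (in_box a b : set 'rV[R]_m).
  have := @rV_compact R m (fun i => [set x | a i <= x <= b i]).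
  apply=> i; have := @segment_compact R (a i) (b i).
  by congr compact; apply/seteqP; split => x /=; rewrite in_itv.
pose P t (y : 'rV[R]_m) := `|f (vcons t y) - f (vcons t0 y)| <= e.
move/compact_near_coveringP : cK => /(_ R (nbhs t0) P _).
suff H : forall y, in_box a b y -> \forall y' \near y & t \near t0, P t y'.
  by move=> /(_ H).
move=> y _.
have e20 : 0 < e / 2 by rewrite divr_gt0.
pose h1 (p : 'rV[R]_m * R) := f (vcons p.2 p.1).
pose h2 (p : 'rV[R]_m * R) := f (vcons t0 p.1).
have c1 : {for (y, t0), continuous h1}.
  apply: (@continuous_comp _ _ _ (fun p : 'rV[R]_m * R => vcons p.2 p.1) f);
    last exact: cf.
  exact: vcons_continuous.
have c2 : {for (y, t0), continuous h2}.
  apply: (@continuous_comp _ _ _ (fun p : 'rV[R]_m * R => vcons t0 p.1) f);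
    last exact: cf.
  apply: (@continuous_comp _ _ _ fst (vcons t0)); first exact: cvg_fst.
  exact: vconsr_continuous.
move/cvgrPdist_lt : c1 => /(_ _ e20) c1.
move/cvgrPdist_lt : c2 => /(_ _ e20) c2.
have : \forall p \near (y, t0), P p.2 p.1.
  near=> p; rewrite /P -/(h1 p) -/(h2 p).
  rewrite -(subrK (f (vcons t0 y)) (h1 p)) -addrA.
  rewrite (le_trans (ler_normD _ _))// (splitr e) lerD//.
    by rewrite distrC ltW//; near: p.
  by rewrite ltW//; near: p.
by apply.
Unshelve. all: by end_near. Qed.

End Box.

(** * Linearity and monotonicity of the integral *)

Section BoxIntegral.
Context {R : realType}.
Notation mu := (@lebesgue_measure R).
Implicit Types a b : nat -> R.

Lemma itv_integrable (a b : R) (f : R -> R) :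
  {within `[a, b], continuous f} -> mu.-integrable `[a, b] (EFin \o f).
Proof.
by move=> cf; apply: continuous_compact_integrable => //; exact: segment_compact.
Qed.

Lemma itv_int_cst (a b c : R) : a <= b ->
  \int[mu]_(t in `[a, b]) c = c * (b - a).
Proof.
move=> ab; rewrite Rintegral_cst//; congr (_ * _).
rewrite [X in fine X](_ : _ = (b - a)%:E)//.
rewrite [LHS]lebesgue_measure_itv/= lte_fin; case: ltgtP ab => // ->.
by rewrite subrr.
Qed.

Definition box_vol n a b : R := \prod_(i < n) (b i - a i).

Lemma box_volS m a b : box_vol m.+1 a b =
  (b 0%N - a 0%N) * box_vol m (fun i => a i.+1) (fun i => b i.+1).
Proof. by rewrite /box_vol big_ord_recl. Qed.

Lemma box_vol_ge0 n a b : (forall i, a i <= b i) -> 0 <= box_vol n a b.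
Proof. by move=> ab; apply: prodr_ge0 => i _; rewrite subr_ge0. Qed.

Lemma box_int_cst n a b c : (forall i, a i <= b i) ->
  box_int a b (fun _ : 'rV[R]_n => c) = c * box_vol n a b.
Proof.
elim: n a b => [|m IH] a b ab /=; first by rewrite /box_vol big_ord0 mulr1.
under eq_Rintegral do rewrite IH//.
by rewrite itv_int_cst// box_volS mulrCA mulrC mulrA.
Qed.

Lemma box_continuous_lin n a b (f g : 'rV[R]_n -> R) k :
  box_continuous a b f -> box_continuous a b g ->
  box_continuous a b (fun y => f y + k * g y).
Proof.
move=> cf cg y; apply: (continuousD (cf y)).
exact: (continuousM (@cst_continuous _ _ k _) (cg y)).
Qed.

(* Linearity and monotonicity in dimension [n] give the continuity in [t] of the
   integrals over slices, which in turn makes them integrable and gives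
   linearity and monotonicity in dimension [n + 1]. *)
Let linear_monotone n := forall a b, (forall i, a i <= b i) ->
  forall (f g : 'rV[R]_n -> R) k, box_continuous a b f -> box_continuous a b g ->
  box_int a b (fun y => f y + k * g y) = box_int a b f + k * box_int a b g /\
  ((forall y, in_box a b y -> f y <= g y) -> box_int a b f <= box_int a b g).

Let slice_continuous m := forall a b, (forall i, a i <= b i) ->
  forall f : 'rV[R]_m.+1 -> R, box_continuous a b f ->
  {within `[a 0%N, b 0%N], continuous (fun t =>
    box_int (fun i => a i.+1) (fun i => b i.+1) (fun y => f (vcons t y)))}.

Let linear_monotone_slice m : linear_monotone m -> slice_continuous m.
Proof.
move=> LM a b ab f cf.
set a' := fun i => a i.+1; set b' := fun i => b i.+1.
have ab' i : a' i <= b' i by exact: ab.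
pose g t := box_int a' b' (fun y => (f \o clamp a b) (vcons t y)).
have fg t : t \in `[a 0%N, b 0%N] -> g t = box_int a' b' (fun y => f (vcons t y)).
  rewrite in_itv/= => ht; apply: box_int_ext => y hy /=.
  by rewrite clamp_id//; exact: in_box_vcons.
apply: (@subspace_eq_continuous _ _ _ (g : R -> R)).
  by move=> t; rewrite inE => ht; apply: fg.
apply: continuous_subspaceT => t0.
apply/cvgrPdist_lt => e e0.
pose v := box_vol m a' b' + 1.
have v0 : 0 < v by rewrite ltr_wpDl// box_vol_ge0.
have e'0 : 0 < e / v by rewrite divr_gt0.
near=> t.
have ct s : box_continuous a' b' (fun y => (f \o clamp a b) (vcons s y)).
  apply: continuous_box => y; apply: (@continuous_comp _ _ _ (vcons s) (f \o clamp a b)).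
    exact: vconsr_continuous.
  exact: cf.
have H : forall y, in_box a' b' y ->
    `|(f \o clamp a b) (vcons t y) - (f \o clamp a b) (vcons t0 y)| <= e / v.
  by near: t; exact: near_slice.
have cc : box_continuous a' b' (fun _ : 'rV[R]_m => e / v) by apply: continuous_box; exact: cst_continuous.
have bnd s1 s2 : (forall y, in_box a' b' y ->
    (f \o clamp a b) (vcons s1 y) <= (f \o clamp a b) (vcons s2 y) + 1 * (e / v)) ->
    g s1 <= g s2 + e / v * box_vol m a' b'.
  move=> h; have [E _] := LM a' b' ab' _ _ 1 (ct s2) cc.
  rewrite -box_int_cst// -[X in _ + X]mul1r -E.
  apply: (LM a' b' ab' _ _ 0 (ct s1) _).2 => //.
  exact: box_continuous_lin.
have lt_e : e / v * box_vol m a' b' < e.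
  by rewrite mulrAC ltr_pdivrMr// ltr_pM2l// /v ltrDl.
rewrite ltr_norml; apply/andP; split.
- rewrite ltrBrDr addrC ltrBlDr (le_lt_trans (bnd t t0 _)) ?ltrD2l//.
  move=> y hy; have := H y hy; rewrite ler_norml => /andP[_].
  by rewrite mul1r lerBlDr addrC.
- rewrite ltrBlDl (le_lt_trans (bnd t0 t _)) ?ltrD2l//.
  move=> y hy; have := H y hy; rewrite ler_norml => /andP[+ _].
  by rewrite mul1r; lra.
Unshelve. all: by end_near. Qed.

Let slice_linear_monotone m :
  linear_monotone m -> slice_continuous m -> linear_monotone m.+1.
Proof.
move=> LM SC a b ab f g k cf cg.
set a' := fun i => a i.+1; set b' := fun i => b i.+1.
have ab' i : a' i <= b' i by exact: ab.
have sf t : t \in `[a 0%N, b 0%N] -> box_continuous a' b' (fun y => f (vcons t y)).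
  by rewrite in_itv/= => ht; exact: box_continuous_slice.
have sg t : t \in `[a 0%N, b 0%N] -> box_continuous a' b' (fun y => g (vcons t y)).
  by rewrite in_itv/= => ht; exact: box_continuous_slice.
have If := itv_integrable _ _ _ (SC a b ab f cf).
have Ig := itv_integrable _ _ _ (SC a b ab g cg).
split=> [|fg] /=.
  rewrite -RintegralZl// -RintegralD//; last first.
    apply: (@integrableZl _ _ _ mu `[a 0%N, b 0%N] _ k
      (EFin \o fun t => box_int a' b' (fun y => g (vcons t y)))) => //.
  apply: eq_Rintegral => t; rewrite inE => ht.
  exact: (LM a' b' ab' _ _ k (sf t ht) (sg t ht)).1.
apply: le_Rintegral => // t ht.
apply: (LM a' b' ab' _ _ 0 (sf t ht) (sg t ht)).2 => y hy.
by apply: fg; apply: in_box_vcons => //; move: ht; rewrite /= in_itv.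
Qed.

Let linear_monotoneT n : linear_monotone n.
Proof.
elim: n => [|m IH].
  by move=> a b ab f g k cf cg /=; split => // H; apply: H => -[].
by apply: slice_linear_monotone => //; exact: linear_monotone_slice.
Qed.

Lemma box_int_slice_continuous m a b (f : 'rV[R]_m.+1 -> R) :
  (forall i, a i <= b i) -> box_continuous a b f ->
  {within `[a 0%N, b 0%N], continuous (fun t =>
    box_int (fun i => a i.+1) (fun i => b i.+1) (fun y => f (vcons t y)))}.
Proof. by move=> ab; exact: linear_monotone_slice. Qed.

Section Linear.
Context {n : nat} {a b : nat -> R}.
Hypothesis ab : forall i, a i <= b i.
Implicit Types f g : 'rV[R]_n -> R.

Lemma box_int_lin f g k : box_continuous a b f -> box_continuous a b g ->
  box_int a b (fun y => f y + k * g y) = box_int a b f + k * box_int a b g.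
Proof. by move=> cf cg; exact: (linear_monotoneT n a b ab f g k cf cg).1. Qed.

Lemma le_box_int f g : box_continuous a b f -> box_continuous a b g ->
  (forall y, in_box a b y -> f y <= g y) -> box_int a b f <= box_int a b g.
Proof. by move=> cf cg; exact: (linear_monotoneT n a b ab f g 0 cf cg).2. Qed.

Lemma box_continuous_cst (c : R) : box_continuous a b (fun _ : 'rV[R]_n => c).
Proof. by apply: continuous_box; exact: cst_continuous. Qed.

Lemma box_continuousD f g : box_continuous a b f -> box_continuous a b g ->
  box_continuous a b (fun y => f y + g y).
Proof. by move=> cf cg y; exact: (continuousD (cf y) (cg y)). Qed.

Lemma box_continuousM f g : box_continuous a b f -> box_continuous a b g ->
  box_continuous a b (fun y => f y * g y).
Proof. by move=> cf cg y; exact: (continuousM (cf y) (cg y)). Qed.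

Lemma box_continuousN f : box_continuous a b f ->
  box_continuous a b (fun y => - f y).
Proof. by move=> cf y; exact: (continuousN (cf y)). Qed.

Lemma box_continuousB f g : box_continuous a b f -> box_continuous a b g ->
  box_continuous a b (fun y => f y - g y).
Proof. by move=> cf cg y; exact: (continuousB (cf y) (cg y)). Qed.

Lemma box_continuous_sum (I : Type) (r : seq I) (F : I -> 'rV[R]_n -> R) :
  (forall i, box_continuous a b (F i)) ->
  box_continuous a b (fun y => \sum_(i <- r) F i y).
Proof.
move=> cF; elim: r => [|i r IH].
  by under [X in box_continuous _ _ X]eq_fun do rewrite big_nil;
    exact: box_continuous_cst.
by under [X in box_continuous _ _ X]eq_fun do rewrite big_cons;
  exact: box_continuousD.
Qed.

Lemma box_intD f g : box_continuous a b f -> box_continuous a b g ->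
  box_int a b (fun y => f y + g y) = box_int a b f + box_int a b g.
Proof.
move=> cf cg; rewrite -[X in _ = _ + X]mul1r -box_int_lin//.
by congr box_int; apply/funext => y; rewrite mul1r.
Qed.

Lemma box_intB f g : box_continuous a b f -> box_continuous a b g ->
  box_int a b (fun y => f y - g y) = box_int a b f - box_int a b g.
Proof.
move=> cf cg; rewrite -[X in _ = _ + X]mulN1r -box_int_lin//.
by congr box_int; apply/funext => y; rewrite mulN1r.
Qed.

Lemma box_intZ k f : box_continuous a b f ->
  box_int a b (fun y => k * f y) = k * box_int a b f.
Proof.
move=> cf; have := box_int_lin _ _ k (box_continuous_cst 0) cf.
rewrite box_int_cst// mul0r add0r => <-.
by congr box_int; apply/funext => y; rewrite add0r.
Qed.

Lemma box_intN f : box_continuous a b f ->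
  box_int a b (fun y => - f y) = - box_int a b f.
Proof.
move=> cf; rewrite -mulN1r -box_intZ//.
by congr box_int; apply/funext => y; rewrite mulN1r.
Qed.

Lemma box_int_sum (I : Type) (r : seq I) (F : I -> 'rV[R]_n -> R) :
  (forall i, box_continuous a b (F i)) ->
  box_int a b (fun y => \sum_(i <- r) F i y) = \sum_(i <- r) box_int a b (F i).
Proof.
move=> cF; elim: r => [|i r IH].
  under [X in box_int _ _ X]eq_fun do rewrite big_nil.
  by rewrite box_int_cst// mul0r big_nil.
under [X in box_int _ _ X]eq_fun do rewrite big_cons.
by rewrite box_intD ?IH ?big_cons//; exact: box_continuous_sum.
Qed.

Lemma box_int_ge0 f : (forall y, in_box a b y -> 0 <= f y) ->
  box_continuous a b f -> 0 <= box_int a b f.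
Proof.
move=> f0 cf; rewrite -[X in X <= _](mul0r (box_vol n a b)) -box_int_cst//.
by apply: le_box_int => //; exact: box_continuous_cst.
Qed.

Lemma le_norm_box_int f g : box_continuous a b f -> box_continuous a b g ->
  (forall y, in_box a b y -> `|f y| <= g y) -> `|box_int a b f| <= box_int a b g.
Proof.
move=> cf cg fg; rewrite ler_norml -box_intN//; apply/andP; split.
  apply: le_box_int => //; first exact: box_continuousN.
  by move=> y /fg; rewrite ler_norml => /andP[].
by apply: le_box_int => // y /fg; rewrite ler_norml => /andP[].
Qed.

End Linear.

Lemma subset_box_int n a b a' b' (f : 'rV[R]_n -> R) :
  (forall i, a' i <= a i) -> (forall i, a i <= b i) -> (forall i, b i <= b' i) ->
  box_continuous a' b' f ->
  (forall y, in_box a' b' y -> 0 <= f y) -> box_int a b f <= box_int a' b' f.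
Proof.
elim: n a b a' b' f => [|m IH] a b a' b' f aa ab bb cf f0 //=.
have ab' i : a' i <= b' i by exact: le_trans (le_trans (aa i) (ab i)) (bb i).
have sub : `[a 0%N, b 0%N] `<=` `[a' 0%N, b' 0%N].
  by apply: subset_itv; rewrite bnd_simp.
pose h t := box_int (fun i => a' i.+1) (fun i => b' i.+1) (fun y => f (vcons t y)).
have ch : mu.-integrable `[a' 0%N, b' 0%N] (EFin \o h).
  by apply: itv_integrable; exact: box_int_slice_continuous.
have h0 t : t \in `[a' 0%N, b' 0%N] -> 0 <= h t.
  rewrite in_itv/= => ht; apply: box_int_ge0 => //.
    by move=> y hy; apply: f0; exact: in_box_vcons.
  exact: box_continuous_slice.
apply: (@le_trans _ _ (\int[mu]_(t in `[a 0%N, b 0%N]) h t)).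
  apply: le_Rintegral => //.
  - apply: itv_integrable; apply: box_int_slice_continuous => // y.
    rewrite (_ : _ \o _ = (f \o clamp a' b') \o clamp a b).
      apply: continuous_comp; first exact: clamp_continuous.
      exact: cf.
    apply/funext => z /=; rewrite [in RHS]clamp_id// => i.
    have /andP[h1 h2] := in_box_clamp m.+1 a b z ab i.
    by rewrite (le_trans (aa i))//= (le_trans h2).
  - exact: integrableS ch.
  - move=> t ht; have ht' := sub t ht.
    apply: IH => //.
      by apply: box_continuous_slice => //; move: ht'; rewrite /= in_itv.
    by move=> y hy; apply: f0; apply: in_box_vcons => //; move: ht'; rewrite /= in_itv.
rewrite /Rintegral fine_le//.
- by apply: integrable_fin_num => //; exact: integrableS ch.
- exact: integrable_fin_num.
- by apply: ge0_subset_integral => //; exact: (measurable_int mu).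
Qed.

End BoxIntegral.

(** * The divergence theorem on a box *)

Section Gauss.
Context {R : realType}.
Notation mu := (@lebesgue_measure R).
Implicit Types a b : nat -> R.

Lemma is_derive_line {V : normedModType R} (f : V -> R) (x v : V) (s d : R) :
  is_derive s 1 (fun h => f (x + h *: v)) d <-> is_derive (x + s *: v) v f d.
Proof.
have E : (fun h : R => h^-1 *: (((fun h => f (x + h *: v)) \o shift s) (h *: 1) -
    f (x + s *: v))) =
  (fun h : R => h^-1 *: ((f \o shift (x + s *: v)) (h *: v) - f (x + s *: v))).
  apply/funext => h /=; congr (_ *: (f _ - _)).
  by rewrite addrCA -scalerDl /GRing.scale/= mulr1.
by split=> -[H1 H2]; constructor; move: H1 H2; rewrite /derivable /derive E.
Qed.

Lemma is_derive_comp_real {V : normedModType R} (g : R -> R) (f : V -> R)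
    (x v : V) (dg df : R) :
  is_derive (f x) 1 g dg -> is_derive x v f df ->
  is_derive x v (fun y => g (f y)) (dg * df).
Proof.
move=> Hg Hf.
have H0 y : y = y + (0 : R) *: v by rewrite scale0r addr0.
have : is_derive (x + (0 : R) *: v) v f df by rewrite -H0.
move=> /is_derive_line Hf'.
rewrite [X in is_derive X](H0 x); apply/is_derive_line.
apply: (@is_derive1_comp _ g (fun h => f (x + h *: v))).
by rewrite -H0.
Qed.

Lemma is_derive1_cvg (f : R -> R) (x d : R) :
  (fun h => h^-1 * (f (x + h) - f x)) @ 0^' --> d -> is_derive x 1 f d.
Proof.
move=> H.
have E : (fun h : R => h^-1 *: ((f \o shift x) (h *: 1) - f x)) =
    (fun h => h^-1 * (f (x + h) - f x)).
  by apply/funext => h /=; rewrite /GRing.scale/= mulr1 (addrC h x).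
constructor; first by rewrite /derivable E; apply/cvg_ex; exists d.
by rewrite /derive E; exact: cvg_lim.
Qed.

Lemma is_derive1_continuous (f : R -> R) (x d : R) :
  is_derive x 1 f d -> {for x, continuous f}.
Proof.
by move=> Hf; apply/differentiable_continuous/derivable1_diffP; exact: ex_derive.
Qed.

(** The mean value theorem with no assumption on the order of the endpoints. *)
Lemma MVT_between (f df : R -> R) (c x : R) :
  (forall s, `|s - c| <= `|x - c| -> is_derive s 1 f (df s)) ->
  exists2 s, `|s - c| <= `|x - c| & f x - f c = df s * (x - c).
Proof.
move=> H; have [cx|xc|->] := ltgtP c x; last first.
- by exists x; rewrite !subrr ?mulr0.
- have P s : x <= s <= c -> `|s - c| <= `|x - c|.
    move=> /andP[h1 h2]; rewrite (ler0_norm (_ : s - c <= 0)) ?subr_le0// (ler0_norm (_ : x - c <= 0)) ?subr_le0 ?(ltW xc)//; lra.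
  have [| |s] := @MVT _ f df x c xc.
  + by move=> s; rewrite in_itv/= => /andP[/ltW h1 /ltW h2]; apply/H/P/andP.
  + apply: continuous_in_subspaceT => s; rewrite inE/= in_itv/= => hs.
    exact/(@is_derive1_continuous f s (df s))/H/P.
  + rewrite in_itv/= => /andP[/ltW h1 /ltW h2] E; exists s; first exact/P/andP.
    by rewrite -opprB E -mulrN opprB.
- have P s : c <= s <= x -> `|s - c| <= `|x - c|.
    move=> /andP[h1 h2]; rewrite (ger0_norm (_ : 0 <= s - c)) ?subr_ge0// (ger0_norm (_ : 0 <= x - c)) ?subr_ge0 ?(ltW cx)//; lra.
  have [| |s] := @MVT _ f df c x cx.
  + by move=> s; rewrite in_itv/= => /andP[/ltW h1 /ltW h2]; apply/H/P/andP.
  + apply: continuous_in_subspaceT => s; rewrite inE/= in_itv/= => hs.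
    exact/(@is_derive1_continuous f s (df s))/H/P.
  + by rewrite in_itv/= => /andP[/ltW h1 /ltW h2] E; exists s => //; exact/P/andP.
Qed.

Lemma vcons_shift m t s (y : 'rV[R]_m) :
  vcons s y = vcons t y + (s - t) *: delta_mx 0 ord0.
Proof.
apply/rowP => i; rewrite !mxE eqxx/=.
case: (unliftP ord0 i) => [j|] ->; last by rewrite mulr1 subrKC.
by rewrite mulr0 addr0.
Qed.

Lemma vcons_slice m t s (y : 'rV[R]_m) (i : 'I_m) :
  vcons t (y + s *: delta_mx 0 i) = vcons t y + s *: delta_mx 0 (lift ord0 i).
Proof.
apply/rowP => k; rewrite !mxE eqxx/=.
case: (unliftP ord0 k) => [j|] ->; last by rewrite mulr0 addr0.
by rewrite !mxE (inj_eq lift_inj).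
Qed.

(** Differentiation under the integral sign: on a box the difference quotients
    converge uniformly, because the derivative is uniformly continuous. *)
Lemma box_int_derive m a b (F F' : 'rV[R]_m.+1 -> R) t :
  (forall i, a i <= b i) -> a 0%N < t < b 0%N ->
  box_continuous a b F -> box_continuous a b F' ->
  (forall y, in_box a b y -> a 0%N < y 0 ord0 < b 0%N ->
    is_derive y (delta_mx 0 ord0) F (F' y)) ->
  is_derive t 1
    (fun s => box_int (fun i => a i.+1) (fun i => b i.+1) (fun y => F (vcons s y)))
    (box_int (fun i => a i.+1) (fun i => b i.+1) (fun y => F' (vcons t y))).
Proof.
move=> ab ht cF cF' dF.
set a' := fun i => a i.+1; set b' := fun i => b i.+1.
have ab' i : a' i <= b' i by exact: ab.
apply: is_derive1_cvg; apply/cvgrPdist_le => e e0.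
pose v := box_vol m a' b' + 1.
have v0 : 0 < v by rewrite ltr_wpDl// box_vol_ge0.
have e'0 : 0 < e / v by rewrite divr_gt0.
have := near_slice m a' b' _ t (e / v) cF' e'0.
move=> /nbhs_ballP[d /= d0 Hd].
have [/andP[at0 tb0]] := ht.
near=> h.
have h0 : h != 0 by near: h; exact: nbhs_dnbhs_neq.
have hr : `|h| < d /\ `|h| < t - a 0%N /\ `|h| < b 0%N - t.
  have : `|h| < Num.min d (Num.min (t - a 0%N) (b 0%N - t)).
    near: h; apply: dnbhs0_lt; rewrite !lt_min d0/= !subr_gt0 at0//.
  by rewrite !lt_min => /and3P[].
have [hd [ha hb]] := hr.
have in0 s : `|s - t| <= `|h| -> a 0%N < s < b 0%N.
  move=> hs; have := le_lt_trans hs ha; have := le_lt_trans hs hb.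
  by rewrite !ltr_norml; lra.
have in1 s : `|s - t| <= `|h| -> a 0%N <= s <= b 0%N.
  by move=> /in0 /andP[/ltW -> /ltW ->].
have th : `|t + h - t| <= `|h| by rewrite addrAC subrr add0r.
have tt : `|t - t| <= `|h| by rewrite subrr normr0.
have st s : `|s - t| <= `|h| -> box_continuous a' b' (fun y => F (vcons s y)).
  by move=> hs; exact: box_continuous_slice (in1 s hs) cF.
have st' s : `|s - t| <= `|h| -> box_continuous a' b' (fun y => F' (vcons s y)).
  by move=> hs; exact: box_continuous_slice (in1 s hs) cF'.
rewrite distrC.
rewrite -(box_intB ab' _ _ (st _ th) (st _ tt)).
rewrite -(box_intZ ab'); last exact: box_continuousB (st _ th) (st _ tt).
rewrite -(box_intB ab'); last 2 first.
- apply: box_continuousM (box_continuous_cst _) _ .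
  exact: box_continuousB (st _ th) (st _ tt).
- exact: st' tt.
apply: (@le_trans _ _ (e / v * box_vol m a' b')); last first.
  by rewrite mulrAC ler_pdivrMr// ler_pM2l// /v lerDl.
rewrite -(box_int_cst m a' b' _ ab'); apply: le_norm_box_int => //.
- apply: box_continuousB (st' _ tt).
  apply: box_continuousM (box_continuous_cst _) _ .
  exact: box_continuousB (st _ th) (st _ tt).
- exact: box_continuous_cst.
move=> y hy.
have [s hs ->] : exists2 s, `|s - t| <= `|h| &
    F (vcons (t + h) y) - F (vcons t y) = F' (vcons s y) * h.
  have [|s] := @MVT_between (fun s => F (vcons s y)) (fun s => F' (vcons s y)) t (t + h).
    move=> s; rewrite addrAC subrr add0r => hs.
    have E : (fun s => F (vcons s y)) =
        (fun s => F (vcons 0 y + s *: delta_mx 0 ord0)).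
      by apply/funext => r; rewrite (vcons_shift m 0 r y) subr0.
    rewrite E is_derive_line -[X in X *: _]subr0 -vcons_shift.
    apply: dF; first exact: in_box_vcons (in1 _ hs) hy.
    by rewrite vcons0; exact: in0.
  by rewrite addrAC subrr add0r => hs E; exists s.
rewrite mulrC mulfK//.
have := Hd s; rewrite /ball/= distrC => /(_ (le_lt_trans hs hd)) /(_ y hy) /=.
rewrite !clamp_id//; [exact: in_box_vcons (in1 _ tt) hy|
  exact: in_box_vcons (in1 _ hs) hy].
Unshelve. all: by end_near. Qed.

Lemma within_LR (G : R -> R) (x y : R) : x < y ->
  {within `[x, y], continuous G} -> G @ x^'+ --> G x /\ G @ y^'- --> G y.
Proof. by move=> xy /(continuous_within_itvP _ xy)[]. Qed.

(** In the first coordinate the divergence theorem is the fundamental theorem of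
    calculus for the integrals over slices. *)
Lemma box_int_gauss0 m a b (F F' : 'rV[R]_m.+1 -> R) :
  (forall i, a i <= b i) -> a 0%N < b 0%N ->
  box_continuous a b F -> box_continuous a b F' ->
  (forall y, in_box a b y -> a 0%N < y 0 ord0 < b 0%N ->
    is_derive y (delta_mx 0 ord0) F (F' y)) ->
  box_int a b F' =
    box_int (fun i => a i.+1) (fun i => b i.+1) (fun y => F (vcons (b 0%N) y)) -
    box_int (fun i => a i.+1) (fun i => b i.+1) (fun y => F (vcons (a 0%N) y)).
Proof.
move=> ab ab0 cF cF' dF /=.
set a' := fun i => a i.+1; set b' := fun i => b i.+1.
pose G t := box_int a' b' (fun y => F (vcons t y)).
have dG t : t \in `]a 0%N, b 0%N[ ->
    is_derive t 1 G (box_int a' b' (fun y => F' (vcons t y))).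
  by rewrite in_itv/= => ht; exact: box_int_derive.
have [G1 G2] := within_LR _ _ _ ab0 (box_int_slice_continuous m a b F ab cF).
rewrite /Rintegral (@continuous_FTC2 _ _ G)//.
- exact: box_int_slice_continuous.
- by split => // t ht; have [] := dG t ht.
- by move=> t ht; rewrite derive1E; have [] := dG t ht.
Qed.

Definition vset {n} (i : 'I_n) (s : R) (y : 'rV[R]_n) : 'rV[R]_n :=
  \row_j (if j == i then s else y 0 j).

Lemma vset_vcons0 m s t (y : 'rV[R]_m) : vset ord0 s (vcons t y) = vcons s y.
Proof.
apply/rowP => i; case: (unliftP ord0 i) => [j|] ->; rewrite !mxE.
  by rewrite liftK.
by rewrite eqxx unlift_none.
Qed.

Lemma vset_vconsS m s t (y : 'rV[R]_m) i :
  vset (lift ord0 i) s (vcons t y) = vcons t (vset i s y).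
Proof.
apply/rowP => k; case: (unliftP ord0 k) => [j|] ->; rewrite !mxE.
  by rewrite (inj_eq lift_inj) liftK mxE.
by rewrite unlift_none.
Qed.

Lemma in_box_vset n a b (i : 'I_n) s (y : 'rV[R]_n) : a i <= s <= b i ->
  in_box a b y -> in_box a b (vset i s y).
Proof. by move=> hs hy j; rewrite mxE; case: eqP => [->//|_]; exact: hy. Qed.

Lemma vset_continuous n (i : 'I_n) s : continuous (vset i s).
Proof.
move=> y; apply: cvg_row => j; have [->|ji] := eqVneq j i.
  rewrite (_ : (fun z => _) = cst s); first exact: cst_continuous.
  by apply/funext => z; rewrite mxE eqxx.
rewrite (_ : (fun z => _) = (fun z : 'rV[R]_n => z 0 j)).
  exact: continuous_entry.
by apply/funext => z; rewrite mxE (negPf ji).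
Qed.

Lemma box_continuous_vset n a b (i : 'I_n) s (f : 'rV[R]_n -> R) :
  (forall i, a i <= b i) ->
  a i <= s <= b i -> box_continuous a b f ->
  box_continuous a b (fun y => f (vset i s y)).
Proof.
move=> ab hs cf.
rewrite /box_continuous (_ : _ \o _ = (f \o clamp a b) \o (vset i s \o clamp a b)).
  move=> y; apply: continuous_comp; last exact: cf.
  by apply: continuous_comp; [exact: clamp_continuous|exact: vset_continuous].
apply/funext => y /=; rewrite [in RHS]clamp_id//.
by apply: in_box_vset => //; exact: in_box_clamp.
Qed.

(** Here the boundary term is averaged over the box, which expresses it without
    a box of lower dimension. *)
Lemma box_int_gauss n a b (i : 'I_n) (F F' : 'rV[R]_n -> R) :
  (forall i, a i <= b i) -> a i < b i ->
  box_continuous a b F -> box_continuous a b F' ->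
  (forall y, in_box a b y -> a i < y 0 i < b i ->
    is_derive y (delta_mx 0 i) F (F' y)) ->
  box_int a b F' =
    box_int a b (fun y => (b i - a i)^-1 * (F (vset i (b i) y) - F (vset i (a i) y))).
Proof.
elim: n a b i F F' => [|m IH] a b i F F' ab abi cF cF' dF; first by case: i abi dF.
move: abi dF; case: (unliftP ord0 i) => [j|] -> abi dF; last first.
  rewrite (box_int_gauss0 m a b F F')//=.
  under eq_Rintegral do under [X in box_int _ _ X]eq_fun do rewrite !vset_vcons0.
  rewrite itv_int_cst//.
  set a' := fun i => a i.+1; set b' := fun i => b i.+1.
  have ab' i0 : a' i0 <= b' i0 by exact: ab.
  have c1 : box_continuous a' b' (fun y => F (vcons (b 0%N) y)).
    by apply: box_continuous_slice => //; rewrite ab lexx.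
  have c2 : box_continuous a' b' (fun y => F (vcons (a 0%N) y)).
    by apply: box_continuous_slice => //; rewrite ab lexx.
  rewrite (box_intZ ab'); last exact: box_continuousB.
  by rewrite (box_intB ab')// mulrC mulrA divff ?mul1r// subr_eq0 gt_eqF.
rewrite /=; apply: eq_Rintegral => t; rewrite inE/= in_itv/= => ht.
under [X in _ = box_int _ _ X]eq_fun do rewrite !vset_vconsS.
apply: (IH (fun i => a i.+1) (fun i => b i.+1) j (fun y => F (vcons t y))) => //.
- exact: box_continuous_slice.
- exact: box_continuous_slice.
move=> y hy hj.
have H0 : y = y + (0 : R) *: delta_mx 0 j by rewrite scale0r addr0.
rewrite [X in is_derive X]H0; apply/is_derive_line.
under [X in is_derive _ _ X]eq_fun do rewrite vcons_slice.
apply/is_derive_line; rewrite scale0r addr0; apply: dF.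
  exact: in_box_vcons.
by rewrite vconsS.
Qed.

End Gauss.

(** * Radial kernels *)

Section Calculus.
Context {R : realType} {V : normedModType R}.
Implicit Types (f g : V -> R) (x v : V).

Lemma is_derive_addr f g x v (df dg : R) :
  is_derive x v f df -> is_derive x v g dg ->
  is_derive x v (fun y => f y + g y) (df + dg).
Proof. exact: is_deriveD. Qed.

Lemma is_derive_subr f g x v (df dg : R) :
  is_derive x v f df -> is_derive x v g dg ->
  is_derive x v (fun y => f y - g y) (df - dg).
Proof. exact: is_deriveB. Qed.

Lemma is_derive_mulr f g x v (df dg : R) :
  is_derive x v f df -> is_derive x v g dg ->
  is_derive x v (fun y => f y * g y) (df * g x + f x * dg).
Proof.
move=> Hf Hg; have := is_deriveM Hf Hg.
by rewrite /GRing.scale/= addrC [g x * _]mulrC.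
Qed.

Lemma is_derive_cstr x v (k : R) : is_derive x v (fun=> k) 0.
Proof. exact: is_derive_cst. Qed.

Lemma is_derive_scaler f x v (k df : R) :
  is_derive x v f df -> is_derive x v (fun y => k * f y) (k * df).
Proof. exact: is_deriveZ. Qed.

Lemma is_derive_expr f x v (k : nat) (df : R) :
  is_derive x v f df ->
  is_derive x v (fun y => f y ^+ k) (k%:R * f x ^+ k.-1 * df).
Proof. by move=> Hf; have := is_deriveX k Hf; rewrite exprfctE. Qed.

Lemma is_derive_sumr n (f : 'I_n -> V -> R) (df : 'I_n -> R) x v :
  (forall i, is_derive x v (f i) (df i)) ->
  is_derive x v (fun y => \sum_i f i y) (\sum_i df i).
Proof. by move=> H; have := is_derive_sum H; rewrite fct_sumE. Qed.

End Calculus.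

Section ContinuousFunctions.
Context {R : realType} {T : topologicalType}.
Implicit Types f g : T -> R.

Lemma continuous_addr f g : continuous f -> continuous g ->
  continuous (fun y => f y + g y).
Proof. by move=> cf cg y; exact: (continuousD (cf y) (cg y)). Qed.

Lemma continuous_subr f g : continuous f -> continuous g ->
  continuous (fun y => f y - g y).
Proof. by move=> cf cg y; exact: (continuousB (cf y) (cg y)). Qed.

Lemma continuous_mulr f g : continuous f -> continuous g ->
  continuous (fun y => f y * g y).
Proof. by move=> cf cg y; exact: (continuousM (cf y) (cg y)). Qed.

Lemma continuous_expr f k : continuous f -> continuous (fun y => f y ^+ k).
Proof.
by move=> cf y; exact: (continuous_comp (cf y) (@exprn_continuous R k (f y))).
Qed.

Lemma continuous_cstr (k : R) : continuous (fun _ : T => k).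
Proof. exact: cst_continuous. Qed.

Lemma continuous_sumr (I : Type) (r : seq I) (F : I -> T -> R) :
  (forall i, continuous (F i)) -> continuous (fun y => \sum_(i <- r) F i y).
Proof. by move=> cF; apply: continuous_big => //; exact: add_continuous. Qed.

Lemma continuous_sqrtr f : continuous f -> continuous (fun y => Num.sqrt (f y)).
Proof. by move=> cf y; exact: (continuous_comp (cf y) (@sqrt_continuous R (f y))). Qed.

End ContinuousFunctions.


Section Kernel.
Context {R : realType}.
Implicit Types (n s : nat) (c L : R).

Lemma is_derive_entry n (i j : 'I_n) (y : 'rV[R]_n) :
  is_derive y (delta_mx 0 i) (fun y : 'rV[R]_n => y 0 j) (j == i)%:R.
Proof.
have H0 : y = y + (0 : R) *: delta_mx 0 i by rewrite scale0r addr0.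
rewrite [X in is_derive X]H0; apply/is_derive_line.
rewrite (_ : (fun h => _) = (fun h => y 0 j + (j == i)%:R * h)); last first.
  by apply/funext => h; rewrite !mxE eqxx mulrC.
rewrite -[X in is_derive _ _ _ X]add0r; apply: is_derive_addr.
rewrite -[X in is_derive _ _ _ X]mulr1; apply: is_derive_scaler.
Qed.

Definition sqlen {n} (y : 'rV[R]_n) : R := \sum_i y 0 i ^+ 2.

Lemma sqlen_ge0 n (y : 'rV[R]_n) : 0 <= sqlen y.
Proof. by apply: sumr_ge0 => i _; rewrite sqr_ge0. Qed.

Lemma sqlen_ge n (y : 'rV[R]_n) i : y 0 i ^+ 2 <= sqlen y.
Proof.
rewrite /sqlen (bigD1 i)//= lerDl.
by apply: sumr_ge0 => j _; rewrite sqr_ge0.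
Qed.

Lemma sqlen_vcons n t (y : 'rV[R]_n) : sqlen (vcons t y) = t ^+ 2 + sqlen y.
Proof. exact: (sum_vcons _ _ _ (fun x => x ^+ 2)). Qed.

Lemma is_derive_sqlen n (i : 'I_n) (y : 'rV[R]_n) :
  is_derive y (delta_mx 0 i) sqlen (2 * y 0 i).
Proof.
rewrite (_ : 2 * _ = \sum_j 2%:R * y 0 j ^+ 1 * (j == i)%:R).
  apply: is_derive_sumr => j.
  exact: (is_derive_expr _ _ _ 2 _ (is_derive_entry n i j y)).
rewrite (bigD1 i)//= eqxx mulr1 big1 ?addr0//.
by move=> j /negPf ->; rewrite mulr0.
Qed.

Lemma sqlen_continuous n : continuous (@sqlen n).
Proof.
by apply: continuous_sumr => i; apply: continuous_expr; exact: continuous_entry.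
Qed.

(** The kernel [(|y|^2 + c) ^ (- s / 2)]: the constant [c > 0] smooths the
    fundamental solution and its derivatives at the origin. *)
Definition kap {n} s c (y : 'rV[R]_n) : R := (Num.sqrt (sqlen y + c))^-1 ^+ s.

Lemma is_derive_kap n s c (i : 'I_n) (y : 'rV[R]_n) : 0 < c ->
  is_derive y (delta_mx 0 i) (kap s c) (- s%:R * y 0 i * kap s.+2 c y).
Proof.
move=> c0; have q0 : 0 < sqlen y + c by rewrite ltr_wpDl ?sqlen_ge0.
have r0 : Num.sqrt (sqlen y + c) != 0 by rewrite sqrtr_eq0 -ltNge.
have Hr : is_derive y (delta_mx 0 i) (fun y => Num.sqrt (sqlen y + c))
    ((2 * Num.sqrt (sqlen y + c))^-1 * (2 * y 0 i + 0)).
  apply: (is_derive_comp_real (@Num.sqrt R) (fun y => sqlen y + c)).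
    exact: is_derive1_sqrt.
  exact: (is_derive_addr _ _ _ _ _ _ (is_derive_sqlen _ _ _) (is_derive_cstr _ _ c)).
have Hi : is_derive (Num.sqrt (sqlen y + c)) 1 (fun t : R => t^-1)
    (- (Num.sqrt (sqlen y + c)) ^- 2 * 1).
  exact: (@is_deriveV _ id _ 1 1 r0 (is_derive_id _ _)).
have := is_derive_expr _ _ _ s _ (is_derive_comp_real (fun t => t^-1)
  (fun y => Num.sqrt (sqlen y + c)) _ _ _ _ Hi Hr).
rewrite /kap; set r := Num.sqrt (sqlen y + c) in r0 *.
congr is_derive; rewrite /GRing.scale/= addr0.
case: s => [|s]; first by rewrite !mul0r oppr0 !mul0r.
by rewrite !exprS !invfM expr0 mulr1; field.
Qed.

Lemma kap_continuous n s c : 0 < c -> continuous (@kap n s c).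
Proof.
move=> c0; apply: continuous_expr => y.
apply: (@continuousV _ _ (fun y : 'rV[R]_n => Num.sqrt (sqlen y + c))).
  by rewrite sqrtr_eq0 -ltNge ltr_wpDl ?sqlen_ge0.
apply: (@continuous_comp _ _ _ (fun y : 'rV[R]_n => sqlen y + c)).
  exact: (continuous_addr _ _ (sqlen_continuous n) (continuous_cstr c)).
exact: sqrt_continuous.
Qed.

Section KernelBounds.
Context {n : nat} {c : R}.
Hypothesis c0 : 0 < c.
Implicit Type y : 'rV[R]_n.

Lemma sqlenc_gt0 y : 0 < sqlen y + c.
Proof. by rewrite ltr_wpDl ?sqlen_ge0. Qed.

Lemma kap_gt0 s y : 0 < kap s c y.
Proof. by rewrite exprn_gt0// invr_gt0 sqrtr_gt0 sqlenc_gt0. Qed.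

Lemma kapD s t y : kap (s + t) c y = kap s c y * kap t c y.
Proof. exact: exprD. Qed.

Lemma sqlen_kap s y : (sqlen y + c) * kap s.+2 c y = kap s c y.
Proof.
rewrite /kap -addn2 exprD expr2 -invfM -expr2 sqr_sqrtr ?(ltW (sqlenc_gt0 y))//.
by rewrite mulrCA divff ?mulr1// gt_eqF ?sqlenc_gt0.
Qed.

Lemma entry_kap s y i : `|y 0 i| * kap s.+1 c y <= kap s c y.
Proof.
rewrite /kap exprSr mulrCA ger_pMr ?kap_gt0// ler_pdivrMr ?sqrtr_gt0 ?sqlenc_gt0//.
rewrite mul1r -sqrtr_sqr ler_wsqrtr// (le_trans (sqlen_ge _ _ i))// lerDl ltW//.
Qed.

Lemma kap_le_exp s y L : 0 < L -> L ^+ 2 <= sqlen y + c ->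
  kap s c y <= L^-1 ^+ s.
Proof.
move=> L0 H; have q0 := sqlenc_gt0 y.
rewrite lerXn2r ?nnegrE ?invr_ge0 ?sqrtr_ge0 ?(ltW L0)//.
by rewrite lef_pV2 ?posrE ?sqrtr_gt0// -(ger0_norm (ltW L0)) -sqrtr_sqr ler_wsqrtr.
Qed.

End KernelBounds.

Lemma le_kap n n' s c c' (y : 'rV[R]_n) (y' : 'rV[R]_n') : 0 < c -> 0 < c' ->
  sqlen y + c <= sqlen y' + c' -> kap s c' y' <= kap s c y.
Proof.
move=> c0 c'0 H; have q0 := sqlenc_gt0 c0 y; have q0' := sqlenc_gt0 c'0 y'.
rewrite lerXn2r ?nnegrE ?invr_ge0 ?sqrtr_ge0//.
by rewrite lef_pV2 ?posrE ?sqrtr_gt0// ler_wsqrtr.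
Qed.

Lemma kap_vcons n s c t (y : 'rV[R]_n) :
  kap s c (vcons t y) = kap s (t ^+ 2 + c) y.
Proof. by rewrite /kap sqlen_vcons [t ^+ 2 + sqlen y]addrC addrA. Qed.

Definition cube_int {n} L (f : 'rV[R]_n -> R) := box_int (fun=> - L) (fun=> L) f.

Lemma is_derive_entry_kap n s c (i : 'I_n) (y : 'rV[R]_n) : 0 < c ->
  is_derive y (delta_mx 0 i) (fun y => y 0 i * kap s c y)
    (kap s c y - s%:R * y 0 i ^+ 2 * kap s.+2 c y).
Proof.
move=> c0.
have := is_derive_mulr _ _ _ _ _ _ (is_derive_entry n i i y) (is_derive_kap n s c i y c0).
by congr is_derive; rewrite eqxx mul1r; ring.
Qed.

Lemma entry_kap_continuous n s c (i : 'I_n) : 0 < c ->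
  continuous (fun y : 'rV[R]_n => y 0 i * kap s c y).
Proof.
move=> c0; apply: continuous_mulr; first exact: continuous_entry.
exact: kap_continuous.
Qed.

Lemma div_kap_continuous n s c (i : 'I_n) : 0 < c ->
  continuous (fun y : 'rV[R]_n => kap s c y - s%:R * y 0 i ^+ 2 * kap s.+2 c y).
Proof.
move=> c0; apply: continuous_subr; first exact: kap_continuous.
apply: continuous_mulr; last exact: kap_continuous.
apply: continuous_mulr; first exact: continuous_cstr.
apply: continuous_expr; exact: continuous_entry.
Qed.

(** The divergence theorem for the radial field [y * kap s], whose divergence is
    [(n - s) kap s + s c kap (s + 2)]. The flux density is
    between [0] and [L * L^-s] on each face. *)
Lemma cube_flux n s c L : 0 < c -> 0 < L ->
  0 <= (n%:R - s%:R) * cube_int L (@kap n s c) +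
       s%:R * c * cube_int L (@kap n s.+2 c) <=
  n%:R * (2 * L) ^+ n * L^-1 ^+ s.
Proof.
move=> c0 L0; have L2 : 0 < L + L by rewrite addr_gt0.
have LL (i : nat) : - L <= L by rewrite ge0_cp// ltW.
pose F' (i : 'I_n) (y : 'rV[R]_n) := kap s c y - s%:R * y 0 i ^+ 2 * kap s.+2 c y.
have cF' i : box_continuous (fun=> - L) (fun=> L) (F' i).
  by apply: continuous_box; exact: div_kap_continuous.
have ck t : box_continuous (fun=> - L) (fun=> L) (@kap n t c).
  by apply: continuous_box; exact: kap_continuous.
have -> : (n%:R - s%:R) * cube_int L (@kap n s c) +
    s%:R * c * cube_int L (@kap n s.+2 c) = \sum_i cube_int L (F' i).
  rewrite /cube_int -box_int_sum// -!(box_intZ LL)// -box_intD//; last 2 first.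
  - exact: box_continuousM (box_continuous_cst _) (ck _).
  - exact: box_continuousM (box_continuous_cst _) (ck _).
  congr box_int; apply/funext => y.
  rewrite /F' sumrB sumr_const card_ord -mulr_suml -mulr_sumr -/(sqlen y).
  by rewrite -(sqlen_kap c0 s y) -mulr_natl; ring.
have HF i : 0 <= cube_int L (F' i) <= (2 * L) ^+ n * L^-1 ^+ s.
  have cF : box_continuous (fun=> - L) (fun=> L) (fun y : 'rV[R]_n => y 0 i * kap s c y).
    by apply: continuous_box; exact: entry_kap_continuous.
  have -> : cube_int L (F' i) = box_int (fun=> - L) (fun=> L)
      (fun y : 'rV[R]_n => (L - - L)^-1 * (L * kap s c (vset i L y) - - L * kap s c (vset i (- L) y))).
    have LLs : - L < L by rewrite -subr_gt0 opprK.
    rewrite /cube_int (box_int_gauss n (fun=> - L) (fun=> L) i _ (F' i) LL LLs cF (cF' i)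
      (fun y _ _ => is_derive_entry_kap n s c i y c0)).
    by congr box_int; apply/funext => y; rewrite !mxE eqxx.
  have cG : box_continuous (fun=> - L) (fun=> L)
      (fun y : 'rV[R]_n => (L - - L)^-1 * (L * kap s c (vset i L y) - - L * kap s c (vset i (- L) y))).
    apply: box_continuousM (box_continuous_cst _) _.
    apply: box_continuousB; apply: box_continuousM (box_continuous_cst _) _;
      by apply: box_continuous_vset => //; rewrite lexx LL.
  have hk e (y : 'rV[R]_n) : e ^+ 2 = L ^+ 2 -> kap s c (vset i e y) <= L^-1 ^+ s.
    move=> e2; apply: kap_le_exp => //; rewrite -e2.
    have := sqlen_ge n (vset i e y) i; rewrite mxE eqxx => /le_trans -> //.
    by rewrite lerDl ltW.
  apply/andP; split.
    apply: box_int_ge0 => // y _; rewrite opprK mulNr opprK.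
    by rewrite mulr_ge0 ?invr_ge0 ?(ltW L2)// addr_ge0// mulr_ge0 ?(ltW L0)// ltW// kap_gt0.
  apply: (@le_trans _ _ (box_int (fun=> - L) (fun=> L) (fun _ : 'rV[R]_n => L^-1 ^+ s))).
    apply: le_box_int => //; first exact: box_continuous_cst.
    move=> y _; rewrite opprK mulNr opprK -mulrDr mulrA.
    have h1 := hk L y erefl; have h2 := hk (- L) y (sqrrN _).
    clear LL.
    have -> : (L + L)^-1 * L = 2^-1.
      rewrite (_ : L + L = 2 * L); last by ring.
      by rewrite invfM -mulrA mulVf ?mulr1// gt_eqF.
    lra.
  rewrite box_int_cst// /box_vol prodr_const card_ord opprK mulrC.
  by rewrite mulr_natl mulr2n.
apply/andP; split; first by apply: sumr_ge0 => i _; have /andP[] := HF i.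
apply: (@le_trans _ _ (\sum_(i < n) (2 * L) ^+ n * L^-1 ^+ s)).
  by apply: ler_sum => i _; have /andP[] := HF i.
by rewrite sumr_const card_ord -[leLHS]mulr_natl mulrA.
Qed.

(** The bound is uniform in [c]: it controls the integrals of the kernels with an
    integrable singularity at the pole, and makes the cutoff errors [O(1 / L)]. *)
Lemma cube_kap_bound n c L : 0 < c -> 0 < L ->
  cube_int L (@kap n.+1 n c) <= n.+1%:R * 2 ^+ n.+1 * L.
Proof.
move=> c0 L0; have /andP[_] := cube_flux n.+1 n c L c0 L0.
have LL (i : nat) : - L <= L by rewrite ge0_cp// ltW.
have k0 : 0 <= cube_int L (@kap n.+1 n.+2 c).
  apply: box_int_ge0 => //; first by move=> y _; rewrite ltW// kap_gt0.
  by apply: continuous_box; exact: kap_continuous.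
have -> : n.+1%:R - n%:R = 1 :> R by rewrite -natr1; ring.
have -> : n.+1%:R * (2 * L) ^+ n.+1 * L^-1 ^+ n = n.+1%:R * 2 ^+ n.+1 * L.
  rewrite exprMn [L ^+ n.+1]exprS exprVn.
  by field; rewrite expf_neq0// gt_eqF.
have : 0 <= n%:R * c * cube_int L (@kap n.+1 n.+2 c).
  by rewrite mulr_ge0// mulr_ge0// ltW.
by move: (_ * _ * cube_int _ _) => X; clear LL; lra.
Qed.

End Kernel.

(** * Moments and the normalized constant *)

Section Trigonometric.
Context {R : realType}.
Notation mu := (@lebesgue_measure R).
Implicit Types f g F : R -> R.

Lemma int_FTC (a b : R) f F : a < b -> continuous f ->
  (forall x : R, is_derive x 1 F (f x)) ->
  \int[mu]_(t in `[a, b]) f t = F b - F a.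
Proof.
move=> ab cf dF; have cF : continuous F.
  by move=> x; apply: (@is_derive1_continuous R F x (f x)).
have [F1 F2] := within_LR _ _ _ ab (continuous_subspaceT cF).
rewrite /Rintegral (@continuous_FTC2 _ _ F)//.
- exact: continuous_subspaceT.
- by split => // t ht; have [] := dF t.
- by move=> t ht; rewrite derive1E; have [] := dF t.
Qed.

Lemma continuous_integrable (a b : R) f : continuous f ->
  mu.-integrable `[a, b] (EFin \o f).
Proof. by move=> cf; apply: itv_integrable; exact: continuous_subspaceT. Qed.

Lemma int_add (a b : R) f g : continuous f -> continuous g ->
  \int[mu]_(t in `[a, b]) (f t + g t) =
  \int[mu]_(t in `[a, b]) f t + \int[mu]_(t in `[a, b]) g t.
Proof. by move=> cf cg; rewrite RintegralD//; exact: continuous_integrable. Qed.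

Lemma int_scale (a b k : R) f : continuous f ->
  \int[mu]_(t in `[a, b]) (k * f t) = k * \int[mu]_(t in `[a, b]) f t.
Proof. by move=> cf; rewrite RintegralZl//; exact: continuous_integrable. Qed.

Lemma int_sum (a b : R) n (f : 'I_n -> R -> R) :
  (forall i, continuous (f i)) ->
  \int[mu]_(t in `[a, b]) (\sum_i f i t) = \sum_i \int[mu]_(t in `[a, b]) f i t.
Proof.
elim: n f => [|n IH] f cf.
  under eq_Rintegral do rewrite big_ord0.
  by rewrite big_ord0 /Rintegral integral0.
under eq_Rintegral do rewrite big_ord_recl.
rewrite int_add//; last by apply: continuous_sumr.
by rewrite big_ord_recl IH.
Qed.

Lemma int_le (a b : R) f g : continuous f -> continuous g ->
  (forall t, a <= t <= b -> f t <= g t) ->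
  \int[mu]_(t in `[a, b]) f t <= \int[mu]_(t in `[a, b]) g t.
Proof.
by move=> cf cg fg; apply: le_Rintegral => //; exact: continuous_integrable.
Qed.

Lemma pihalf_gt0 : 0 < pi / 2 :> R.
Proof. by rewrite divr_gt0// pi_gt0. Qed.

Lemma sin_ge0_pihalf (t : R) : 0 <= t <= pi / 2 -> 0 <= sin t.
Proof.
move=> /andP[t0 t1]; apply: sin_ge0_pi; rewrite t0/= (le_trans t1)//.
by rewrite ler_pdivrMr// ler_peMr ?pi_ge0// ler1n.
Qed.

Lemma is_derive_cos_sin p q (x : R) :
  is_derive x 1 (fun t => cos t ^+ p.+1 * sin t ^+ q.+1)
    ((q.+1%:R * cos x ^+ p.+2 * sin x ^+ q - p.+1%:R * cos x ^+ p * sin x ^+ q.+2)).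
Proof.
have := is_derive_mulr _ _ _ _ _ _ (is_derive_expr _ _ _ p.+1 _ (is_derive_cos x))
  (is_derive_expr _ _ _ q.+1 _ (is_derive_sin x)).
by congr is_derive; rewrite /= !exprS; ring.
Qed.

Definition wallis k j : R :=
  \int[mu]_(t in `[0, pi / 2]) (cos t ^+ j * sin t ^+ k).

Lemma cos_sin_continuous j k : continuous (fun t : R => cos t ^+ j * sin t ^+ k).
Proof.
by apply: continuous_mulr; apply: continuous_expr;
  [exact: continuous_cos|exact: continuous_sin].
Qed.

Lemma int_cos_sin_parts p q (a b : R) : a < b ->
  q.+1%:R * \int[mu]_(t in `[a, b]) (cos t ^+ p.+2 * sin t ^+ q) -
  p.+1%:R * \int[mu]_(t in `[a, b]) (cos t ^+ p * sin t ^+ q.+2) =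
  cos b ^+ p.+1 * sin b ^+ q.+1 - cos a ^+ p.+1 * sin a ^+ q.+1.
Proof.
move=> ab; rewrite -(int_FTC a b _ _ ab _ (is_derive_cos_sin p q)); last first.
  apply: continuous_subr; under eq_fun do rewrite -mulrA;
    by apply: continuous_mulr (continuous_cstr _) _; exact: cos_sin_continuous.
rewrite -!int_scale; [|exact: cos_sin_continuous..].
rewrite -mulN1r -int_scale; last first.
  by apply: continuous_mulr (continuous_cstr _) (cos_sin_continuous _ _).
rewrite -int_add.
- by apply: eq_Rintegral => t _; ring.
- exact: continuous_mulr (continuous_cstr _) (cos_sin_continuous _ _).
- apply: continuous_mulr (continuous_cstr _) _.
  exact: continuous_mulr (continuous_cstr _) (cos_sin_continuous _ _).
Qed.

Lemma wallis_split p q : wallis q.+2 p = wallis q p - wallis q p.+2.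
Proof.
apply/eqP; rewrite eq_sym subr_eq; apply/eqP.
rewrite /wallis -int_add; try exact: cos_sin_continuous.
apply: eq_Rintegral => t _; rewrite -[p.+2]addn2 -[q.+2]addn2 !exprD.
have := cos2Dsin2 t => /(congr1 (fun x => x - cos t ^+ 2)); rewrite addrAC subrr add0r => ->.
ring.
Qed.

Lemma wallis_cosS k j :
  (k + j + 2)%N%:R * wallis k j.+2 = j.+1%:R * wallis k j.
Proof.
have := int_cos_sin_parts j k _ _ pihalf_gt0.
rewrite -!/(wallis _ _) cos_pihalf sin0 !expr0n/= mul0r mulr0 subrr wallis_split.
have -> : (k + j + 2)%N%:R = k.+1%:R + j.+1%:R :> R by rewrite -natrD; congr (_%:R); lia.
lra.
Qed.

Lemma wallis_sinS k : k.+2%:R * wallis k.+2 0 = k.+1%:R * wallis k 0.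
Proof.
rewrite wallis_split mulrBr; have := wallis_cosS k 0; rewrite addn0 addn2 mul1r => ->.
by rewrite -[k.+2%:R]natr1; ring.
Qed.

(** Compare with the integral of [sin^k * cos], which has a primitive. *)
Lemma wallis0_gt0 k : 0 < wallis k 0.
Proof.
apply: (@lt_le_trans _ _ (wallis k 1)); last first.
  apply: int_le; try exact: cos_sin_continuous.
  move=> t ht; apply: ler_wpM2r; first by rewrite exprn_ge0// sin_ge0_pihalf.
  by rewrite expr0 expr1 cos_le1.
have dF (x : R) : is_derive x 1 (fun t : R => k.+1%:R^-1 * sin t ^+ k.+1) (cos x ^+ 1 * sin x ^+ k).
  have := is_derive_scaler _ _ _ k.+1%:R^-1 _ (is_derive_expr _ _ _ k.+1 _ (is_derive_sin x)).
  congr is_derive => /=; rewrite expr1 !mulrA mulVf ?pnatr_eq0// mul1r mulrC//.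
rewrite /wallis (int_FTC _ _ _ _ pihalf_gt0 (cos_sin_continuous _ _) dF).
by rewrite sin0 sin_pihalf expr0n expr1n/= mulr1 mulr0 subr0 invr_gt0 ltr0n.
Qed.

End Trigonometric.

Section SqrtApprox.
Context {R : realType}.

(** For [x] in [0, 1] the iterates increase to [sqrt x], and they are polynomials
    in [x]. *)
Fixpoint sqrt_iter (x : R) j : R :=
  if j is i.+1 then sqrt_iter x i + (x - sqrt_iter x i ^+ 2) / 2 else 0.

Lemma sqrt_iter_bound x0 x j : 0 < x0 -> x0 <= x <= 1 ->
  sqrt_iter x j <= Num.sqrt x <= sqrt_iter x j + (1 - Num.sqrt x0 / 2) ^+ j.
Proof.
move=> x00 /andP[x0x x1].
have xge0 : 0 <= x by rewrite (le_trans _ x0x)// ltW.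
set s := Num.sqrt x; have s0 : 0 <= s by rewrite sqrtr_ge0.
have s1 : s <= 1 by rewrite -sqrtr1 ler_wsqrtr.
have s2 : x = s ^+ 2 by rewrite sqr_sqrtr.
set u := Num.sqrt x0; have us : u <= s by rewrite ler_wsqrtr.
have u0 : 0 <= u by rewrite sqrtr_ge0.
suff : [/\ 0 <= sqrt_iter x j, sqrt_iter x j <= s &
    s - sqrt_iter x j <= (1 - u / 2) ^+ j].
  by move=> [h1 h2 h3]; rewrite h2/=; lra.
elim: j => [|j [h1 h2 h3]] /=; first by rewrite expr0; split => //; lra.
set q := sqrt_iter x j in h1 h2 h3 *.
have E : s - (q + (x - q ^+ 2) / 2) = (1 - (s + q) / 2) * (s - q).
  by rewrite [X in X - q ^+ 2]s2; field.
split.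
- rewrite addr_ge0// divr_ge0// subr_ge0 [leRHS]s2.
  by rewrite lerXn2r// nnegrE.
- by rewrite -subr_ge0 E mulr_ge0 ?subr_ge0//; lra.
- by rewrite E exprS ler_pM ?subr_ge0//; lra.
Qed.

Fixpoint sqrt_poly (q : {poly R}) j : {poly R} :=
  if j is i.+1 then sqrt_poly q i + 2^-1 *: (q - sqrt_poly q i ^+ 2) else 0.

Lemma horner_sqrt_poly q j z : (sqrt_poly q j).[z] = sqrt_iter q.[z] j.
Proof.
elim: j => [|j IH] /=; first by rewrite horner0.
by rewrite !hornerE IH mulrC.
Qed.

(** After division by [1 + a] the argument of the root stays in [1 / (1 + a), 1],
    where the iteration converges geometrically. *)
Lemma sqrt_approx (a e : R) : 0 <= a -> 0 < e ->
  exists p : {poly R}, forall z, 0 <= z <= 1 ->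
    Num.sqrt (1 + a * z) <= p.[z] <= Num.sqrt (1 + a * z) + e.
Proof.
move=> a0 e0; have a1 : 0 < 1 + a by rewrite ltr_wpDr.
pose x0 := (1 + a)^-1; have x00 : 0 < x0 by rewrite invr_gt0.
have x01 : x0 <= 1 by rewrite invf_le1// lerDl.
pose th := 1 - Num.sqrt x0 / 2.
have r0 : 0 < Num.sqrt x0 by rewrite sqrtr_gt0.
have r1 : Num.sqrt x0 <= 1 by rewrite -sqrtr1 ler_wsqrtr.
have th1 : `|th| < 1 by rewrite /th gtr0_norm; lra.
pose S := Num.sqrt (1 + a); have S0 : 0 < S by rewrite sqrtr_gt0.
have /cvgrPdist_lt/(_ (e / S)) := cvg_expr th1.
rewrite divr_gt0// => /(_ isT)[j _ /(_ j (leqnn j)) /=].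
rewrite sub0r normrN normrX => Hj.
have {Hj} : S * th ^+ j < e.
  rewrite mulrC -ltr_pdivlMr//; apply: le_lt_trans Hj.
  by rewrite -normrX ler_norm.
set d := th ^+ j => Hd.
pose q : {poly R} := x0%:P + (x0 * a) *: 'X.
exists (S *: (sqrt_poly q j + d%:P)) => z /andP[z0 z1].
rewrite !hornerE horner_sqrt_poly.
have qz : q.[z] = x0 * (1 + a * z) by rewrite !hornerE; ring.
have az : 0 <= a * z by rewrite mulr_ge0.
have /andP[h1 h2] : sqrt_iter q.[z] j <= Num.sqrt q.[z] <= sqrt_iter q.[z] j + d.
  apply: sqrt_iter_bound => //; rewrite qz; apply/andP; split.
    by rewrite ler_peMr ?(ltW x00)// lerDl.
  by rewrite mulrC ler_pdivrMr// mul1r lerD2l ler_piMr.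
have E : Num.sqrt (1 + a * z) = S * Num.sqrt q.[z].
  by rewrite -sqrtrM ?(ltW a1)// qz mulrA mulfV ?mul1r// gt_eqF.
rewrite E ler_pM2l// h2/= mulrDr.
by rewrite lerD ?ler_pM2l// ltW.
Qed.

End SqrtApprox.

Section Moments.
Context {R : realType}.
Variable k : nat.
Notation mu := (@lebesgue_measure R).
(* moments of powers of 1 / (|y|^2 + 1) *)
Let A j L := cube_int L (@kap R k.+1 (k.+2 + 2 * j)%N 1).

Lemma cube_kap_ge0 n s (c L : R) : 0 < c -> 0 < L -> 0 <= cube_int L (@kap R n s c).
Proof.
move=> c0 L0; apply: box_int_ge0.
- by move=> i; rewrite ge0_cp// ltW.
- by move=> y _; rewrite ltW// kap_gt0.
- by apply: continuous_box; exact: kap_continuous.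
Qed.

(** The moments satisfy the recurrence of [int cos^(2j) sin^k] up to the flux
    through the faces of the cube. *)
Lemma moment_asymptotics j L : 1 <= L ->
  `|A j L - wallis k (2 * j)%N / wallis k 0 * A 0 L| <=
    j%:R * (k.+1%:R * 2 ^+ k.+1) / L.
Proof.
move=> L1; have L0 : 0 < L by rewrite (lt_le_trans _ L1).
have w0 : wallis k 0 != 0 :> R by rewrite gt_eqF// wallis0_gt0.
elim: j => [|j IH].
  by rewrite muln0 divff// mul1r subrr normr0 !mul0r.
set K := k.+1%:R * 2 ^+ k.+1 in IH *.
have K0 : 0 <= K by rewrite mulr_ge0// exprn_ge0.
pose N : R := (k.+2 + 2 * j)%N%:R.
have N0 : 0 < N by rewrite ltr0n.
have N1 : 1 <= N by rewrite ler1n.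
have := cube_flux k.+1 (k.+2 + 2 * j)%N 1 L ltr01 L0.
rewrite -/N mulr1 (_ : (k.+2 + 2 * j)%N.+2 = (k.+2 + 2 * j.+1)%N); last by lia.
rewrite -!/(A _ _).
have -> : k.+1%:R - N = - (2 * j).+1%:R.
  by apply/eqP; rewrite subr_eq addrC -subr_eq opprK -natrD /N; apply/eqP; congr (_%:R); lia.
set X := (X in 0 <= X <= _); move=> /andP[X0 XK].
have {}XK : X <= K / L.
  apply: le_trans XK _.
  have -> : k.+1%:R * (2 * L) ^+ k.+1 * L^-1 ^+ (k.+2 + 2 * j)%N =
      K * (L ^+ k.+1 * L^-1 ^+ (k.+2 + 2 * j)%N) by rewrite exprMn /K; ring.
  rewrite ler_wpM2l// -ler_pdivlMl ?exprn_gt0// exprVn.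
  rewrite -invfM -exprSr lef_pV2 ?posrE ?exprn_gt0//.
  by rewrite ler_weXn2l ?leq_addr.
pose r : R := (2 * j).+1%:R / N.
have r0 : 0 <= r by rewrite divr_ge0// ltW.
have r1 : r <= 1 by rewrite ler_pdivrMr// mul1r ler_nat; lia.
have EA : A j.+1 L = r * A j L + X / N.
  by rewrite /X /r; field; rewrite gt_eqF.
have EW : wallis k (2 * j.+1)%N = r * wallis k (2 * j)%N.
  have := @wallis_cosS R k (2 * j); rewrite (_ : (2 * j).+2 = 2 * j.+1)%N; last by lia.
  rewrite (_ : (k + 2 * j + 2)%:R = N); last by congr (_%:R); lia.
  by move=> E; apply: (mulfI (lt0r_neq0 N0)); rewrite E /r; field; rewrite gt_eqF.
have -> : A j.+1 L - wallis k (2 * j.+1)%N / wallis k 0 * A 0 L =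
    r * (A j L - wallis k (2 * j)%N / wallis k 0 * A 0 L) + X / N.
  by rewrite EA EW; ring.
apply: le_trans (ler_normD _ _) _.
have -> : j.+1%:R * K / L = j%:R * K / L + K / L by rewrite -natr1; ring.
rewrite normrM (ger0_norm r0) lerD//.
  by apply: le_trans IH; rewrite ler_piMl.
rewrite ger0_norm ?divr_ge0// ?(ltW N0)//.
by rewrite (le_trans _ XK)// ler_pdivrMr// ler_peMr.
Qed.

(** The lowest moment stays away from zero, so that an error [O(1 / L)] is small
    relative to it. *)
Lemma moment0_lower : exists2 a : R, 0 < a & forall L, 1 <= L -> a <= A 0 L.
Proof.
have LL (i : nat) : - 1 <= 1 :> R by lra.
exists (k.+2%:R^-1 ^+ k.+2 * 2 ^+ k.+1).
  by rewrite mulr_gt0 ?exprn_gt0// invr_gt0 ltr0n.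
move=> L L1; apply: (@le_trans _ _ (A 0 1)).
  rewrite /A muln0 addn0 /cube_int.
  have -> : k.+2%:R^-1 ^+ k.+2 * 2 ^+ k.+1 =
      box_int (fun=> - 1) (fun=> 1) (fun _ : 'rV[R]_k.+1 => k.+2%:R^-1 ^+ k.+2).
    rewrite box_int_cst// /box_vol prodr_const card_ord; congr (_ * _ ^+ _); clear LL; lra.
  apply: le_box_int => //; first exact: box_continuous_cst.
    by apply: continuous_box; exact: kap_continuous.
  move=> y hy.
  have q1 : sqlen y + 1 <= k.+2%:R.
    rewrite -natr1 lerD2r /sqlen.
    apply: (@le_trans _ _ (\sum_(i < k.+1) 1)); last first.
      by rewrite sumr_const card_ord.
    apply: ler_sum => i _; rewrite -real_normK ?num_real// expr_le1//.
    by rewrite ler_norml; exact: hy.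
  have q0 := sqlenc_gt0 ltr01 y.
  rewrite lerXn2r ?nnegrE ?invr_ge0 ?sqrtr_ge0//.
  rewrite lef_pV2 ?posrE ?sqrtr_gt0// ?ltr0n//.
  rewrite (le_trans (ler_wsqrtr q1))// -[leRHS]ger0_norm// -sqrtr_sqr ler_wsqrtr//.
  by rewrite expr2 ler_peMr// ler1n.
apply: subset_box_int => //.
- by move=> _; rewrite lerN2.
- by apply: continuous_box; exact: kap_continuous.
- by move=> y _; rewrite ltW// kap_gt0.
Qed.

(** With [n = k + 2], the normalized form of the constant: the average of
    [sqrt (1 + n (n - 2) cos^2)] with respect to the weight [sin^(n - 2)]. *)
Definition D_ratio : R :=
  (\int[mu]_(t in `[0, pi / 2])
    (Num.sqrt (1 + k.+2%:R * k%:R * cos t ^+ 2) * sin t ^+ k)) / wallis k 0.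

(** Length of the normal derivative of the gradient of the fundamental solution
    at distance one from the pole, up to the factor [omega_n]. *)
Definition pole_mass (y : 'rV[R]_k.+1) : R :=
  kap k.+2 1 y * Num.sqrt (1 + k.+2%:R * k%:R * kap 2 1 y).

Lemma pole_mass_continuous : continuous pole_mass.
Proof.
apply: continuous_mulr; first exact: kap_continuous.
apply: continuous_sqrtr.
apply: continuous_addr; first exact: continuous_cstr.
by apply: continuous_mulr (continuous_cstr _) _; exact: kap_continuous.
Qed.

Lemma kap2_le1 n (y : 'rV[R]_n) : 0 <= kap 2 1 y <= 1.
Proof.
rewrite ltW ?kap_gt0//=; have := kap_le_exp ltr01 2 y 1 ltr01.
by rewrite expr1n invr1 expr1n; apply; rewrite lerDr sqlen_ge0.
Qed.

(** Replace the square root by a polynomial: the left side becomes a combination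
    of moments of [1 / (|y|^2 + 1)], and [D_ratio] the same combination of moments
    of [cos^2]. *)
Lemma pole_mass_bound (e : R) : 0 < e ->
  exists C : R, forall L, 1 <= L ->
    cube_int L pole_mass <= (D_ratio + e) * A 0 L + C / L.
Proof.
move=> e0; pose a : R := k.+2%:R * k%:R.
have a0 : 0 <= a by rewrite mulr_ge0.
have [p Hp] := sqrt_approx a e a0 e0.
pose K : R := k.+1%:R * 2 ^+ k.+1.
have K0 : 0 <= K by rewrite mulr_ge0// exprn_ge0.
exists (\sum_(i < size p) `|p`_i| * (i%:R * K)) => L L1.
have L0 : 0 < L by rewrite (lt_le_trans _ L1).
have LL (i : nat) : - L <= L by rewrite ge0_cp// ltW.
have w0 := @wallis0_gt0 R k.
have ck s : box_continuous (fun=> - L) (fun=> L) (@kap R k.+1 s 1).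
  by apply: continuous_box; exact: kap_continuous.
pose P y := \sum_(i < size p) p`_i * @kap R k.+1 (k.+2 + 2 * i)%N 1 y.
have cP : box_continuous (fun=> - L) (fun=> L) P.
  apply: box_continuous_sum => i; exact: box_continuousM (box_continuous_cst _) (ck _).
have h1 : cube_int L pole_mass <= cube_int L P.
  apply: le_box_int => //; first by apply: continuous_box; exact: pole_mass_continuous.
  move=> y _.
  have -> : P y = kap k.+2 1 y * p.[kap 2 1 y].
    rewrite horner_coef /P mulr_sumr; apply: eq_bigr => i _.
    by rewrite [in RHS]mulrCA kapD /kap -exprM.
  by rewrite /pole_mass ler_pM2l ?kap_gt0//; have /andP[] := Hp _ (kap2_le1 _ y).
apply: le_trans h1 _.
have -> : cube_int L P = \sum_(i < size p) p`_i * A i L.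
  rewrite /cube_int box_int_sum//; last first.
    by move=> i; exact: box_continuousM (box_continuous_cst _) (ck _).
  by apply: eq_bigr => i _; rewrite box_intZ.
apply: (@le_trans _ _ (\sum_(i < size p) (p`_i * (wallis k (2 * i)%N / wallis k 0 * A 0 L) +
    `|p`_i| * (i%:R * K) / L))).
  apply: ler_sum => i _; rewrite -lerBlDl -mulrBr -[leRHS]mulrA.
  apply: le_trans (ler_norm _) _; rewrite normrM ler_wpM2l//.
  exact: moment_asymptotics.
rewrite big_split/= -mulr_suml lerD2r.
have -> : \sum_(i < size p) p`_i * (wallis k (2 * i)%N / wallis k 0 * A 0 L) =
    (\sum_(i < size p) p`_i * wallis k (2 * i)%N) / wallis k 0 * A 0 L.
  by rewrite mulr_suml mulr_suml; apply: eq_bigr => i _; ring.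
rewrite ler_wpM2r//; first by rewrite /A; exact: cube_kap_ge0.
rewrite ler_pdivrMr// mulrDl /D_ratio divfK ?gt_eqF//.
have cs (t : R) : 0 <= cos t ^+ 2 <= 1.
  by rewrite sqr_ge0/= -(cos2Dsin2 t) lerDl sqr_ge0.
have cq : continuous (fun t : R => Num.sqrt (1 + a * cos t ^+ 2) * sin t ^+ k).
  apply: continuous_mulr; last by apply: continuous_expr; exact: continuous_sin.
  apply: continuous_sqrtr.
  apply: continuous_addr; first exact: continuous_cstr.
  apply: continuous_mulr (continuous_cstr _) _.
  by apply: continuous_expr; exact: continuous_cos.
have cc := @cos_sin_continuous R 0 k.
have ce := continuous_mulr _ _ (continuous_cstr e) cc.
rewrite /wallis -int_scale// -(int_add _ _ _ _ cq ce).
have cS (i : 'I_(size p)) : continuous (fun t : R => p`_i * (cos t ^+ (2 * i) * sin t ^+ k)).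
  exact: continuous_mulr (continuous_cstr _) (cos_sin_continuous _ _).
under eq_bigr do rewrite -(int_scale _ _ _ _ (@cos_sin_continuous R _ _)).
rewrite -int_sum//; apply: int_le.
- exact: continuous_sumr.
- by apply: continuous_addr.
move=> t ht.
have -> : \sum_(i < size p) p`_i * (cos t ^+ (2 * i) * sin t ^+ k) =
    p.[cos t ^+ 2] * sin t ^+ k.
  by rewrite horner_coef mulr_suml; apply: eq_bigr => i _; rewrite mulrA exprM.
rewrite expr0 mul1r -mulrDl ler_wpM2r ?exprn_ge0 ?sin_ge0_pihalf//.
by have /andP[] := Hp _ (cs t).
Qed.

End Moments.

(** * Volumes of balls and areas of spheres *)

Section BallVolume.
Context {R : realType}.
Notation mu := (@lebesgue_measure R).

Definition sin_pow_int k : R := \int[mu]_(t in `[0, pi]) (cos t ^+ 0 * sin t ^+ k).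

Lemma sin_pow_intS k : k.+2%:R * sin_pow_int k.+2 = k.+1%:R * sin_pow_int k.
Proof.
have := int_cos_sin_parts 0 k _ _ (@pi_gt0 R).
rewrite sin0 sinpi !expr0n/= !mulr0 subrr -/(sin_pow_int k.+2) mul1r => H.
have E : \int[mu]_(t in `[0, pi]) (cos t ^+ 2 * sin t ^+ k) =
    sin_pow_int k - sin_pow_int k.+2.
  apply/eqP; rewrite eq_sym subr_eq; apply/eqP.
  rewrite /sin_pow_int -int_add; try exact: cos_sin_continuous.
  apply: eq_Rintegral => t _; rewrite expr0 !mul1r -[k.+2]addn2 exprD.
  have := cos2Dsin2 t => /(congr1 (fun x => x - sin t ^+ 2)); rewrite addrK => ->.
  ring.
move: H; rewrite E -[k.+2%:R]natr1; lra.
Qed.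

Lemma sin_pow_int0 : sin_pow_int 0 = 2 * wallis 0 0.
Proof.
rewrite /sin_pow_int /wallis.
under eq_Rintegral do rewrite !expr0 mulr1.
under [in RHS]eq_Rintegral do rewrite !expr0 mulr1.
by rewrite !itv_int_cst ?pi_ge0// ?(ltW pihalf_gt0)//; field.
Qed.

Lemma sin_pow_int1 : sin_pow_int 1 = 2 * wallis 1 0.
Proof.
have dF (x : R) : is_derive x 1 (fun t : R => -1 * cos t) (cos x ^+ 0 * sin x ^+ 1).
  have := is_derive_scaler _ _ _ (-1) _ (is_derive_cos x).
  by congr is_derive; rewrite expr0 expr1 mul1r mulN1r opprK.
rewrite /sin_pow_int /wallis.
rewrite (int_FTC _ _ _ _ (@pi_gt0 R) (cos_sin_continuous _ _) dF).
rewrite (int_FTC _ _ _ _ pihalf_gt0 (cos_sin_continuous _ _) dF).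
by rewrite cospi cos0 cos_pihalf; ring.
Qed.

(** Both sides satisfy the same recurrence of order two. *)
Lemma sin_pow_intE k : sin_pow_int k = 2 * wallis k 0.
Proof.
suff [] : sin_pow_int k = 2 * wallis k 0 /\ sin_pow_int k.+1 = 2 * wallis k.+1 0 by [].
elim: k => [|k [IH1 IH2]]; first by rewrite sin_pow_int0 sin_pow_int1.
split => //; apply: (@mulfI _ k.+2%:R); first by rewrite pnatr_eq0.
by rewrite sin_pow_intS IH1 [RHS]mulrCA wallis_sinS; ring.
Qed.

Lemma disc_power_continuous m (rho : R) :
  continuous (fun t : R => Num.sqrt (rho ^+ 2 - t ^+ 2) ^+ m).
Proof.
apply: continuous_expr; apply: continuous_sqrtr.
apply: continuous_subr; first exact: continuous_cstr.
by apply: continuous_expr => x; exact: cvg_id.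
Qed.

(** Substitute [t = rho * cos]. *)
Lemma int_disc_power m (rho : R) : 0 <= rho ->
  \int[mu]_(t in `[- rho, rho]) (Num.sqrt (rho ^+ 2 - t ^+ 2) ^+ m) =
  rho ^+ m.+1 * sin_pow_int m.+1.
Proof.
rewrite le_eqVlt => /predU1P[<-|r0].
  by rewrite oppr0 set_itv1 Rintegral_set1 expr0n mul0r.
pose G t := Num.sqrt (rho ^+ 2 - t ^+ 2) ^+ m.
pose F (t : R) := rho * cos t.
have cG : continuous G.
  exact: disc_power_continuous.
have dF (x : R) : is_derive x 1 F (rho * - sin x).
  exact: is_derive_scaler (is_derive_cos x).
have F'E : derive1 F = (fun x => - rho * sin x).
  by apply/funext => x; rewrite derive1E mulNr -mulrN; have [] := dF x.
have cF' : continuous (derive1 F).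
  rewrite F'E; exact: continuous_mulr (continuous_cstr _) (@continuous_sin R).
have cF : continuous F.
  exact: continuous_mulr (continuous_cstr _) (@continuous_cos R).
have H := @integration_by_substitution_decreasing R F G 0 pi (pi_ge0 _).
have E0 : F 0 = rho by rewrite /F cos0 mulr1.
have Epi : F pi = - rho by rewrite /F cospi mulrN1.
rewrite /Rintegral -[in X in `[- rho, X]]E0 -Epi H.
- rewrite -[X in fine X]/(_).
  rewrite -/(Rintegral _ _ _) /sin_pow_int -int_scale; last exact: cos_sin_continuous.
  apply: eq_Rintegral => t; rewrite inE/= in_itv/= => ht.
  have s0 := sin_ge0_pi ht.
  rewrite !fctE F'E /G /F expr0 mul1r.
  have -> : rho ^+ 2 - (rho * cos t) ^+ 2 = (rho * sin t) ^+ 2.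
    have := cos2Dsin2 t => /(congr1 (fun x => x - cos t ^+ 2)).
    by rewrite addrAC subrr add0r exprMn [(rho * sin t) ^+ 2]exprMn => ->; ring.
  rewrite sqrtr_sqr ger0_norm ?mulr_ge0 ?(ltW r0)// !exprS exprMn; ring.
- move=> x y xI yI xy; rewrite /F ltr_pM2l// ltr_cos//.
- by move=> x _; exact: cF'.
- by apply/cvg_ex; exists (derive1 F 0); apply: cvg_at_right_filter; exact: cF'.
- by apply/cvg_ex; exists (derive1 F pi); apply: cvg_at_left_filter; exact: cF'.
- split; first by move=> x _; have [] := dF x.
  + by apply: cvg_at_right_filter; exact: cF.
  + by apply: cvg_at_left_filter; exact: cF.
- exact: continuous_subspaceT.
Qed.

Definition ball_vol k : R := \prod_(i < k) sin_pow_int i.+1.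

Lemma ball_vol_gt0 k : 0 < ball_vol k.
Proof.
by apply: prodr_gt0 => i _; rewrite sin_pow_intE mulr_gt0// wallis0_gt0.
Qed.

Lemma row_mx_vcons m t (y : 'rV[R]_m) : row_mx (t%:M : 'rV_1) y = vcons t y.
Proof.
apply/rowP => i; rewrite [RHS]mxE; case: (unliftP ord0 i) => [j|] ->.
  rewrite (_ : lift ord0 j = rshift 1 j); last exact/val_inj.
  by rewrite (@row_mxEr R 1 1 m).
rewrite (_ : ord0 = lshift m (ord0 : 'I_1)); last exact/val_inj.
by rewrite (@row_mxEl R 1 1 m) mxE eqxx.
Qed.

Lemma volume0 m : volume (set0 : set 'rV[R]_m) = 0%E.
Proof.
elim: m => [|m IH] /=; first by rewrite indic0.
under eq_integral => t _.
  rewrite (_ : [set y | set0 (row_mx (t%:M : 'rV[R]_1) y)] = set0); last by [].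
  rewrite IH; over.
by rewrite integral0.
Qed.

Definition disc_section m (rho t : R) : \bar R :=
  ((fun t => (ball_vol m * Num.sqrt (rho ^+ 2 - t ^+ 2) ^+ m)%:E) \_ `[- rho, rho]) t.

Lemma disc_section_integrable m rho :
  mu.-integrable `[- rho, rho]
    (EFin \o (fun t => ball_vol m * Num.sqrt (rho ^+ 2 - t ^+ 2) ^+ m)).
Proof.
apply: continuous_integrable; apply: continuous_mulr (continuous_cstr _) _.
exact: disc_power_continuous.
Qed.

Lemma int_disc_section m rho : 0 <= rho ->
  (\int[mu]_t disc_section m rho t = (ball_vol m.+1 * rho ^+ m.+1)%:E)%E.
Proof.
move=> r0; rewrite -integral_mkcond.
have Hi := disc_section_integrable m rho.
rewrite -[LHS]fineK; last exact: integrable_fin_num.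
congr (_%:E); rewrite -/(Rintegral _ _ _) RintegralZl//; last first.
  apply: continuous_integrable; exact: disc_power_continuous.
by rewrite int_disc_power// /ball_vol big_ord_recr/=; ring.
Qed.

Lemma section_ball m rho t : 0 <= rho ->
  (forall r, 0 <= r -> volume [set y : 'rV[R]_m | sqlen y <= r ^+ 2] =
    (ball_vol m * r ^+ m)%:E) ->
  volume [set y : 'rV[R]_m | sqlen (vcons t y) <= rho ^+ 2] = disc_section m rho t.
Proof.
move=> r0 IH; rewrite /disc_section patchE.
have tE : (t \in `[- rho, rho]%classic) = (t ^+ 2 <= rho ^+ 2).
  rewrite -(real_normK (num_real t)) ler_pXn2r ?nnegrE//.
  by apply/idP/idP; rewrite inE/= in_itv/= ler_norml.
rewrite tE; case: ifPn => [t2|t2].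
  rewrite -IH ?sqrtr_ge0//; congr volume; apply/seteqP; split => y /=;
    by rewrite sqlen_vcons sqr_sqrtr ?subr_ge0// lerBrDl.
rewrite (_ : [set y | _] = set0) ?volume0//.
apply/seteqP; split => // y /=; rewrite sqlen_vcons => H.
by move: t2; rewrite (le_trans _ H)// lerDl sqlen_ge0.
Qed.

Lemma volume_ball m rho : 0 <= rho ->
  volume [set y : 'rV[R]_m | sqlen y <= rho ^+ 2] = (ball_vol m * rho ^+ m)%:E.
Proof.
elim: m rho => [|m IH] rho r0 /=.
  rewrite /ball_vol big_ord0 mulr1 indicE mem_set//=.
  by rewrite /sqlen big_ord0 sqr_ge0.
rewrite -int_disc_section//; apply: eq_integral => t _.
under eq_set do rewrite row_mx_vcons.
exact: section_ball.
Qed.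

(** Removing the origin changes one slice only. The cone over the unit sphere is
    this punctured ball. *)
Lemma volume_punctured_ball m :
  volume [set y : 'rV[R]_m.+1 | y != 0 /\ sqlen y <= 1] = (ball_vol m.+1)%:E.
Proof.
pose g t := volume [set y : 'rV[R]_m | row_mx (t%:M : 'rV[R]_1) y != 0 /\
  sqlen (row_mx (t%:M : 'rV[R]_1) y : 'rV[R]_m.+1) <= 1].
have gE t : t != 0 -> g t = disc_section m 1 t.
  move=> t0; rewrite -section_ball//; last by move=> r; exact: volume_ball.
  congr volume; apply/seteqP; split => y /=; rewrite row_mx_vcons expr1n.
    by case.
  move=> H; split => //; apply/eqP => /rowP/(_ ord0); rewrite vcons0 mxE => t0'.
  by rewrite t0' eqxx in t0.
have ms : measurable_fun [set: R] (disc_section m 1).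
  have := measurable_int mu (disc_section_integrable m 1).
  by move=> /(measurable_restrictT _ _).1; apply.
have msD : measurable_fun (setT `\ (0 : R)) (disc_section m 1).
  exact: measurable_funS ms.
have mg : measurable_fun (setT `\ (0 : R)) g.
  apply: eq_measurable_fun msD => t; rewrite inE/= => -[_ /eqP t0].
  by rewrite gE.
have <- : (\int[mu]_t disc_section m 1 t = (ball_vol m.+1)%:E)%E.
  by rewrite int_disc_section// expr1n mulr1.
rewrite -[LHS]/(\int[mu]_t g t)%E.
rewrite -(integral_setD1 _ mg) -?(integral_setD1 _ msD); try exact: measurableD.
by apply: eq_integral => t; rewrite inE/= => -[_ /eqP t0]; exact: gE.
Qed.

Lemma cone_unit_sphere n :
  cone (@unit_sphere R n) = [set y | y != 0 /\ sqlen y <= 1].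
Proof.
apply/seteqP; split => [z [t [x [/andP[t0 t1] hx ->]]]|z [z0 z1]] /=.
  have sx : sqlen x = 1.
    have : enorm x ^+ 2 = 1 by rewrite hx expr1n.
    by rewrite /enorm sqr_sqrtr ?sqlen_ge0.
  have E : sqlen (t *: x) = t ^+ 2.
    rewrite -[RHS]mulr1 -sx /sqlen mulr_sumr; apply: eq_bigr => i _.
    by rewrite mxE exprMn.
  split; last by rewrite E expr_le1// ltW.
  apply/eqP => E0; move: E; rewrite E0 /sqlen big1; last by move=> i _; rewrite mxE expr0n.
  by move/esym/eqP; rewrite sqrf_eq0 gt_eqF.
have q0 : 0 < sqlen z.
  rewrite lt_neqAle sqlen_ge0 andbT eq_sym; apply: contra z0.
  rewrite /sqlen psumr_eq0; last by move=> i _; rewrite sqr_ge0.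
  move=> /allP H; apply/eqP/rowP => i; rewrite mxE.
  by have := H i; rewrite mem_index_enum => /(_ isT)/=; rewrite sqrf_eq0 => /eqP.
have r0 : 0 < Num.sqrt (sqlen z) by rewrite sqrtr_gt0.
exists (Num.sqrt (sqlen z)), ((Num.sqrt (sqlen z))^-1 *: z); split.
- by rewrite r0/= -sqrtr1 ler_wsqrtr.
- rewrite /unit_sphere/= /enorm.
  have -> : \sum_(i < n) ((Num.sqrt (sqlen z))^-1 *: z) 0 i ^+ 2 =
      (Num.sqrt (sqlen z))^-1 ^+ 2 * sqlen z.
    by rewrite /sqlen mulr_sumr; apply: eq_bigr => i _; rewrite mxE exprMn.
  by rewrite exprVn sqr_sqrtr ?sqlen_ge0// mulVf ?sqrtr1// gt_eqF.
- by rewrite scalerA divff ?scale1r// gt_eqF.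
Qed.

Lemma omegaE m : omega R m.+1 = m.+1%:R * ball_vol m.+1.
Proof.
by rewrite /omega /sphere_measure cone_unit_sphere volume_punctured_ball.
Qed.

(** The ratio of the two sphere areas is [1 / (2 int_0^(pi/2) sin^k)]: since
    [omega_n] is [n] times the volume of the ball, it is read off the slicing of
    the ball by parallel hyperplanes and the recurrence for [wallis]. *)
Lemma D_constE k : D_const R k.+2 = D_ratio k.
Proof.
rewrite /D_const /D_ratio !omegaE subn2/=.
rewrite (_ : k.+2%:R - 2 = k%:R); last by rewrite -[k.+2]addn2 natrD addrK.
set I := Rintegral _ _ _; rewrite mulrC; congr (_ * _).
have v0 := ball_vol_gt0 k.+1.
have w0 := @wallis0_gt0 R k.
rewrite [ball_vol k.+2]/ball_vol big_ord_recr/= -/(ball_vol k.+1) sin_pow_intE.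
have n1 : k.+1%:R != 0 :> R by rewrite pnatr_eq0.
have n2 : k.+2%:R != 0 :> R by rewrite pnatr_eq0.
have -> : wallis k.+2 0 = k.+1%:R / k.+2%:R * wallis k 0 :> R.
  by rewrite mulrAC -wallis_sinS mulrAC divff ?mul1r.
move: (k.+1%:R) (k.+2%:R) n1 n2 (lt0r_neq0 v0) (lt0r_neq0 w0) => N1 N2 n1 n2 nv nw.
by field; rewrite n1 n2 nv nw.
Qed.

End BallVolume.

(** * The reflected kernel *)

Section TestFunctions.
Context {R : realType}.
Implicit Types (n : nat) (c L : R).

Lemma is_derive_const_along (V : normedModType R) (f : V -> R) (x v : V) :
  (forall h : R, f (x + h *: v) = f x) -> is_derive x v f 0.
Proof.
move=> H; have H0 : x = x + (0 : R) *: v by rewrite scale0r addr0.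
rewrite [X in is_derive X]H0; apply/is_derive_line.
rewrite (_ : (fun h => _) = cst (f x)); last by apply/funext => h; rewrite H.
exact: is_derive_cst.
Qed.

Lemma is_derive_translate (V : normedModType R) (f : V -> R) (x v w : V) (d : R) :
  is_derive (x + w) v f d -> is_derive x v (fun y => f (y + w)) d.
Proof.
move=> H; have E y : y = y + (0 : R) *: v by rewrite scale0r addr0.
rewrite [X in is_derive X]E; apply/is_derive_line.
under [X in is_derive _ _ X]eq_fun do rewrite addrAC.
by apply/is_derive_line; rewrite -E.
Qed.

(** Up to a constant factor [psi] is the gradient of the smoothed fundamental
    solution; [psi1] and [psi2] are its first and pure second derivatives. *)
Definition psi n c (i : 'I_n) (y : 'rV[R]_n) : R := y 0 i * kap n c y.

Definition psi1 n c (i j : 'I_n) (y : 'rV[R]_n) : R :=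
  (i == j)%:R * kap n c y - n%:R * (y 0 i * y 0 j * kap n.+2 c y).

Definition psi2 n c (i j : 'I_n) (y : 'rV[R]_n) : R :=
  n%:R * (n.+2%:R * (y 0 i * y 0 j ^+ 2 * kap n.+4 c y) -
          (2 * (i == j)%:R * y 0 j + y 0 i) * kap n.+2 c y).

(** The divergence of [psi]: as [c] tends to zero, a constant multiple of an
    approximate identity at the origin. *)
Definition rho n c (y : 'rV[R]_n) : R := n%:R * c * kap n.+2 c y.

Definition rho1 n c (i : 'I_n) (y : 'rV[R]_n) : R :=
  - (n%:R * n.+2%:R * c * (y 0 i * kap n.+4 c y)).

Section Derivatives.
Context {n : nat} {c : R}.
Hypothesis c0 : 0 < c.
Implicit Types (i j : 'I_n) (y : 'rV[R]_n).

Lemma is_derive_psi i j y : is_derive y (delta_mx 0 j) (psi n c i) (psi1 n c i j y).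
Proof.
have := is_derive_mulr _ _ _ _ _ _ (is_derive_entry n j i y) (is_derive_kap n n c j y c0).
by congr is_derive; rewrite /psi1; ring.
Qed.

Lemma is_derive_psi1 i j y :
  is_derive y (delta_mx 0 j) (psi1 n c i j) (psi2 n c i j y).
Proof.
have Hk := is_derive_kap n n c j y c0.
have Hk2 := is_derive_kap n n.+2 c j y c0.
have Hy := is_derive_mulr _ _ _ _ _ _ (is_derive_entry n j i y) (is_derive_entry n j j y).
have := is_derive_subr _ _ _ _ _ _ (is_derive_scaler _ _ _ (i == j)%:R _ Hk)
  (is_derive_scaler _ _ _ n%:R _ (is_derive_mulr _ _ _ _ _ _ Hy Hk2)).
congr is_derive; rewrite /psi2 eqxx mulr1n.
by have [->|_] := eqVneq i j; rewrite ?mulr1n ?mulr0n; ring.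
Qed.

Lemma is_derive_rho i y : is_derive y (delta_mx 0 i) (rho n c) (rho1 n c i y).
Proof.
have := is_derive_scaler _ _ _ (n%:R * c) _ (is_derive_kap n n.+2 c i y c0).
by congr is_derive; rewrite /rho1; ring.
Qed.

Lemma div_psi y : \sum_i psi1 n c i i y = rho n c y.
Proof.
have S1 : \sum_(i < n) (i == i)%:R * kap n c y = n%:R * kap n c y.
  by under eq_bigr do rewrite eqxx mul1r; rewrite sumr_const card_ord -[LHS]mulr_natl.
have S2 : \sum_(i < n) n%:R * (y 0 i * y 0 i * kap n.+2 c y) =
    n%:R * (sqlen y * kap n.+2 c y).
  by rewrite -mulr_sumr /sqlen mulr_suml.
rewrite /psi1 sumrB S1 S2 /rho -(sqlen_kap c0 n y); ring.
Qed.

Lemma lap_psi i y : \sum_j psi2 n c i j y = rho1 n c i y.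
Proof.
have S1 : \sum_(j < n) n.+2%:R * (y 0 i * y 0 j ^+ 2 * kap n.+4 c y) =
    n.+2%:R * (y 0 i * sqlen y * kap n.+4 c y).
  by rewrite -mulr_sumr /sqlen; congr (_ * _); rewrite mulr_sumr mulr_suml.
have S2 : \sum_(j < n) (2 * (i == j)%:R * y 0 j + y 0 i) = n.+2%:R * y 0 i.
  rewrite big_split/= sumr_const card_ord -[X in _ + X]mulr_natl (bigD1 i)//=.
  rewrite eqxx mulr1 big1 ?addr0; last first.
    by move=> j /negPf; rewrite eq_sym => ->; rewrite mulr0 mul0r.
  by rewrite -[n.+2%:R]natr1 -natr1; ring.
rewrite /psi2 -mulr_sumr sumrB S1 -mulr_suml S2 /rho1 -(sqlen_kap c0 n.+2 y); ring.
Qed.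

Lemma psi_continuous i : continuous (psi n c i).
Proof. exact: entry_kap_continuous. Qed.

Lemma psi1_continuous i j : continuous (psi1 n c i j).
Proof.
apply: continuous_subr; apply: continuous_mulr (continuous_cstr _) _.
  exact: kap_continuous.
apply: continuous_mulr; last exact: kap_continuous.
by apply: continuous_mulr; exact: continuous_entry.
Qed.

Lemma psi2_continuous i j : continuous (psi2 n c i j).
Proof.
apply: continuous_mulr (continuous_cstr _) _; apply: continuous_subr.
  apply: continuous_mulr (continuous_cstr _) _.
  apply: continuous_mulr; last exact: kap_continuous.
  by apply: continuous_mulr (continuous_entry _ _) (continuous_expr _ _ (continuous_entry _ _)).
apply: continuous_mulr; last exact: kap_continuous.
apply: continuous_addr (continuous_entry _ _).
exact: continuous_mulr (continuous_cstr _) (continuous_entry _ _).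
Qed.

Lemma rho_continuous : continuous (rho n c).
Proof. exact: continuous_mulr (continuous_cstr _) (kap_continuous _ _ _ c0). Qed.

Lemma rho_ge0 y : 0 <= rho n c y.
Proof. by apply: mulr_ge0; [rewrite mulr_ge0// ltW|rewrite ltW// kap_gt0]. Qed.

Lemma rho1_continuous i : continuous (rho1 n c i).
Proof.
rewrite /rho1; under eq_fun do rewrite -mulNr.
exact: continuous_mulr (continuous_cstr _) (entry_kap_continuous _ _ _ _ c0).
Qed.

Lemma psi1_bound i j y : `|psi1 n c i j y| <= n.+1%:R * kap n c y.
Proof.
have k0 s : 0 < kap s c y by exact: kap_gt0.
have h1 : `|(i == j)%:R * kap n c y| <= kap n c y.
  rewrite normrM (gtr0_norm (k0 _)) ler_piMl ?(ltW (k0 _))//.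
  by case: (_ == _); rewrite ?normr1 ?normr0.
have h2 : `|y 0 i * y 0 j * kap n.+2 c y| <= kap n c y.
  rewrite normrM (gtr0_norm (k0 _)) normrM -mulrA (le_trans _ (entry_kap c0 n y i))//.
  by rewrite ler_wpM2l// (entry_kap c0 n.+1 y j).
apply: le_trans (ler_normB _ _) _.
by rewrite -natr1 mulrDl mul1r addrC lerD// normrM (ger0_norm (ler0n _ _)) ler_wpM2l.
Qed.

End Derivatives.

Lemma psi_bound n c (i : 'I_n.+1) y : 0 < c -> `|psi n.+1 c i y| <= kap n c y.
Proof.
by move=> c0; rewrite normrM (gtr0_norm (kap_gt0 c0 _ _)) (entry_kap c0 n y i).
Qed.

(** The term centered at the image of the pole under the reflection in the
    hyperplane [y_0 = -1] carries signs that make [phi] vanish there. *)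
Section Reflected.
Context {n : nat} {c : R}.
Hypothesis c0 : 0 < c.
Implicit Types (i j : 'I_n.+1) (y : 'rV[R]_n.+1).

Definition image y : 'rV[R]_n.+1 := y + 2 *: delta_mx 0 ord0.

Definition sg i : R := if i == ord0 then -1 else 1.

Definition phi i y := psi n.+1 c i y - sg i * psi n.+1 c i (image y).
Definition phi1 i j y := psi1 n.+1 c i j y - sg i * psi1 n.+1 c i j (image y).
Definition phi2 i j y := psi2 n.+1 c i j y - sg i * psi2 n.+1 c i j (image y).

Lemma norm_sg i : `|sg i| = 1.
Proof. by rewrite /sg; case: ifP => _; rewrite ?normrN normr1. Qed.

Lemma image_vcons (y : 'rV[R]_n) : image (vcons (-1) y) = vcons 1 y.
Proof.
by rewrite /image [RHS](vcons_shift n (-1) 1) opprK.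
Qed.

Lemma image_continuous : continuous image.
Proof.
move=> y; apply: cvg_row => i.
rewrite (_ : (fun z => _) =
  (fun z : 'rV[R]_n.+1 => z 0 i + (2 *: delta_mx 0 ord0 : 'rV[R]_n.+1) 0 i)).
  exact: (continuous_addr _ _ (continuous_entry _ _) (continuous_cstr _)).
by apply/funext => z; rewrite mxE.
Qed.

Lemma sqlen_image y : sqlen (image y) = sqlen y + 4 * (y 0 ord0 + 1).
Proof.
rewrite [y]vcons_eta /image; set t := y 0 ord0; set y' := \row_j _.
have -> : vcons t y' + 2 *: delta_mx 0 ord0 = vcons (t + 2) y'.
  by rewrite (vcons_shift n t (t + 2)) addrAC subrr add0r.
by rewrite !sqlen_vcons vcons0; ring.
Qed.

Lemma sqlen_image_ge1 y : -1 <= y 0 ord0 -> 1 <= sqlen (image y).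
Proof.
rewrite sqlen_image; have := sqlen_ge _ y ord0.
move: (sqlen y) (y 0 ord0) => q t tq t1.
have t3 : 0 <= (t + 1) * (t + 3) by rewrite mulr_ge0//; lra.
have E : q + 4 * (t + 1) - 1 = (q - t ^+ 2) + (t + 1) * (t + 3) by ring.
by rewrite -subr_ge0 E addr_ge0// subr_ge0.
Qed.

(** Above the bottom face a point is closer to the pole than its image is, so
    the bounds at the pole also hold for the reflected terms. *)
Lemma kap_image s y : -1 <= y 0 ord0 -> kap s c (image y) <= kap s c y.
Proof.
move=> y0; apply: le_kap => //; rewrite sqlen_image lerD2r lerDl.
by rewrite mulr_ge0// -lerBlDr sub0r.
Qed.

Lemma is_derive_phi i j y : is_derive y (delta_mx 0 j) (phi i) (phi1 i j y).
Proof.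
apply: (is_derive_subr _ _ _ _ _ _ (is_derive_psi c0 i j y)).
apply: is_derive_scaler; apply: is_derive_translate.
exact: is_derive_psi.
Qed.

Lemma is_derive_phi1 i j y :
  is_derive y (delta_mx 0 j) (phi1 i j) (phi2 i j y).
Proof.
apply: (is_derive_subr _ _ _ _ _ _ (is_derive_psi1 c0 i j y)).
apply: is_derive_scaler; apply: is_derive_translate.
exact: is_derive_psi1.
Qed.

Lemma lap_phi i y : \sum_j phi2 i j y =
  rho1 n.+1 c i y - sg i * rho1 n.+1 c i (image y).
Proof. by rewrite /phi2 sumrB -[X in _ - X]mulr_sumr !(lap_psi c0). Qed.

Lemma comp_image_continuous (f : 'rV[R]_n.+1 -> R) : continuous f ->
  continuous (fun y => f (image y)).
Proof.
by move=> cf y; exact: (continuous_comp (image_continuous y) (cf (image y))).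
Qed.

Let reflected_continuous i f : continuous f ->
  continuous (fun y => f y - sg i * f (image y)).
Proof.
move=> cf; apply: continuous_subr => //.
exact: continuous_mulr (continuous_cstr _) (comp_image_continuous _ cf).
Qed.

Lemma phi_continuous i : continuous (phi i).
Proof. by apply: reflected_continuous; exact: psi_continuous. Qed.

Lemma phi1_continuous i j : continuous (phi1 i j).
Proof. by apply: reflected_continuous; exact: psi1_continuous. Qed.

Lemma phi2_continuous i j : continuous (phi2 i j).
Proof. by apply: reflected_continuous; exact: psi2_continuous. Qed.

Lemma phi_bound i y : -1 <= y 0 ord0 -> `|phi i y| <= 2 * kap n c y.
Proof.
move=> y0; apply: le_trans (ler_normB _ _) _.
rewrite mulr_natl mulr2n lerD ?psi_bound//.
rewrite normrM norm_sg mul1r (le_trans (psi_bound _ _ _ _ c0))//.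
exact: kap_image.
Qed.

Lemma phi1_bound i j y : -1 <= y 0 ord0 ->
  `|phi1 i j y| <= 2 * n.+2%:R * kap n.+1 c y.
Proof.
move=> y0; apply: le_trans (ler_normB _ _) _.
rewrite -mulrA mulr_natl mulr2n lerD ?psi1_bound//.
rewrite normrM norm_sg mul1r (le_trans (psi1_bound c0 _ _ _))//.
by rewrite ler_wpM2l// kap_image.
Qed.

Lemma phi_bottom i (y : 'rV[R]_n) : phi i (vcons (-1) y) = 0.
Proof.
rewrite /phi image_vcons /psi !kap_vcons sqrrN /sg.
case: (unliftP ord0 i) => [j|] ->.
  by rewrite !vconsS mul1r subrr.
by rewrite !vcons0 eqxx; ring.
Qed.

Lemma phi1_bottom i (y : 'rV[R]_n) :
  phi1 i ord0 (vcons (-1) y) = 2 * psi1 n.+1 c i ord0 (vcons (-1) y).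
Proof.
rewrite /phi1 image_vcons /psi1 !kap_vcons sqrrN /sg !vcons0.
case: (unliftP ord0 i) => [j|] ->.
  by rewrite !vconsS [lift _ _ == _]eq_sym (negPf (neq_lift _ _)) mulr0n; ring.
by rewrite !vcons0 eqxx mulr1n; ring.
Qed.

(** With [c = 0] and [y] replaced by its direction, this is
    [|e - n (e . y) y|^2 = 1 + n (n - 2) (e . y)^2]. *)
Lemma psi1_bottom_sqr (y : 'rV[R]_n.+1) : y 0 ord0 = -1 ->
  \sum_i psi1 n.+1 c i ord0 y ^+ 2 <=
  kap n.+1 c y ^+ 2 * (1 + n.+1%:R * (n.+1%:R - 2) * kap 2 c y).
Proof.
move=> y0; set N : R := n.+1%:R.
have kE : kap n.+3 c y = kap n.+1 c y * kap 2 c y by rewrite -kapD addn2.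
have k2 := sqlen_kap c0 0 y; rewrite [kap 0 _ _]expr0 in k2.
have kp := kap_gt0 c0 n.+1 y; have k2p := kap_gt0 c0 2 y.
have E (i : 'I_n.+1) : psi1 n.+1 c i ord0 y ^+ 2 =
    kap n.+1 c y ^+ 2 * ((i == ord0)%:R * (1 + 2 * N * y 0 i * kap 2 c y) +
                         N ^+ 2 * kap 2 c y ^+ 2 * y 0 i ^+ 2).
  rewrite /psi1 y0 kE -/N.
  by case: (i == ord0); rewrite ?mulr1n ?mulr0n; ring.
rewrite (eq_bigr _ (fun i _ => E i)) -mulr_sumr ler_pM2l ?(exprn_gt0 _ kp)//.
rewrite big_split/= -mulr_sumr -/(sqlen y) (bigD1 ord0)//= big1 ?addr0; last first.
  by move=> i /negPf ->; rewrite mul0r.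
rewrite y0 mulr1n mul1r.
have : N ^+ 2 * (kap 2 c y * (c * kap 2 c y)) >= 0.
  by rewrite mulr_ge0 ?sqr_ge0// mulr_ge0 ?(ltW k2p)// mulr_ge0 ?(ltW c0)// ltW.
have -> : N ^+ 2 * kap 2 c y ^+ 2 * sqlen y =
    N ^+ 2 * (kap 2 c y * ((sqlen y + c) * kap 2 c y - c * kap 2 c y)) by ring.
rewrite k2; move: (kap 2 c y) => z H.
have -> : N ^+ 2 * (z * (1 - c * z)) = N ^+ 2 * z - N ^+ 2 * (z * (c * z)) by ring.
move: (N ^+ 2 * (z * (c * z))) H => W H.
have -> : 1 + N * (N - 2) * z = 1 + 2 * N * -1 * z + N ^+ 2 * z by ring.
lra.
Qed.

End Reflected.
End TestFunctions.

(** * Cutoff and Green's identity *)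

Section Cutoff.
Context {R : realType}.
Implicit Types (n : nat) (L s : R).

(** The cutoff vanishes with its derivative at [L] and [- L]. Its derivative
    also vanishes at the pole, linearly: this compensates the singularity of the
    derivatives of the kernel in the error terms. *)
Definition cut L s := (1 - (s / L) ^+ 2) ^+ 2.
Definition cut1 L s := - (4 * s / L ^+ 2 * (1 - (s / L) ^+ 2)).
Definition cut2 L s := - (4 / L ^+ 2 * (1 - 3 * (s / L) ^+ 2)).

Lemma is_derive_cut L s : 0 < L -> is_derive s 1 (cut L) (cut1 L s).
Proof.
move=> L0.
have H : is_derive s 1 (fun s => 1 - (s / L) ^+ 2) (0 - 2%:R * (s / L) ^+ 1 * (1 * L^-1 + s * 0)).
  apply: (is_derive_subr _ _ _ _ _ _ (is_derive_cstr _ _ 1)).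
  apply: (is_derive_expr _ _ _ 2); apply: is_derive_mulr.
have := is_derive_expr _ _ _ 2 _ H.
by congr is_derive; rewrite /cut1/=; field; rewrite gt_eqF.
Qed.

Lemma is_derive_cut1 L s : 0 < L -> is_derive s 1 (cut1 L) (cut2 L s).
Proof.
move=> L0.
have H : is_derive s 1 (fun s => 1 - (s / L) ^+ 2) (0 - 2%:R * (s / L) ^+ 1 * (1 * L^-1 + s * 0)).
  apply: (is_derive_subr _ _ _ _ _ _ (is_derive_cstr _ _ 1)).
  apply: (is_derive_expr _ _ _ 2); apply: is_derive_mulr.
have Hs : is_derive s 1 (fun s => - 4 / L ^+ 2 * s) (- 4 / L ^+ 2 * 1).
  apply: is_derive_scaler.
have := is_derive_mulr _ _ _ _ _ _ Hs H.
rewrite (_ : (fun s => _) = cut1 L); last first.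
  by apply/funext => t; rewrite /cut1; field; rewrite gt_eqF.
by congr is_derive; rewrite /cut2/=; field; rewrite gt_eqF.
Qed.

Lemma cut_range L s : - L <= s <= L -> 0 <= (s / L) ^+ 2 <= 1.
Proof.
rewrite -ler_norml => sL; rewrite sqr_ge0/= -real_normK ?num_real// expr_le1//.
have [L0|L0] := ltP 0 L; last first.
  have -> : s = 0 by apply/eqP; rewrite -normr_le0 (le_trans sL).
  by rewrite mul0r normr0.
by rewrite normrM normfV (gtr0_norm L0) ler_pdivrMr// mul1r.
Qed.

Lemma cut_bound L s : - L <= s <= L -> 0 <= cut L s <= 1.
Proof.
move=> /cut_range; rewrite /cut; move: (_ ^+ 2) => t /andP[t0 t1].
by rewrite sqr_ge0/= expr_le1// ?subr_ge0//; lra.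
Qed.

Lemma cut1_bound L s : 0 < L -> - L <= s <= L -> `|cut1 L s| <= 4 / L ^+ 2 * `|s|.
Proof.
move=> L0 /cut_range; rewrite /cut1; move: ((s / L) ^+ 2) => t /andP[t0 t1].
have -> : 4 / L ^+ 2 * `|s| = `|4 * s / L ^+ 2|.
  by rewrite [4 * s / _]mulrAC normrM [`|4 / _|]ger0_norm// divr_ge0// sqr_ge0.
by rewrite normrN normrM ler_piMr// ger0_norm ?subr_ge0//; lra.
Qed.

Lemma cut2_bound L s : 0 < L -> - L <= s <= L -> `|cut2 L s| <= 8 / L ^+ 2.
Proof.
move=> L0 /cut_range; rewrite /cut2; move: ((s / L) ^+ 2) => t /andP[t0 t1].
rewrite normrN normrM ger0_norm ?divr_ge0 ?sqr_ge0//.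
have -> : 8 / L ^+ 2 = 4 / L ^+ 2 * 2 by ring.
rewrite ler_wpM2l ?divr_ge0 ?sqr_ge0// ler_norml; lra.
Qed.

Lemma cut_continuous L : continuous (cut L).
Proof.
apply: continuous_expr; apply: continuous_subr (continuous_cstr _) _.
apply: continuous_expr; apply: continuous_mulr _ (continuous_cstr _).
by move=> x; exact: cvg_id.
Qed.

Lemma cut1_continuous L : 0 < L -> continuous (cut1 L).
Proof.
by move=> L0 s; exact: (@is_derive1_continuous _ _ _ (cut2 L s)) (is_derive_cut1 L s L0).
Qed.

Lemma cut2_continuous L : continuous (cut2 L).
Proof.
rewrite /cut2; under eq_fun do rewrite -mulNr.
apply: continuous_mulr (continuous_cstr _) _.
apply: continuous_subr (continuous_cstr _) _.
apply: continuous_mulr (continuous_cstr _) _.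
apply: continuous_expr; apply: continuous_mulr _ (continuous_cstr _).
by move=> x; exact: cvg_id.
Qed.

Section Product.
Context {n : nat} {L : R}.
Hypothesis L0 : 0 < L.
Implicit Types (i j : 'I_n) (y : 'rV[R]_n).

Definition chi_rest j y := \prod_(i | i != j) cut L (y 0 i).
Definition chi y := \prod_i cut L (y 0 i).
Definition chi1 j y := cut1 L (y 0 j) * chi_rest j y.
Definition chi2 j y := cut2 L (y 0 j) * chi_rest j y.

Lemma chiE j y : chi y = cut L (y 0 j) * chi_rest j y.
Proof. by rewrite /chi (bigD1 j). Qed.

Let is_derive_cut_rest (f : R -> R) (df : R) j y :
  is_derive (y 0 j) 1 f df ->
  is_derive y (delta_mx 0 j) (fun y => f (y 0 j) * chi_rest j y) (df * chi_rest j y).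
Proof.
move=> Hf.
have Hr : is_derive y (delta_mx 0 j) (chi_rest j) 0.
  apply: is_derive_const_along => h; apply: eq_bigr => i /negPf ij.
  by rewrite !mxE eqxx ij/= mulr0 addr0.
have := is_derive_mulr _ _ _ _ _ _
  (is_derive_comp_real f (fun y => y 0 j) _ _ _ _ Hf (is_derive_entry n j j y)) Hr.
by congr is_derive; rewrite eqxx mulr1n mulr1 mulr0 addr0.
Qed.

Lemma is_derive_chi j y : is_derive y (delta_mx 0 j) chi (chi1 j y).
Proof.
rewrite (_ : chi = (fun y => cut L (y 0 j) * chi_rest j y)); last first.
  by apply/funext => z; exact: chiE.
by apply: is_derive_cut_rest; exact: is_derive_cut.
Qed.

Lemma is_derive_chi1 j y : is_derive y (delta_mx 0 j) (chi1 j) (chi2 j y).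
Proof. by apply: is_derive_cut_rest; exact: is_derive_cut1. Qed.

Let in_cube y := forall i, - L <= y 0 i <= L.

Lemma chi_rest_bound j y : in_cube y -> 0 <= chi_rest j y <= 1.
Proof.
move=> hy; apply/andP; split.
  by apply: prodr_ge0 => i _; have /andP[] := cut_bound _ _ (hy i).
by apply: prodr_ile1 => i _; exact: cut_bound.
Qed.

Lemma chi_bound y : in_cube y -> 0 <= chi y <= 1.
Proof.
move=> hy; apply/andP; split.
  by apply: prodr_ge0 => i _; have /andP[] := cut_bound _ _ (hy i).
by apply: prodr_ile1 => i _; exact: cut_bound.
Qed.

Lemma chi1_bound j y : in_cube y -> `|chi1 j y| <= 4 / L ^+ 2 * `|y 0 j|.
Proof.
move=> hy; have /andP[r0 r1] := chi_rest_bound j y hy.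
rewrite normrM (ger0_norm r0) (le_trans _ (cut1_bound L _ L0 (hy j)))//.
by rewrite ler_piMr.
Qed.

Lemma chi2_bound j y : in_cube y -> `|chi2 j y| <= 8 / L ^+ 2.
Proof.
move=> hy; have /andP[r0 r1] := chi_rest_bound j y hy.
rewrite normrM (ger0_norm r0) (le_trans _ (cut2_bound L _ L0 (hy j)))//.
by rewrite ler_piMr.
Qed.

Lemma cut_face s : s ^+ 2 = L ^+ 2 -> (s / L) ^+ 2 = 1.
Proof. by move=> E; rewrite exprMn exprVn E divff// expf_neq0// gt_eqF. Qed.

Lemma chi_face j y : y 0 j ^+ 2 = L ^+ 2 -> chi y = 0.
Proof. by move=> E; rewrite (chiE j) /cut (cut_face _ E) subrr expr0n mul0r. Qed.

Lemma chi1_face j y : y 0 j ^+ 2 = L ^+ 2 -> chi1 j y = 0.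
Proof. by move=> E; rewrite /chi1 /cut1 (cut_face _ E) subrr mulr0 oppr0 mul0r. Qed.

Lemma chi_origin : chi 0 = 1.
Proof. by apply: big1 => i _; rewrite /cut mxE mul0r expr0n subr0 expr1n. Qed.

Lemma chi1_origin j : chi1 j 0 = 0.
Proof. by rewrite /chi1 /cut1 mxE mulr0 !mul0r oppr0 mul0r. Qed.

Let continuous_prod (I : Type) (r : seq I) (P : pred I) (F : I -> 'rV[R]_n -> R) :
  (forall e : I, continuous (F e)) -> continuous (fun y => \prod_(e <- r | P e) F e y).
Proof.
move=> cF; elim: r => [|e r IH].
  by under eq_fun do rewrite big_nil; exact: continuous_cstr.
under eq_fun do rewrite big_cons.
by case: (P e) => //; exact: continuous_mulr.
Qed.

Let comp_entry_continuous (f : R -> R) j : continuous f ->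
  continuous (fun y => f (y 0 j)).
Proof. by move=> cf y; exact: (continuous_comp (continuous_entry _ _ _) (cf _)). Qed.

Lemma chi_rest_continuous j : continuous (chi_rest j).
Proof.
by apply: continuous_prod => i; apply: comp_entry_continuous; exact: cut_continuous.
Qed.

Lemma chi_continuous : continuous chi.
Proof.
by apply: continuous_prod => i; apply: comp_entry_continuous; exact: cut_continuous.
Qed.

Lemma chi1_continuous j : continuous (chi1 j).
Proof.
apply: continuous_mulr (chi_rest_continuous j).
by apply: comp_entry_continuous; exact: cut1_continuous.
Qed.

Lemma chi2_continuous j : continuous (chi2 j).
Proof.
apply: continuous_mulr (chi_rest_continuous j).
by apply: comp_entry_continuous; exact: cut2_continuous.
Qed.

End Product.
End Cutoff.

Section GreenBox.
Context {R : realType} {n : nat} {a b : nat -> R}.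
Hypothesis ab : forall i, a i < b i.
Let abW i : a i <= b i := ltW (ab i).
Implicit Types (i j : 'I_n.+1) (y : 'rV[R]_n.+1).
Let a' := fun i : nat => a i.+1.
Let b' := fun i : nat => b i.+1.

(** The divergence theorem for a field whose normal component vanishes on all
    faces of the box but the bottom one. *)
Lemma box_int_div (W W' : 'I_n.+1 -> 'rV[R]_n.+1 -> R) :
  (forall i, box_continuous a b (W i)) -> (forall i, box_continuous a b (W' i)) ->
  (forall i y, in_box a b y -> is_derive y (delta_mx 0 i) (W i) (W' i y)) ->
  (forall i y, in_box a b y -> y 0 i = b i -> W i y = 0) ->
  (forall i y, in_box a b y -> i != ord0 -> y 0 i = a i -> W i y = 0) ->
  box_int a b (fun y => \sum_i W' i y) =
    - box_int a' b' (fun z : 'rV[R]_n => W ord0 (vcons (a 0%N) z)).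
Proof.
move=> cW cW' dW Wb Wa.
rewrite (box_int_sum abW)// (bigD1 ord0 isT) big1; last first.
  move=> i i0; rewrite (box_int_gauss n.+1 a b i (W i) (W' i) abW (ab i) (cW i) (cW' i)
    (fun y hy _ => dW i y hy)).
  rewrite (box_int_ext _ _ _ _ (fun=> 0)) ?box_int_cst ?mul0r// => y hy.
  have hA : in_box a b (vset i (a i) y) by apply: in_box_vset => //; rewrite lexx abW.
  have hB : in_box a b (vset i (b i) y) by apply: in_box_vset => //; rewrite lexx abW.
  by rewrite Wb// ?Wa ?subrr ?mulr0// mxE eqxx.
rewrite [LHS]addr0 (box_int_gauss0 n a b (W ord0) (W' ord0) abW (ab 0%N) (cW ord0) (cW' ord0)
  (fun y hy _ => dW ord0 y hy)).
rewrite (box_int_ext _ a' b' (fun z : 'rV[R]_n => W ord0 (vcons (b 0%N) z)) (fun=> 0)).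
  by rewrite box_int_cst ?mul0r ?sub0r// => i; exact: abW.
move=> y hy; apply: Wb; last by rewrite vcons0.
by apply: in_box_vcons => //; rewrite lexx abW.
Qed.

(** Green's second identity against a function [th] that vanishes on the
    boundary of the box, and to first order except on the bottom face. *)
Lemma box_int_green (u : 'rV[R]_n.+1 -> R) (u1 u2 : 'I_n.+1 -> 'rV[R]_n.+1 -> R)
    (th : 'rV[R]_n.+1 -> R) (th1 th2 : 'I_n.+1 -> 'rV[R]_n.+1 -> R) :
  box_continuous a b u -> (forall j, box_continuous a b (u1 j)) ->
  (forall j, box_continuous a b (u2 j)) ->
  box_continuous a b th -> (forall j, box_continuous a b (th1 j)) ->
  (forall j, box_continuous a b (th2 j)) ->
  (forall j y, in_box a b y -> is_derive y (delta_mx 0 j) u (u1 j y)) ->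
  (forall j y, in_box a b y -> is_derive y (delta_mx 0 j) (u1 j) (u2 j y)) ->
  (forall j y, in_box a b y -> is_derive y (delta_mx 0 j) th (th1 j y)) ->
  (forall j y, in_box a b y -> is_derive y (delta_mx 0 j) (th1 j) (th2 j y)) ->
  (forall y, in_box a b y -> \sum_j u2 j y = 0) ->
  (forall j y, in_box a b y -> y 0 j = b j -> th y = 0 /\ th1 j y = 0) ->
  (forall j y, in_box a b y -> j != ord0 -> y 0 j = a j ->
    th y = 0 /\ th1 j y = 0) ->
  (forall y, in_box a b y -> y 0 ord0 = a 0%N -> th y = 0) ->
  box_int a b (fun y => u y * \sum_j th2 j y) =
    - box_int a' b' (fun z : 'rV[R]_n => u (vcons (a 0%N) z) * th1 ord0 (vcons (a 0%N) z)).
Proof.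
move=> cu cu1 cu2 cth cth1 cth2 du du1 dth dth1 lap_u thb tha th0.
pose W j y := u y * th1 j y - u1 j y * th y.
pose W' j y := u y * th2 j y - u2 j y * th y.
rewrite (box_int_ext _ _ _ _ (fun y => \sum_j W' j y)); last first.
  by move=> y hy; rewrite /W' sumrB -mulr_sumr -mulr_suml lap_u// mul0r subr0.
transitivity (- box_int a' b' (fun z : 'rV[R]_n => W ord0 (vcons (a 0%N) z)));
  last first.
  congr (- _); apply: box_int_ext => y hy; rewrite /W th0 ?mulr0 ?subr0 ?vcons0//.
  by apply: in_box_vcons => //; rewrite lexx abW.
apply: box_int_div.
- by move=> j; apply: box_continuousB; exact: box_continuousM.
- by move=> j; apply: box_continuousB; exact: box_continuousM.
- move=> j y hy.
  have := is_derive_subr _ _ _ _ _ _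
    (is_derive_mulr _ _ _ _ _ _ (du j y hy) (dth1 j y hy))
    (is_derive_mulr _ _ _ _ _ _ (du1 j y hy) (dth j y hy)).
  by congr is_derive; rewrite /W'; ring.
- by move=> j y hy yb; have [e1 e2] := thb j y hy yb; rewrite /W e1 e2 !mulr0 subrr.
- by move=> j y hy j0 ya; have [e1 e2] := tha j y hy j0 ya; rewrite /W e1 e2 !mulr0 subrr.
Qed.

End GreenBox.

(** * Estimate on a half-cube *)

Section HalfBox.
Context {R : realType}.

Definition lo (L : R) (i : nat) : R := if i is _.+1 then - L else -1.
Definition hi (L : R) (_ : nat) : R := L.

(** The derivatives are part of the data, so that explicit formulas can be used
    for the pull-back of a field by a similarity. *)
Record harmonic_field k (L : R) (U : 'I_k.+2 -> 'rV[R]_k.+2 -> R)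
    (U1 U2 : 'I_k.+2 -> 'I_k.+2 -> 'rV[R]_k.+2 -> R) : Prop := HarmonicField {
  hf_derive : forall i j y, in_box (lo L) (hi L) y ->
    is_derive y (delta_mx 0 j) (U i) (U1 i j y);
  hf_derive1 : forall i j y, in_box (lo L) (hi L) y ->
    is_derive y (delta_mx 0 j) (U1 i j) (U2 i j y);
  hf_cont : forall i y, in_box (lo L) (hi L) y -> {for y, continuous (U i)};
  hf_cont1 : forall i j y, in_box (lo L) (hi L) y -> {for y, continuous (U1 i j)};
  hf_cont2 : forall i j y, in_box (lo L) (hi L) y -> {for y, continuous (U2 i j)};
  hf_lap : forall i y, in_box (lo L) (hi L) y -> \sum_j U2 i j y = 0;
  hf_bound : forall y, in_box (lo L) (hi L) y -> \sum_i U i y ^+ 2 <= 1 }.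

Lemma cauchy_schwarz_unit n (x y : 'I_n -> R) (B : R) : 0 < B ->
  \sum_i x i ^+ 2 <= 1 -> \sum_i y i ^+ 2 <= B ^+ 2 -> `|\sum_i x i * y i| <= B.
Proof.
move=> B0 hx hy; apply: le_trans (ler_norm_sum _ _ _) _.
apply: (@le_trans _ _ (\sum_i (B / 2 * x i ^+ 2 + (2 * B)^-1 * y i ^+ 2))).
  apply: ler_sum => i _; rewrite normrM.
  rewrite -(real_normK (num_real (x i))) -(real_normK (num_real (y i))).
  have -> : B / 2 * `|x i| ^+ 2 + (2 * B)^-1 * `|y i| ^+ 2 =
      `|x i| * `|y i| + (2 * B)^-1 * (B * `|x i| - `|y i|) ^+ 2.
    by field; rewrite gt_eqF.
  by rewrite lerDl mulr_ge0 ?sqr_ge0// invr_ge0 mulr_ge0// ltW.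
rewrite big_split/= -!mulr_sumr.
have h1 : B / 2 * \sum_i x i ^+ 2 <= B / 2 by rewrite ler_piMr// divr_ge0// ltW.
have h2 : (2 * B)^-1 * \sum_i y i ^+ 2 <= B / 2.
  rewrite ler_pdivrMl ?mulr_gt0// (le_trans hy)//.
  by rewrite le_eqVlt; apply/orP; left; apply/eqP; field.
by rewrite (le_trans (lerD h1 h2))// -splitr.
Qed.

Section Estimate.
Context {k : nat} {L : R} {U : 'I_k.+2 -> 'rV[R]_k.+2 -> R}.
Context {U1 U2 : 'I_k.+2 -> 'I_k.+2 -> 'rV[R]_k.+2 -> R}.
Hypothesis L1 : 1 <= L.
Hypothesis HU : harmonic_field k L U U1 U2.
Implicit Types (i j : 'I_k.+2) (y : 'rV[R]_k.+2).

Let L0 : 0 < L. Proof. exact: lt_le_trans L1. Qed.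

Let lohi (i : nat) : lo L i < hi L i.
Proof. by case: i => [|i]; rewrite /lo/hi -subr_gt0 opprK addr_gt0. Qed.

Let lohiW (i : nat) : lo L i <= hi L i := ltW (lohi i).

Let cube (i : nat) : (fun=> - L) i <= (fun=> L) i.
Proof. by rewrite ge0_cp// ltW. Qed.

Lemma half_box_cube y : in_box (lo L) (hi L) y -> forall i, - L <= y 0 i <= L.
Proof.
move=> hy i; have /andP[h1 h2] := hy i; rewrite h2 andbT (le_trans _ h1)//.
by case: (nat_of_ord i) => [|n] //=; rewrite lerN2.
Qed.

Lemma half_box_top y : in_box (lo L) (hi L) y -> -1 <= y 0 ord0.
Proof. by move=> /(_ ord0)/andP[]. Qed.

Lemma half_box_bottom (z : 'rV[R]_k.+1) :
  in_box (fun=> - L) (fun=> L) z -> in_box (lo L) (hi L) (vcons (-1) z).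
Proof.
by move=> hz; apply: in_box_vcons => //=; rewrite lexx/= ltW// (lt_trans _ L0)// oppr_lt0.
Qed.

Let cU i : box_continuous (lo L) (hi L) (U i).
Proof. by apply: box_continuousW => // y hy; exact: (hf_cont _ _ _ _ _ HU). Qed.

Let cU1 i j : box_continuous (lo L) (hi L) (U1 i j).
Proof. by apply: box_continuousW => // y hy; exact: (hf_cont1 _ _ _ _ _ HU). Qed.

Let cU2 i j : box_continuous (lo L) (hi L) (U2 i j).
Proof. by apply: box_continuousW => // y hy; exact: (hf_cont2 _ _ _ _ _ HU). Qed.

Lemma field_le1 i y : in_box (lo L) (hi L) y -> `|U i y| <= 1.
Proof.
move=> hy; rewrite -(@expr_le1 _ 2)// real_normK ?num_real//.
apply: le_trans (hf_bound _ _ _ _ _ HU y hy).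
by rewrite (bigD1 i)//= lerDl; apply: sumr_ge0 => j _; exact: sqr_ge0.
Qed.

(** The divergence of the field multiplied by [chi]. *)
Definition div_cut y := \sum_i (U1 i i y * chi (L := L) y + U i y * chi1 (L := L) i y).

Section Smoothed.
Context {c : R}.
Hypothesis c0 : 0 < c.

Let theta i y := chi (L := L) y * phi (c := c) i y.
Let theta1 i j y := chi1 (L := L) j y * phi (c := c) i y + chi (L := L) y * phi1 (c := c) i j y.
Let err i j y := chi2 (L := L) j y * phi (c := c) i y +
  2 * (chi1 (L := L) j y * phi1 (c := c) i j y).
Let theta2 i j y := err i j y + chi (L := L) y * phi2 (c := c) i j y.
Let cchi : box_continuous (lo L) (hi L) (chi (n := k.+2) (L := L)).
Proof. by apply: continuous_box; exact: chi_continuous. Qed.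
Let cchi1 j : box_continuous (lo L) (hi L) (chi1 (L := L) j).
Proof. by apply: continuous_box; exact: chi1_continuous. Qed.
Let cchi2 j : box_continuous (lo L) (hi L) (chi2 (L := L) j).
Proof. by apply: continuous_box; exact: chi2_continuous. Qed.
Let cphi i : box_continuous (lo L) (hi L) (phi (n := k.+1) (c := c) i).
Proof. by apply: continuous_box; exact: phi_continuous. Qed.
Let cphi1 i j : box_continuous (lo L) (hi L) (phi1 (n := k.+1) (c := c) i j).
Proof. by apply: continuous_box; exact: phi1_continuous. Qed.
Let cphi2 i j : box_continuous (lo L) (hi L) (phi2 (n := k.+1) (c := c) i j).
Proof. by apply: continuous_box; exact: phi2_continuous. Qed.
Let crho : box_continuous (lo L) (hi L) (rho k.+2 c).
Proof. by apply: continuous_box; exact: rho_continuous. Qed.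
Let crho1 i : box_continuous (lo L) (hi L) (rho1 k.+2 c i).
Proof. by apply: continuous_box; exact: rho1_continuous. Qed.
Let crho1i i : box_continuous (lo L) (hi L) (fun y => rho1 k.+2 c i (image y)).
Proof. by apply: continuous_box; apply: comp_image_continuous; exact: rho1_continuous. Qed.
Let cpsi1 i j : box_continuous (lo L) (hi L) (psi1 k.+2 c i j).
Proof. by apply: continuous_box; exact: psi1_continuous. Qed.
Let ckap s : box_continuous (lo L) (hi L) (@kap R k.+2 s c).
Proof. by apply: continuous_box; exact: kap_continuous. Qed.

Let slice (f : 'rV[R]_k.+2 -> R) : box_continuous (lo L) (hi L) f ->
  box_continuous (fun=> - L) (fun=> L) (fun z : 'rV[R]_k.+1 => f (vcons (-1) z)).
Proof.
move=> cf; apply: (box_continuous_slice _ (lo L) (hi L) f) => //=.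
by rewrite lexx/= ltW// (lt_trans _ L0)// oppr_lt0.
Qed.

(* continuity on the half-cube of expressions in the functions above; the case
   analysis is purely syntactic *)
Ltac bcont_leaf F := lazymatch F with
  | context [U2] => exact: cU2
  | context [U1] => exact: cU1
  | context [U] => exact: cU
  | context [@chi2] => exact: cchi2
  | context [@chi1] => exact: cchi1
  | context [@chi] => exact: cchi
  | context [@phi2] => exact: cphi2
  | context [@phi1] => exact: cphi1
  | context [@phi] => exact: cphi
  | context [@image] => exact: crho1i
  | context [@rho1] => exact: crho1
  | context [@rho] => exact: crho
  | context [@psi1] => exact: cpsi1
  | context [@kap] => exact: ckap
  | _ => exact: box_continuous_cst
  end.
Ltac bcont := lazymatch goal with
  | |- box_continuous _ _ (fun y => @?f y + @?g y) =>
      refine (box_continuousD f g _ _); bcont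
  | |- box_continuous _ _ (fun y => @?f y * @?g y) =>
      refine (box_continuousM f g _ _); bcont
  | |- box_continuous _ _ (fun y => - @?f y) =>
      refine (box_continuousN f _); bcont
  | |- box_continuous _ _ (fun y => bigop _ _ _) =>
      apply: box_continuous_sum => ?; bcont
  | |- box_continuous _ _ ?F => bcont_leaf F
  end.

Let green i : box_int (lo L) (hi L) (fun y => U i y * \sum_j theta2 i j y) =
  - (2 * cube_int L (fun z : 'rV[R]_k.+1 => U i (vcons (-1) z) *
       (chi (L := L) (vcons (-1) z) * psi1 k.+2 c i ord0 (vcons (-1) z)))).
Proof.
transitivity (- cube_int L (fun z : 'rV[R]_k.+1 =>
    U i (vcons (-1) z) * theta1 i ord0 (vcons (-1) z))); last first.
  rewrite -(box_intZ cube); last first.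
    by apply: (slice (fun y => U i y * (chi (L := L) y * psi1 k.+2 c i ord0 y))); bcont.
  congr (- _); apply: box_int_ext => z hz.
  by rewrite /theta1 phi_bottom mulr0 add0r phi1_bottom; ring.
apply: (box_int_green lohi (U i) (U1 i) (U2 i) (theta i) (theta1 i) (theta2 i)).
- by bcont.
- by move=> j; bcont.
- by move=> j; bcont.
- by rewrite /theta; bcont.
- by move=> j; rewrite /theta1; bcont.
- by move=> j; rewrite /theta2 /err; bcont.
- by move=> j y hy; exact: (hf_derive _ _ _ _ _ HU).
- by move=> j y hy; exact: (hf_derive1 _ _ _ _ _ HU).
- move=> j y _.
  exact: (is_derive_mulr _ _ _ _ _ _ (is_derive_chi L0 j y) (is_derive_phi c0 i j y)).
- move=> j y _.
  have := is_derive_addr _ _ _ _ _ _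
    (is_derive_mulr _ _ _ _ _ _ (is_derive_chi1 L0 j y) (is_derive_phi c0 i j y))
    (is_derive_mulr _ _ _ _ _ _ (is_derive_chi L0 j y) (is_derive_phi1 c0 i j y)).
  by congr is_derive; rewrite /theta2 /err; ring.
- by move=> y hy; exact: (hf_lap _ _ _ _ _ HU).
- move=> j y hy yb; have E : y 0 j ^+ 2 = L ^+ 2 by rewrite yb.
  by rewrite /theta /theta1 (chi_face L0 j y E) (chi1_face L0 j y E) !mul0r addr0.
- move=> j y hy j0 ya; have E : y 0 j ^+ 2 = L ^+ 2.
    rewrite ya; case: (unliftP ord0 j) j0 => [i' ->|->] //= _.
    exact: sqrrN.
  by rewrite /theta /theta1 (chi_face L0 j y E) (chi1_face L0 j y E) !mul0r addr0.
- move=> y hy y0; rewrite /theta [y]vcons_eta y0 phi_bottom mulr0//.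
Qed.

Let div_rho : box_int (lo L) (hi L) (fun y => div_cut y * rho k.+2 c y) =
  - box_int (lo L) (hi L) (fun y => \sum_i U i y * (chi (L := L) y * rho1 k.+2 c i y))
  - cube_int L (fun z : 'rV[R]_k.+1 => U ord0 (vcons (-1) z) *
      (chi (L := L) (vcons (-1) z) * rho k.+2 c (vcons (-1) z))).
Proof.
pose W i y := U i y * (chi (L := L) y * rho k.+2 c y).
pose W' i y := (U1 i i y * chi (L := L) y + U i y * chi1 (L := L) i y) * rho k.+2 c y +
  U i y * (chi (L := L) y * rho1 k.+2 c i y).
have H : box_int (lo L) (hi L) (fun y => \sum_i W' i y) =
    - cube_int L (fun z : 'rV[R]_k.+1 => W ord0 (vcons (-1) z)).
  apply: (box_int_div lohi W W').
  - by move=> i; rewrite /W; bcont.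
  - by move=> i; rewrite /W'; bcont.
  - move=> i y hy.
    have := is_derive_mulr _ _ _ _ _ _ (hf_derive _ _ _ _ _ HU i i y hy)
      (is_derive_mulr _ _ _ _ _ _ (is_derive_chi L0 i y) (is_derive_rho c0 i y)).
    by congr is_derive; rewrite /W'; ring.
  - move=> i y hy yb; have E : y 0 i ^+ 2 = L ^+ 2 by rewrite yb.
    by rewrite /W (chi_face L0 i y E) mul0r mulr0.
  - move=> j y hy j0 ya; have E : y 0 j ^+ 2 = L ^+ 2.
      rewrite ya; case: (unliftP ord0 j) j0 => [i' ->|->] //= _.
      exact: sqrrN.
    by rewrite /W (chi_face L0 j y E) mul0r mulr0.
rewrite -/(cube_int L (fun z : 'rV[R]_k.+1 => W ord0 (vcons (-1) z))) -H.
have cW' : box_continuous (lo L) (hi L) (fun y => \sum_i W' i y) by rewrite /W'; bcont.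
have cr : box_continuous (lo L) (hi L)
    (fun y => \sum_i U i y * (chi (L := L) y * rho1 k.+2 c i y)) by bcont.
rewrite addrC -(box_intB lohiW _ _ cW' cr); apply: box_int_ext => y hy.
by rewrite /W' big_split/= -mulr_suml addrK.
Qed.

Let err_bound i j y : in_box (lo L) (hi L) y ->
  `|err i j y| <= 16 * (1 + k.+3%:R) / L ^+ 2 * kap k.+1 c y.
Proof.
move=> hy; have hc := half_box_cube _ hy; have y0 := half_box_top _ hy.
have L2 : 0 <= L ^- 2 by rewrite invr_ge0 sqr_ge0.
have h1 : `|chi2 (L := L) j y * phi (c := c) i y| <= 8 / L ^+ 2 * (2 * kap k.+1 c y).
  by rewrite normrM ler_pM// ?chi2_bound// phi_bound.
have h2 : `|chi1 (L := L) j y * phi1 (c := c) i j y| <=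
    4 / L ^+ 2 * (2 * k.+3%:R) * kap k.+1 c y.
  apply: (@le_trans _ _ (4 / L ^+ 2 * `|y 0 j| * (2 * k.+3%:R * kap k.+2 c y))).
    by rewrite normrM ler_pM// ?chi1_bound// phi1_bound.
  have -> : 4 / L ^+ 2 * `|y 0 j| * (2 * k.+3%:R * kap k.+2 c y) =
      4 / L ^+ 2 * (2 * k.+3%:R) * (`|y 0 j| * kap k.+2 c y) by ring.
  by rewrite ler_wpM2l ?entry_kap// !mulr_ge0.
apply: le_trans (ler_normD _ _) _; rewrite [X in _ + X]normrM ger0_norm//.
have -> : 16 * (1 + k.+3%:R) / L ^+ 2 * kap k.+1 c y =
    8 / L ^+ 2 * (2 * kap k.+1 c y) +
    2 * (4 / L ^+ 2 * (2 * k.+3%:R) * kap k.+1 c y) by ring.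
by rewrite lerD// ler_wpM2l.
Qed.

Lemma half_box_kap : box_int (lo L) (hi L) (@kap R k.+2 k.+1 c) <=
  k.+2%:R * 2 ^+ k.+2 * L.
Proof.
apply: le_trans (cube_kap_bound k.+1 c L c0 L0).
apply: subset_box_int => //.
- by case=> [|i] //=; rewrite lerN2.
- by apply: continuous_box; exact: kap_continuous.
- by move=> y _; rewrite ltW// kap_gt0.
Qed.

Let bottom_bound (z : 'rV[R]_k.+1) : in_box (fun=> - L) (fun=> L) z ->
  `|\sum_i U i (vcons (-1) z) *
     (chi (L := L) (vcons (-1) z) * psi1 k.+2 c i ord0 (vcons (-1) z))| <= pole_mass k z.
Proof.
move=> hz; set v := vcons (-1) z; have hv := half_box_bottom _ hz.
have /andP[x0 x1] := chi_bound v (half_box_cube _ hv).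
have k2 (c' : R) s : 0 < c' -> 0 < @kap R k.+1 s c' z by move=> ?; exact: kap_gt0.
have B0 : 0 < pole_mass k z.
  rewrite mulr_gt0 ?k2// sqrtr_gt0 ltr_pwDl// mulr_ge0// ?(ltW (k2 _ _ _))//.
have le_v s : kap s c v <= kap s 1 z.
  by rewrite /v kap_vcons; apply: le_kap; rewrite ?ltr_wpDl// ?sqr_ge0// sqrrN expr1n lerD2l lerDl ltW.
have -> : \sum_i U i v * (chi (L := L) v * psi1 k.+2 c i ord0 v) =
    chi (L := L) v * \sum_i U i v * psi1 k.+2 c i ord0 v.
  by rewrite mulr_sumr; apply: eq_bigr => i _; rewrite mulrCA.
rewrite normrM (ger0_norm x0); apply: (@le_trans _ _ (`|\sum_i U i v * psi1 k.+2 c i ord0 v|)).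
  by rewrite ler_piMl.
apply: cauchy_schwarz_unit => //; first exact: (hf_bound _ _ _ _ _ HU).
have v0 : v 0 ord0 = -1 by rewrite /v vcons0.
apply: (le_trans (psi1_bottom_sqr c0 v v0)).
have kE : k.+2%:R - 2 = k%:R :> R by rewrite -[k.+2]addn2 natrD addrK.
have kge : 0 <= k.+2%:R * k%:R :> R by rewrite mulr_ge0.
rewrite kE /pole_mass [leRHS]exprMn sqr_sqrtr; last first.
  by rewrite addr_ge0// mulr_ge0// ltW// k2.
have kv s : 0 <= kap s c v by rewrite ltW// kap_gt0.
rewrite ler_pM ?sqr_ge0//.
- by rewrite addr_ge0// mulr_ge0.
- by rewrite ler_pXn2r// nnegrE// ltW// k2.
- by rewrite lerD2l ler_wpM2l.
Qed.

Let far_kap s y : 1 <= sqlen y -> kap s c y <= 1.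
Proof.
move=> y1; rewrite -(expr1n R s) -[X in _ <= X ^+ _]invr1.
by apply: kap_le_exp => //; rewrite expr1n (le_trans y1)// lerDl ltW.
Qed.

Let far_rho1 i y : 1 <= sqlen y -> `|rho1 k.+2 c i y| <= k.+2%:R * k.+4%:R * c.
Proof.
move=> y1; rewrite normrN normrM ger0_norm; last by rewrite !mulr_ge0// ltW.
rewrite ler_piMr//; first by rewrite !mulr_ge0// ltW.
rewrite normrM (gtr0_norm (kap_gt0 c0 _ _)).
by rewrite (le_trans (entry_kap c0 _ _ _))// far_kap.
Qed.

(** By Green's identity the smoothed divergence is the integral of the field
    against twice the normal derivative of [psi] on the bottom face, up to three
    errors: the terms [err] where the cutoff is differentiated, of order [1 / L],
    the reflected densities, and the boundary term of the integration by parts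
    of [rho], both of order [c]. *)
Lemma div_rho_bound : `|box_int (lo L) (hi L) (fun y => div_cut y * rho k.+2 c y)| <=
  2 * cube_int L (pole_mass k) +
  16 * (1 + k.+3%:R) * k.+2%:R ^+ 3 * 2 ^+ k.+2 / L +
  c * (k.+2%:R ^+ 2 * k.+4%:R * box_vol k.+2 (lo L) (hi L) +
       k.+2%:R * box_vol k.+1 (fun=> - L) (fun=> L)).
Proof.
pose f1 y := \sum_i U i y * \sum_j theta2 i j y.
pose f2 y := \sum_i U i y * \sum_j err i j y.
pose f3 y := \sum_i U i y * (chi (L := L) y * rho1 k.+2 c i y).
pose f4 y := \sum_i U i y * (chi (L := L) y * (sg i * rho1 k.+2 c i (image y))).
pose g1 (z : 'rV[R]_k.+1) := \sum_i U i (vcons (-1) z) *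
  (chi (L := L) (vcons (-1) z) * psi1 k.+2 c i ord0 (vcons (-1) z)).
pose g2 (z : 'rV[R]_k.+1) := U ord0 (vcons (-1) z) *
  (chi (L := L) (vcons (-1) z) * rho k.+2 c (vcons (-1) z)).
have c1 : box_continuous (lo L) (hi L) f1 by rewrite /f1 /theta2 /err; bcont.
have c2 : box_continuous (lo L) (hi L) f2 by rewrite /f2 /err; bcont.
have c3 : box_continuous (lo L) (hi L) f3 by rewrite /f3; bcont.
have c4 : box_continuous (lo L) (hi L) f4 by rewrite /f4; bcont.
have d1 : box_continuous (fun=> - L) (fun=> L) g1.
  by apply: (slice (fun y => \sum_i U i y * (chi (L := L) y * psi1 k.+2 c i ord0 y))); bcont.
have d2 : box_continuous (fun=> - L) (fun=> L) g2.
  by apply: (slice (fun y => U ord0 y * (chi (L := L) y * rho k.+2 c y))); bcont.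
have cpm : box_continuous (fun=> - L) (fun=> L) (pole_mass k).
  by apply: continuous_box; exact: pole_mass_continuous.
have E1 : box_int (lo L) (hi L) f1 = - (2 * cube_int L g1).
  rewrite /f1 (box_int_sum lohiW); last first.
    by move=> i; rewrite /theta2 /err; bcont.
  under eq_bigr do rewrite green.
  rewrite sumrN -mulr_sumr /cube_int -(box_int_sum cube)// => i.
  by apply: (slice (fun y => U i y * (chi (L := L) y * psi1 k.+2 c i ord0 y))); bcont.
have E3 : box_int (lo L) (hi L) f3 =
    box_int (lo L) (hi L) f1 - box_int (lo L) (hi L) f2 + box_int (lo L) (hi L) f4.
  rewrite -(box_intB lohiW _ _ c1 c2).
  rewrite -(box_intD lohiW _ _ (box_continuousB _ _ c1 c2) c4).
  apply: box_int_ext => y hy; rewrite /f1 /f2 /f3 /f4 -sumrB -big_split/=.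
  apply: eq_bigr => i _; rewrite /theta2 big_split/= -mulr_sumr lap_phi//; ring.
have -> : box_int (lo L) (hi L) (fun y => div_cut y * rho k.+2 c y) =
    2 * cube_int L g1 + box_int (lo L) (hi L) f2 - box_int (lo L) (hi L) f4 - cube_int L g2.
  transitivity (- box_int (lo L) (hi L) f3 - cube_int L g2); first exact: div_rho.
  have Eabc (x1 x2 x4 x5 : R) : - (- x1 - x2 + x4) - x5 = x1 + x2 - x4 - x5 by ring.
  by rewrite E3 E1 Eabc.
have n0 : 0 <= k.+2%:R :> R by [].
have B1 : `|cube_int L g1| <= cube_int L (pole_mass k).
  exact: (le_norm_box_int cube) d1 cpm bottom_bound.
have L2 : 0 <= L ^- 2 by rewrite invr_ge0 sqr_ge0.
pose K : R := k.+2%:R ^+ 2 * (16 * (1 + k.+3%:R) / L ^+ 2).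
have K0 : 0 <= K by rewrite !mulr_ge0// ?exprn_ge0// addr_ge0.
have B2 : `|box_int (lo L) (hi L) f2| <= 16 * (1 + k.+3%:R) * k.+2%:R ^+ 3 * 2 ^+ k.+2 / L.
  have -> : 16 * (1 + k.+3%:R) * k.+2%:R ^+ 3 * 2 ^+ k.+2 / L = K * (k.+2%:R * 2 ^+ k.+2 * L).
    by rewrite /K; field; rewrite gt_eqF.
  apply: (@le_trans _ _ (K * box_int (lo L) (hi L) (@kap R k.+2 k.+1 c))); last first.
    by rewrite ler_wpM2l// half_box_kap.
  rewrite -(box_intZ lohiW)//; apply: le_norm_box_int => //; first by bcont.
  move=> y hy; apply: le_trans (ler_norm_sum _ _ _) _.
  have -> : K * kap k.+1 c y =
      \sum_(i < k.+2) \sum_(j < k.+2) 16 * (1 + k.+3%:R) / L ^+ 2 * kap k.+1 c y.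
    by rewrite !sumr_const !card_ord -mulrnA -[RHS]mulr_natl natrM /K; ring.
  apply: ler_sum => i _; rewrite normrM.
  apply: (@le_trans _ _ `|\sum_j err i j y|); first by rewrite ler_piMl// field_le1.
  apply: le_trans (ler_norm_sum _ _ _) _.
  by apply: ler_sum => j _; exact: err_bound.
have B4 : `|box_int (lo L) (hi L) f4| <=
    c * (k.+2%:R ^+ 2 * k.+4%:R * box_vol k.+2 (lo L) (hi L)).
  have -> : c * (k.+2%:R ^+ 2 * k.+4%:R * box_vol k.+2 (lo L) (hi L)) =
      k.+2%:R * (k.+2%:R * k.+4%:R * c) * box_vol k.+2 (lo L) (hi L) by ring.
  rewrite -(box_int_cst _ _ _ _ lohiW); apply: le_norm_box_int => //; first by bcont.
  move=> y hy; apply: le_trans (ler_norm_sum _ _ _) _.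
  have -> : k.+2%:R * (k.+2%:R * k.+4%:R * c) = \sum_(i < k.+2) k.+2%:R * k.+4%:R * c :> R.
    by rewrite sumr_const card_ord -[RHS]mulr_natl.
  apply: ler_sum => i _; rewrite 3!normrM norm_sg mul1r.
  have /andP[x0 x1] := chi_bound y (half_box_cube _ hy).
  have s1 := sqlen_image_ge1 _ (half_box_top _ hy).
  have h := far_rho1 i _ s1.
  apply: (@le_trans _ _ (1 * (1 * `|rho1 k.+2 c i (image y)|))); last by rewrite !mul1r.
  rewrite ler_pM ?mulr_ge0 ?field_le1// ler_wpM2r//.
  by rewrite ger0_norm.
have B5 : `|cube_int L g2| <= c * (k.+2%:R * box_vol k.+1 (fun=> - L) (fun=> L)).
  have -> : c * (k.+2%:R * box_vol k.+1 (fun=> - L) (fun=> L)) =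
      k.+2%:R * c * box_vol k.+1 (fun=> - L) (fun=> L) by ring.
  rewrite -(box_int_cst _ _ _ _ cube); apply: (le_norm_box_int cube) => //.
    exact: box_continuous_cst.
  move=> z hz; have hv := half_box_bottom _ hz; rewrite 2!normrM.
  have /andP[x0 x1] := chi_bound _ (half_box_cube _ hv).
  have s1 : 1 <= sqlen (vcons (-1) z).
    by rewrite sqlen_vcons sqrrN expr1n lerDl sqlen_ge0.
  have h : `|rho k.+2 c (vcons (-1) z)| <= k.+2%:R * c.
    rewrite normrM ger0_norm ?mulr_ge0// ?(ltW c0)// (gtr0_norm (kap_gt0 c0 _ _)).
    by rewrite ler_piMr ?mulr_ge0 ?(ltW c0)// far_kap.
  apply: (@le_trans _ _ (1 * (1 * `|rho k.+2 c (vcons (-1) z)|))); last by rewrite !mul1r.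
  rewrite ler_pM ?mulr_ge0 ?field_le1// ler_wpM2r//.
  by rewrite ger0_norm.
rewrite [c * (_ + _)]mulrDr [leRHS]addrA.
apply: le_trans (ler_normB _ _) _; rewrite lerD//.
apply: le_trans (ler_normB _ _) _; rewrite lerD//.
apply: le_trans (ler_normD _ _) _; rewrite lerD//.
by rewrite normrM ger0_norm// ler_wpM2l.
Qed.

(** As [rho] is the divergence of [psi], its mass between the two horizontal
    planes at distance one from the pole is a flux: each plane contributes the
    integral of [kap], and the vertical faces contribute nonnegative terms. *)
Lemma rho_mass : 2 * cube_int L (@kap R k.+1 k.+2 (1 + c)) <=
  box_int (lo L) (hi L) (rho k.+2 c).
Proof.
pose up (i : nat) : R := if i is _.+1 then L else 1.
have lo_up (i : nat) : lo L i < up i.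
  by case: i => [|i]; rewrite /lo /up -subr_gt0 opprK addr_gt0.
have lo_upW (i : nat) : lo L i <= up i by exact: ltW.
have cc (f : 'rV[R]_k.+2 -> R) : continuous f -> box_continuous (lo L) up f.
  exact: continuous_box.
have cps i j : box_continuous (lo L) up (psi1 k.+2 c i j).
  by apply: cc; exact: psi1_continuous.
have cp i : box_continuous (lo L) up (psi k.+2 c i).
  by apply: cc; exact: psi_continuous.
apply: (@le_trans _ _ (box_int (lo L) up (rho k.+2 c))); last first.
  apply: subset_box_int => //.
  - by case=> [|i]; rewrite /up /hi.
  - by move=> y _; exact: rho_ge0.
have -> : box_int (lo L) up (rho k.+2 c) =
    \sum_i box_int (lo L) up (psi1 k.+2 c i i).
  rewrite -(box_int_sum lo_upW _ _ (fun i => psi1 k.+2 c i i) (fun i => cps i i)).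
  apply: box_int_ext => y _.
  by rewrite (div_psi c0).
rewrite (bigD1 ord0 isT); set S := (X in _ <= _ _ X).
have S0 : 0 <= S.
  apply: sumr_ge0 => i i0.
  rewrite (box_int_gauss _ _ _ i _ _ lo_upW (lo_up i) (cp i) (cps i i)
    (fun y _ _ => is_derive_psi c0 i i y)).
  have ha : lo L i <= lo L i <= up i by rewrite lexx lo_upW.
  have hb : lo L i <= up i <= up i by rewrite lexx lo_upW.
  apply: box_int_ge0 => //; last first.
    apply: box_continuousM; first exact: box_continuous_cst.
    by apply: box_continuousB; apply: box_continuous_vset.
  move=> y _; rewrite mulr_ge0 ?invr_ge0 ?subr_ge0//.
  rewrite /psi !mxE eqxx; case: (unliftP ord0 i) i0 => [i' ->|->] //= _.
  rewrite (@le_trans _ _ 0)//.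
    by rewrite mulNr oppr_le0 mulr_ge0 ?(ltW L0)// ltW// kap_gt0.
  by rewrite mulr_ge0 ?(ltW L0)// ltW// kap_gt0.
rewrite (box_int_gauss0 _ _ _ _ _ lo_upW (lo_up 0%N) (cp ord0) (cps ord0 ord0)
  (fun y _ _ => is_derive_psi c0 ord0 ord0 y)).
rewrite -[leLHS]addr0 lerD//.
have c10 : 0 < 1 + c by rewrite addr_gt0.
have ck : box_continuous (fun=> - L) (fun=> L) (@kap R k.+1 k.+2 (1 + c)).
  by apply: continuous_box; exact: kap_continuous.
have ka : box_int (fun i : nat => lo L i.+1) (fun i : nat => up i.+1)
    (fun z : 'rV[R]_k.+1 => psi k.+2 c ord0 (vcons (up 0%N) z)) =
    cube_int L (@kap R k.+1 k.+2 (1 + c)).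
  by apply: box_int_ext => z _; rewrite /psi vcons0 kap_vcons /up mul1r expr1n.
have kb : box_int (fun i : nat => lo L i.+1) (fun i : nat => up i.+1)
    (fun z : 'rV[R]_k.+1 => psi k.+2 c ord0 (vcons (lo L 0%N) z)) =
    - cube_int L (@kap R k.+1 k.+2 (1 + c)).
  rewrite /cube_int -(box_intN cube)//.
  by apply: box_int_ext => z _; rewrite /psi vcons0 kap_vcons /lo mulN1r sqrrN expr1n.
by rewrite ka kb opprK mulr_natl mulr2n.
Qed.

End Smoothed.
Lemma le_of_small (x y z : R) : (forall t, 0 < t <= 1 -> x <= y + t * z) -> x <= y.
Proof.
move=> H; apply/ler_addgt0Pr => e e0.
have z1 : 0 < `|z| + 1 by rewrite ltr_wpDl.
pose t := Num.min 1 (e / (`|z| + 1)).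
have t0 : 0 < t by rewrite lt_min ltr01 divr_gt0.
have t1 : t <= 1 by rewrite ge_min lexx.
apply: le_trans (H t _) _; first by rewrite t0.
rewrite lerD2l (le_trans (ler_norm _))// normrM gtr0_norm//.
apply: (@le_trans _ _ (t * (`|z| + 1))); first by rewrite ler_pM2l// lerDl.
by rewrite -ler_pdivlMr// ge_min lexx orbT.
Qed.

Lemma half_box_origin : in_box (lo L) (hi L) (0 : 'rV[R]_k.+2).
Proof.
move=> i; rewrite mxE /hi (ltW L0) andbT.
by case: (nat_of_ord i) => [|n] /=; rewrite oppr_le0 ?(ltW L0).
Qed.

(** A modulus of continuity at the pole that can be integrated against [rho]. *)
Lemma quadratic_modulus (g : 'rV[R]_k.+2 -> R) (eta : R) :
  box_continuous (lo L) (hi L) g -> 0 < eta ->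
  exists2 M, 0 <= M & forall y, in_box (lo L) (hi L) y ->
    `|g y - g 0| <= eta + M * sqlen y.
Proof.
move=> cg eta0.
have : g \o clamp (lo L) (hi L) @ (0 : 'rV[R]_k.+2) --> g 0.
  rewrite -[X in _ --> g X](clamp_id _ _ _ _ half_box_origin); exact: cg.
move=> /cvgrPdist_le/(_ eta eta0)/nbhs_ballP[r /= r0 Hr].
have cK : compact (in_box (lo L) (hi L) : set 'rV[R]_k.+2).
  have := @rV_compact R k.+2 (fun i => [set x | lo L i <= x <= hi L i]).
  apply=> i; have := @segment_compact R (lo L i) (hi L i).
  by congr compact; apply/seteqP; split => x /=; rewrite in_itv.
have [B [_ HB]] := compact_bounded (continuous_compact (continuous_subspaceT cg) cK).
pose B1 := Num.max B 0 + 1.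
have B1B : B < B1 by rewrite ltr_pwDr// le_max lexx.
have B10 : 0 <= B1 by rewrite addr_ge0// le_max lexx orbT.
have gB y : in_box (lo L) (hi L) y -> `|g y| <= B1.
  move=> hy; apply: (HB B1 B1B); exists y => //=.
  by rewrite clamp_id.
exists (2 * B1 / r ^+ 2); first by rewrite !mulr_ge0// invr_ge0 sqr_ge0.
move=> y hy; have [yr|yr] := ltP (sqlen y) (r ^+ 2).
  apply: (@le_trans _ _ eta); last first.
    by rewrite lerDl mulr_ge0 ?sqlen_ge0// !mulr_ge0// invr_ge0 sqr_ge0.
  rewrite distrC -[in g y](clamp_id _ _ _ _ hy); apply: Hr.
  split => // i j; rewrite (ord1 i) mxE /ball/= sub0r normrN.
  rewrite -(@ltr_pXn2r _ 2)// ?nnegrE// ?(ltW r0)// real_normK ?num_real//.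
  exact: le_lt_trans (sqlen_ge _ _ _) yr.
apply: (@le_trans _ _ (2 * B1)).
  rewrite (le_trans (ler_normB _ _))// mulr_natl mulr2n lerD ?gB//.
  exact: half_box_origin.
have : 2 * B1 <= 2 * B1 / r ^+ 2 * sqlen y.
  rewrite -mulrA ler_peMr ?mulr_ge0//.
  by rewrite mulrC ler_pdivlMr ?mul1r// exprn_gt0.
by move/le_trans; apply; rewrite lerDr ltW.
Qed.

(** [|y|^2 rho] is at most [n sqrt c] times a kernel whose integral is bounded
    uniformly in [c]. *)
Lemma rho_concentrates (g : 'rV[R]_k.+2 -> R) (eta M t : R) :
  box_continuous (lo L) (hi L) g -> 0 <= M -> 0 < t ->
  (forall y, in_box (lo L) (hi L) y -> `|g y - g 0| <= eta + M * sqlen y) ->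
  `|box_int (lo L) (hi L) (fun y => g y * rho k.+2 (t ^+ 2) y) -
    g 0 * box_int (lo L) (hi L) (rho k.+2 (t ^+ 2))| <=
  eta * box_int (lo L) (hi L) (rho k.+2 (t ^+ 2)) +
  t * (M * k.+2%:R * (k.+2%:R * 2 ^+ k.+2 * L)).
Proof.
move=> cg M0 t0 H; have c0 : 0 < t ^+ 2 by rewrite exprn_gt0.
set c := t ^+ 2 in c0 *.
have crho : box_continuous (lo L) (hi L) (rho k.+2 c).
  by apply: continuous_box; exact: rho_continuous.
have ckap : box_continuous (lo L) (hi L) (@kap R k.+2 k.+1 c).
  by apply: continuous_box; exact: kap_continuous.
have cst0 (x : R) : box_continuous (lo L) (hi L) (fun _ : 'rV[R]_k.+2 => x).
  exact: box_continuous_cst.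
rewrite -(box_intZ lohiW)// -(box_intB lohiW); [|exact: box_continuousM..].
apply: (@le_trans _ _ (eta * box_int (lo L) (hi L) (rho k.+2 c) +
    t * (M * k.+2%:R) * box_int (lo L) (hi L) (@kap R k.+2 k.+1 c))); last first.
  rewrite lerD2l [leRHS]mulrA ler_wpM2l ?half_box_kap//.
  by rewrite !mulr_ge0// ltW.
rewrite -!(box_intZ lohiW)// -(box_intD lohiW); [|exact: box_continuousM..].
apply: (le_norm_box_int lohiW).
- by apply: box_continuousB; exact: box_continuousM.
- by apply: box_continuousD; exact: box_continuousM.
move=> y hy; have kp s := kap_gt0 c0 s y.
have r0 : 0 <= rho k.+2 c y by exact: rho_ge0.
rewrite -mulrBl normrM (ger0_norm r0).
apply: (@le_trans _ _ ((eta + M * sqlen y) * rho k.+2 c y)).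
  by rewrite ler_wpM2r// H.
rewrite mulrDl lerD2l.
have k1 : c * kap 1 c y <= t.
  have := kap_le_exp c0 1 y t t0; rewrite -/c lerDr sqlen_ge0 => /(_ isT).
  rewrite expr1 => h; rewrite -[leRHS](mulfK (lt0r_neq0 t0)) -expr2 -/c.
  by rewrite ler_pM2l.
have h : sqlen y * kap k.+4 c y <= kap k.+2 c y.
  by rewrite -(sqlen_kap c0 k.+2 y) ler_pM2r// lerDl ltW.
have kE : kap k.+2 c y = kap k.+1 c y * kap 1 c y by rewrite -kapD addn1.
have -> : M * sqlen y * rho k.+2 c y =
  M * k.+2%:R * (c * (sqlen y * kap k.+4 c y)) by rewrite /rho; ring.
have -> : t * (M * k.+2%:R) * kap k.+1 c y = M * k.+2%:R * (t * kap k.+1 c y) by ring.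
rewrite ler_wpM2l ?mulr_ge0//.
apply: (@le_trans _ _ (c * kap k.+2 c y)); first by rewrite ler_pM2l.
by rewrite kE mulrCA mulrC ler_pM2r.
Qed.

Lemma kap_perturb n s (c : R) (z : 'rV[R]_n) : 0 < c <= 1 ->
  (1 - s%:R * c) * kap s 1 z <= kap s (1 + c) z.
Proof.
move=> /andP[c0 c1].
have bern : 1 - s%:R * c <= (1 - c) ^+ s.
  elim: s => [|s IH]; first by rewrite mul0r subr0 expr0.
  rewrite exprS; apply: (@le_trans _ _ ((1 - c) * (1 - s%:R * c))).
    have : 0 <= s%:R * (c * c) by rewrite !mulr_ge0// ltW.
    by rewrite -natr1; move: (s%:R : R) => x; nra.
  by rewrite ler_wpM2l// subr_ge0.
apply: (@le_trans _ _ ((1 - c) ^+ s * kap s 1 z)).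
  by rewrite ler_wpM2r// ltW// kap_gt0.
have q0 := sqlen_ge0 _ z; have q1 : 0 < sqlen z + 1 by rewrite ltr_wpDl.
have q2 : 0 < sqlen z + (1 + c) by rewrite ltr_wpDl// addr_gt0.
rewrite /kap -exprMn lerXn2r ?nnegrE ?mulr_ge0 ?subr_ge0 ?invr_ge0 ?sqrtr_ge0//.
rewrite ler_pdivrMr ?sqrtr_gt0// mulrC ler_pdivlMr ?sqrtr_gt0//.
apply: (@le_trans _ _ ((1 - c) * ((1 + c) * Num.sqrt (sqlen z + 1)))).
  rewrite ler_wpM2l ?subr_ge0//.
  have -> : (1 + c) * Num.sqrt (sqlen z + 1) = Num.sqrt ((1 + c) ^+ 2 * (sqlen z + 1)).
    by rewrite sqrtrM ?sqr_ge0// sqrtr_sqr ger0_norm// addr_ge0// ltW.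
  rewrite ler_wsqrtr//; move: (sqlen z) q0 => q q0; nra.
rewrite mulrA ler_piMl ?sqrtr_ge0//; nra.
Qed.

(** Let [c = t^2] tend to zero in [div_rho_bound]: the left side concentrates to
    the divergence at the pole times the mass of [rho], and the latter is at least
    twice the integral of [kap] over the bottom face. *)
Lemma half_box_estimate :
  `|\sum_i U1 i i 0| * (2 * cube_int L (@kap R k.+1 k.+2 1)) <=
  2 * cube_int L (pole_mass k) +
  16 * (1 + k.+3%:R) * k.+2%:R ^+ 3 * 2 ^+ k.+2 / L.
Proof.
set d := `|_|; set A := cube_int L _; set X := (X in _ <= X).
have A0 : 0 <= A by exact: cube_kap_ge0.
have P0 : 0 <= cube_int L (pole_mass k).
  apply: (box_int_ge0 cube); last by apply: continuous_box; exact: pole_mass_continuous.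
  by move=> z _; rewrite mulr_ge0 ?sqrtr_ge0// ltW// kap_gt0.
have X0 : 0 <= X.
  apply: addr_ge0; first exact: mulr_ge0.
  apply: divr_ge0 (ltW L0); apply: mulr_ge0; last exact: exprn_ge0.
  apply: mulr_ge0; last exact: exprn_ge0.
  by apply: mulr_ge0 => //; rewrite addr_ge0.
have cdiv : box_continuous (lo L) (hi L) div_cut.
  apply: box_continuous_sum => i; apply: box_continuousD; apply: box_continuousM => //.
    by apply: continuous_box; exact: chi_continuous.
  by apply: continuous_box; exact: chi1_continuous.
have d0E : `|div_cut 0| = d.
  congr `|_|; apply: eq_bigr => i _.
  by rewrite chi_origin chi1_origin mulr1 mulr0 addr0.
suff main eta : 0 < eta -> (d - eta) * (2 * A) <= X.
  apply: (le_of_small _ _ (2 * A)) => t /andP[t0 _].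
  by rewrite -lerBlDr -mulrBl; exact: main.
move=> eta0; have [de|de] := leP d eta.
  by rewrite (le_trans _ X0)// mulr_le0_ge0 ?subr_le0// mulr_ge0.
have [M M0 HM] := quadratic_modulus _ _ cdiv eta0.
pose K4 : R := k.+2%:R ^+ 2 * k.+4%:R * box_vol k.+2 (lo L) (hi L) +
       k.+2%:R * box_vol k.+1 (fun=> - L) (fun=> L).
have K40 : 0 <= K4 by rewrite addr_ge0// !mulr_ge0// box_vol_ge0.
pose K5 := M * k.+2%:R * (k.+2%:R * 2 ^+ k.+2 * L).
apply: (le_of_small _ _ (K4 + K5 + (d - eta) * (k.+2%:R * (2 * A)))) => t /andP[t0 t1].
have c0 : 0 < t ^+ 2 by rewrite exprn_gt0.
have ct : t ^+ 2 <= t by rewrite expr2 ler_piMr// ltW.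
have h1 := @div_rho_bound (t ^+ 2) c0.
have h2 := @rho_mass (t ^+ 2) c0.
have h3 := rho_concentrates _ _ _ _ cdiv M0 t0 HM.
set I := box_int _ _ (fun y => div_cut y * _) in h1 h3.
set N := box_int _ _ (rho _ _) in h2 h3.
rewrite -/X -/K4 in h1; rewrite -/K5 in h3.
have N0 : 0 <= N.
  apply: le_trans h2; rewrite mulr_ge0//; apply: cube_kap_ge0 => //.
  by rewrite addr_gt0.
have h4 : d * N <= `|I| + (eta * N + t * K5).
  rewrite -d0E -[X in _ * X](ger0_norm N0) -normrM.
  have -> : div_cut 0 * N = I - (I - div_cut 0 * N) by ring.
  by rewrite (le_trans (ler_normB _ _))// lerD2l.
have h5 : 2 * A - k.+2%:R * t * (2 * A) <= N.
  apply: le_trans h2; rewrite -[X in X - _]mul1r -mulrBl mulrCA ler_pM2l//.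
  apply: (@le_trans _ _ ((1 - k.+2%:R * t ^+ 2) * A)).
    by rewrite ler_wpM2r// lerD2l lerN2 ler_wpM2l.
  rewrite /A /cube_int -(box_intZ cube); last first.
    by apply: continuous_box; exact: kap_continuous.
  apply: (le_box_int cube).
  - apply: box_continuousM (box_continuous_cst _) _.
    by apply: continuous_box; exact: kap_continuous.
  - by apply: continuous_box; apply: kap_continuous; rewrite addr_gt0.
  - by move=> z _; apply: kap_perturb; rewrite c0 (le_trans ct).
have h6 : (d - eta) * (2 * A - k.+2%:R * t * (2 * A)) <= (d - eta) * N.
  by rewrite ler_wpM2l// subr_ge0 ltW.
have h7 : t ^+ 2 * K4 <= t * K4 by rewrite ler_wpM2r.
have h8 : (d - eta) * N <= X + t * K4 + t * K5.
  rewrite mulrBl lerBlDl (le_trans h4)// addrCA lerD2l lerD2r (le_trans h1)//.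
  by rewrite lerD2l.
have := le_trans h6 h8; lra.
Qed.

End Estimate.
End HalfBox.

(** * Similarities *)

Section ChainRule.
Context {R : realType} {n : nat}.
Implicit Types (f : 'rV[R]_n -> R) (x y z v : 'rV[R]_n).

(** A function with continuous partial derivatives is strictly differentiable:
    move from [y] to [z] one coordinate at a time and use the mean value
    theorem on each segment. *)
Lemma C1_strict (O : set 'rV[R]_n) f x (e : R) :
  open O -> C1_on O f -> O x -> 0 < e ->
  exists2 r, 0 < r & forall y z,
    (forall j, `|y 0 j - x 0 j| < r) -> (forall j, `|z 0 j - x 0 j| < r) ->
    `|f z - f y - \sum_j (z 0 j - y 0 j) * partial j f x| <=
      e * \sum_j `|z 0 j - y 0 j|.
Proof.
move=> oO fC1 Ox e0.
have : \forall w \near x, O w /\ forall j, `|partial j f x - partial j f w| <= e.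
  have Hd : \forall w \near x, forall j, `|partial j f x - partial j f w| <= e.
    pose P (j : 'I_n) (w : 'rV[R]_n) := `|partial j f x - partial j f w| <= e.
    have HP j : \forall w \near x, P j w.
      by have [_ /cvgrPdist_le/(_ e e0)] := fC1 j x Ox.
    exact: (filter_forall _ HP).
  have HO : \forall w \near x, O w by exact: open_nbhs_nbhs.
  by apply: filterS2 HO Hd.
move=> /nbhs_ballP[r /= r0 Hr].
exists (r / 3); first by rewrite divr_gt0.
move=> y z hy hz.
have inr (w : 'rV[R]_n) : (forall j, `|w 0 j - x 0 j| < r) ->
    O w /\ forall j, `|partial j f x - partial j f w| <= e.
  move=> hw; apply: Hr; split => // i j.
  by rewrite (ord1 i) /ball/= distrC; exact: hw.
pose p k : 'rV[R]_n := \row_j (if (j < k)%N then z 0 j else y 0 j).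
have p0 : p 0%N = y by apply/rowP => j; rewrite mxE.
have pn : p n = z by apply/rowP => j; rewrite mxE ltn_ord.
have step (k : 'I_n) : `|f (p k.+1) - f (p k) - (z 0 k - y 0 k) * partial k f x| <=
    e * `|z 0 k - y 0 k|.
  have pS h : forall j, `|(p k + h *: delta_mx 0 k) 0 j - x 0 j| < r / 3 + `|h|.
    move=> j; rewrite !mxE eqxx/=; have h0 := normr_ge0 h.
    have pj : `|(if (j < k)%N then z 0 j else y 0 j) - x 0 j| < r / 3 by case: ifP.
    rewrite addrAC (le_lt_trans (ler_normD _ _))// ltr_leD//.
    by case: (j == k); rewrite ?mulr1 ?mulr0 ?normr0.
  have zy : `|z 0 k - y 0 k| < r / 3 + r / 3.
    have -> : z 0 k - y 0 k = (z 0 k - x 0 k) - (y 0 k - x 0 k) by ring.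
    by rewrite (le_lt_trans (ler_normB _ _))// ltrD.
  have seg s : `|s - 0| <= `|z 0 k - y 0 k - 0| ->
      O (p k + s *: delta_mx 0 k) /\
      forall j, `|partial j f x - partial j f (p k + s *: delta_mx 0 k)| <= e.
    rewrite !subr0 => hs; apply: inr => j; apply: lt_le_trans (pS s j) _.
    have := le_lt_trans hs zy; move: `|s| => q; lra.
  have [|s hs] := @MVT_between R (fun h => f (p k + h *: delta_mx 0 k))
      (fun h => partial k f (p k + h *: delta_mx 0 k)) 0 (z 0 k - y 0 k).
    move=> s hs; apply/is_derive_line; apply: derivableP.
    by have [Os _] := seg s hs; have [] := fC1 k _ Os.
  rewrite scale0r addr0 subr0.
  have -> : p k + (z 0 k - y 0 k) *: delta_mx 0 k = p k.+1.
    apply/rowP => j; rewrite !mxE eqxx/= ltnS [in RHS]leq_eqVlt.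
    have [->|jk] := eqVneq j k; first by rewrite ltnn eqxx mulr1 subrKC.
    by rewrite (_ : (nat_of_ord j == k) = false) ?orFb ?mulr0 ?addr0//; exact/negbTE.
  move=> ->; rewrite mulrC -mulrBr normrM mulrC ler_wpM2r//.
  by rewrite distrC; have [_] := seg s hs; exact.
have -> : f z - f y = \sum_(k < n) (f (p k.+1) - f (p k)).
  rewrite -[in f z]pn -[in f y]p0 -(telescope_sumr (fun k => f (p k)) (leq0n n)).
  by rewrite big_mkord.
rewrite -sumrB mulr_sumr (le_trans (ler_norm_sum _ _ _))//.
by apply: ler_sum => k _; exact: step.
Qed.

Lemma is_derive_C1 (O : set 'rV[R]_n) f x v : open O -> C1_on O f -> O x ->
  is_derive x v f (\sum_j v 0 j * partial j f x).
Proof.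
move=> oO fC1 Ox; have E0 : x = x + (0 : R) *: v by rewrite scale0r addr0.
rewrite [X in is_derive X]E0; apply/is_derive_line; apply: is_derive1_cvg.
apply/cvgrPdist_le => e e0.
pose S := \sum_j `|v 0 j| + 1.
have S1 : 0 < S by rewrite ltr_wpDl// sumr_ge0.
have [r r0 Hr] := C1_strict _ _ _ (e / S) oO fC1 Ox (divr_gt0 e0 S1).
near=> h; rewrite add0r scale0r addr0.
have h0 : h != 0 by near: h; exact: nbhs_dnbhs_neq.
have hr : `|h| < r / S by near: h; apply: dnbhs0_lt; rewrite divr_gt0.
have := Hr x (x + h *: v); rewrite /=.
have E j : (x + h *: v) 0 j - x 0 j = h * v 0 j by rewrite !mxE addrAC subrr add0r.
under eq_bigr do rewrite E -mulrA.
under [X in _ -> _ -> _ <= _ * X]eq_bigr do rewrite E normrM.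
rewrite -!mulr_sumr => H.
have {}H : `|f (x + h *: v) - f x - h * \sum_j v 0 j * partial j f x| <=
    e / S * (`|h| * \sum_j `|v 0 j|).
  apply: H => j; first by rewrite subrr normr0.
  rewrite E normrM (@le_lt_trans _ _ (`|h| * S))//; last by rewrite -ltr_pdivlMr.
  rewrite ler_wpM2l// /S (bigD1 j)//= -addrA lerDl addr_ge0// sumr_ge0//.
have -> : \sum_j v 0 j * partial j f x - h^-1 * (f (x + h *: v) - f x) =
    - h^-1 * (f (x + h *: v) - f x - h * \sum_j v 0 j * partial j f x) by field.
rewrite normrM normrN normfV mulrC ler_pdivrMr ?normr_gt0//.
apply: le_trans H _; rewrite mulrCA [leRHS]mulrC ler_wpM2l//.
by rewrite mulrAC ler_pdivrMr// ler_pM2l// /S lerDl.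
Unshelve. all: by end_near. Qed.

Lemma C1_continuous (O : set 'rV[R]_n) f x : open O -> C1_on O f -> O x ->
  {for x, continuous f}.
Proof.
move=> oO fC1 Ox; have [r r0 Hr] := C1_strict _ _ _ 1 oO fC1 Ox ltr01.
pose B z := \sum_j `|z 0 j - x 0 j| * (1 + `|partial j f x|).
have cB : continuous B.
  apply: continuous_sumr => j; apply: continuous_mulr _ (continuous_cstr _) => z.
  exact: (cvg_norm (continuous_subr (fun z : 'rV[R]_n => z 0 j) _
    (@continuous_entry R n j) (continuous_cstr (x 0 j)) z)).
have B0 : B x = 0.
  by apply: big1 => j _; rewrite subrr normr0 mul0r.
have FF : Filter (nbhs x) by exact: nbhs_filter.
suff : f z @[z --> x] --> f x by [].
apply/cvgrPdist_lt => e e0.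
have nB : \forall z \near x, `|B x - B z| < e.
  by have /cvgrPdist_lt/(_ e e0) := cB x.
have nr : nbhs x [set z : 'rV[R]_n | forall j, `|x 0 j - z 0 j| < r].
  pose P (j : 'I_n) (z : 'rV[R]_n) := `|x 0 j - z 0 j| < r.
  have HP j : \forall z \near x, P j z.
    by have /cvgrPdist_lt/(_ r r0) := @continuous_entry R n j x.
  exact: (filter_forall _ HP).
apply: (@filterS2 _ (nbhs x) FF _ _ _ _ nB nr) => z zB zr.
have := Hr x z; rewrite mul1r => H.
have {}H : `|f z - f x - \sum_j (z 0 j - x 0 j) * partial j f x| <=
    \sum_j `|z 0 j - x 0 j|.
  by apply: H => j; rewrite ?subrr ?normr0// distrC.
rewrite distrC; apply: le_lt_trans zB.
rewrite B0 sub0r normrN [leRHS]ger0_norm; last first.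
  by rewrite /B; apply: sumr_ge0 => j _; rewrite mulr_ge0// addr_ge0.
rewrite -[X in `|X|](subrK (\sum_j (z 0 j - x 0 j) * partial j f x)).
apply: le_trans (ler_normD _ _) _; rewrite /B.
under [leRHS]eq_bigr do rewrite mulrDr mulr1.
rewrite big_split/= lerD//.
apply: le_trans (ler_norm_sum _ _ _) _.
by apply: ler_sum => j _; rewrite normrM.
Qed.

End ChainRule.

Section Reflection.
Context {R : realType} {n : nat}.
Implicit Types (e y : 'rV[R]_n.+1).

(** The Householder reflection that exchanges [e_0] and the unit vector [e];
    division by zero makes it the identity when they coincide. *)
Definition householder e : 'M[R]_n.+1 :=
  let w := delta_mx 0 ord0 - e in
  \matrix_(i, j) ((i == j)%:R - 2 * w 0 i * w 0 j / sqlen w).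

Lemma householder_sym e i j : householder e i j = householder e j i.
Proof. by rewrite !mxE eq_sym; ring. Qed.

Lemma householder_orth e p q :
  \sum_i householder e i p * householder e i q = (p == q)%:R.
Proof.
pose w : 'rV[R]_n.+1 := delta_mx 0 ord0 - e.
pose S := sqlen w.
have SS : S * S^-1 * S^-1 = S^-1.
  by have [->|S0] := eqVneq S 0; rewrite ?invr0 ?mulr0// divff// mul1r.
have E i : householder e i p * householder e i q =
    (i == p)%:R * ((i == q)%:R - 2 * w 0 p * w 0 q / S) -
    (i == q)%:R * (2 * w 0 p * w 0 q / S) + 4 * w 0 p * w 0 q / S / S * w 0 i ^+ 2.
  rewrite !mxE -/w -/S.
  by have [->|_] := eqVneq i p; have [->|_] := eqVneq _ q; rewrite ?mulr1n ?mulr0n; ring.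
rewrite (eq_bigr _ (fun i _ => E i)) big_split sumrB/= -mulr_sumr -/(sqlen w) -/S.
rewrite (bigD1 p)//= eqxx mulr1n mul1r big1 ?addr0; last first.
  by move=> i /negPf ->; rewrite mul0r.
rewrite (bigD1 q)//= eqxx mulr1n mul1r big1 ?addr0; last first.
  by move=> i /negPf ->; rewrite mul0r.
have -> : 4 * w 0 p * w 0 q / S / S * S = 4 * w 0 p * w 0 q * (S * S^-1 * S^-1) by ring.
by rewrite SS; ring.
Qed.

Lemma householder_row0 e j : sqlen e = 1 -> householder e ord0 j = e 0 j.
Proof.
move=> e1; pose w : 'rV[R]_n.+1 := delta_mx 0 ord0 - e.
have wE i : w 0 i = (i == ord0)%:R - e 0 i by rewrite !mxE eqxx.
have S2 : sqlen w = 2 * w 0 ord0.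
  have E i : w 0 i ^+ 2 = e 0 i ^+ 2 + (i == ord0)%:R * (1 - 2 * e 0 ord0).
    by rewrite wE; have [->|_] := eqVneq i ord0; rewrite ?mulr1n ?mulr0n; ring.
  rewrite /sqlen (eq_bigr _ (fun i _ => E i)) big_split/= -/(sqlen e) e1.
  rewrite (bigD1 ord0)//= ?eqxx mulr1n mul1r big1 ?addr0; last first.
    by move=> i /negPf ->; rewrite mul0r.
  by rewrite wE eqxx mulr1n; ring.
rewrite mxE -/w; have [S0|S0] := eqVneq (sqlen w) 0.
  have w0 i : w 0 i = 0.
    apply/eqP; rewrite -sqrf_eq0 eq_le sqr_ge0 andbT -S0; exact: sqlen_ge.
  by rewrite !w0 mulr0 mul0r subr0 eq_sym; have := w0 j; rewrite wE => /eqP; rewrite subr_eq0 => /eqP.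
rewrite -S2 mulrAC divff// mul1r wE eq_sym; ring.
Qed.

(** As the reflection is symmetric and orthogonal with first row [e], the
    component along [e] of an image is the first coordinate. *)
Lemma householder_dot e y : sqlen e = 1 ->
  \sum_j (y *m householder e) 0 j * e 0 j = y 0 ord0.
Proof.
move=> e1.
under eq_bigr => j _ do rewrite mxE -(householder_row0 _ _ e1) mulr_suml.
rewrite exchange_big/=.
have E i : \sum_j y 0 i * householder e i j * householder e ord0 j =
    y 0 i * (i == ord0)%:R.
  rewrite -(householder_orth e i ord0) mulr_sumr; apply: eq_bigr => j _.
  by rewrite -mulrA [householder e i j]householder_sym [householder e ord0 j]householder_sym.
rewrite (eq_bigr _ (fun i _ => E i)) (bigD1 ord0)//= ?eqxx mulr1 big1 ?addr0//.
by move=> i /negPf ->; rewrite mulr0.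
Qed.

Lemma sqlen_householder e y : sqlen (y *m householder e) = sqlen y.
Proof.
have E j : (y *m householder e) 0 j ^+ 2 =
    \sum_i \sum_l y 0 i * y 0 l * (householder e j i * householder e j l).
  rewrite mxE expr2 mulr_suml; apply: eq_bigr => i _.
  rewrite mulr_sumr; apply: eq_bigr => l _.
  by rewrite [householder e i j]householder_sym [householder e l j]householder_sym; ring.
rewrite /sqlen (eq_bigr _ (fun j _ => E j)) exchange_big/=; apply: eq_bigr => i _.
rewrite exchange_big/= (bigD1 i)//= -mulr_sumr householder_orth eqxx mulr1.
rewrite big1 ?addr0//; move=> l /negPf li.
by rewrite -mulr_sumr householder_orth eq_sym li mulr0.
Qed.

End Reflection.

Lemma sum_delta (R : pzRingType) n (F : 'I_n -> R) q : \sum_p F p * (q == p)%:R = F q.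
Proof.
rewrite (bigD1 q)//= eqxx mulr1 big1 ?addr0// => p /negPf.
by rewrite eq_sym => ->; rewrite mulr0.
Qed.

Section PullBack.
Context {R : realType} {k : nat}.
Notation V := 'rV[R]_k.+2.
Variables (Omega : set V) (u : V -> V) (x : V) (s L : R) (H : 'M[R]_k.+2).
Hypothesis oOmega : open Omega.
Hypothesis hu : harmonic_unit_fields Omega u.
Hypothesis Horth : forall p q, \sum_i H i p * H i q = (p == q)%:R.

Definition affine (y : V) : V := x + s *: (y *m H).

Hypothesis box_in : forall y, in_box (lo L) (hi L) y -> Omega (affine y).

Lemma affine_line i y (h : R) :
  affine (y + h *: delta_mx 0 i) = affine y + h *: (s *: row i H).
Proof.
rewrite /affine mulmxDl -scalemxAl -rowE scalerDr addrA; congr (_ + _).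
by rewrite !scalerA mulrC.
Qed.

Lemma affine_continuous : continuous affine.
Proof.
move=> y; apply: cvg_row => j.
rewrite (_ : (fun z => _) = (fun z : V => x 0 j + s * \sum_i z 0 i * H i j)).
  apply: (continuous_addr _ _ (continuous_cstr _)).
  apply: (continuous_mulr _ _ (continuous_cstr _)).
  by apply: continuous_sumr => i; exact: continuous_mulr (continuous_entry _ _) (continuous_cstr _).
by apply/funext => z; rewrite !mxE.
Qed.

Lemma is_derive_affine (f : V -> R) i y : C1_on Omega f -> Omega (affine y) ->
  is_derive y (delta_mx 0 i) (fun y => f (affine y))
    (\sum_q s * H i q * partial q f (affine y)).
Proof.
move=> fC1 Oy.
have E0 (z v : V) : z = z + (0 : R) *: v by rewrite scale0r addr0.
rewrite [X in is_derive X](E0 y (delta_mx 0 i)); apply/is_derive_line.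
under [X in is_derive _ _ X]eq_fun do rewrite affine_line.
apply/is_derive_line; rewrite -E0.
have := is_derive_C1 _ _ _ (s *: row i H) oOmega fC1 Oy.
by congr is_derive; apply: eq_bigr => q _; rewrite !mxE.
Qed.

Definition pullU i (y : V) : R := \sum_l H i l * u (affine y) 0 l.
Definition pullU1 i j (y : V) : R :=
  \sum_l H i l * \sum_q s * H j q * partial q (fun z => u z 0 l) (affine y).
Definition pullU2 i j (y : V) : R :=
  \sum_l H i l * \sum_q s * H j q * \sum_p s * H j p *
    partial p (partial q (fun z => u z 0 l)) (affine y).

Lemma unit_field_le1 z : Omega z -> \sum_l u z 0 l ^+ 2 <= 1.
Proof.
move=> Oz; have : ((enorm (u z))%:E <= 1)%E.
  by apply: le_trans hu.2; apply: ereal_sup_ubound; exists z.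
rewrite lee_fin /enorm => h; rewrite -[leLHS]sqr_sqrtr; last exact: (sqlen_ge0 _ (u z)).
by rewrite expr_le1// sqrtr_ge0.
Qed.

Let comp_affine_continuous (f : V -> R) y : {for affine y, continuous f} ->
  {for y, continuous (fun y => f (affine y))}.
Proof. by move=> cf; exact: (continuous_comp (affine_continuous y) cf). Qed.

Let continuous_at_sum (I : Type) (r : seq I) (F : I -> V -> R) y :
  (forall e : I, {for y, continuous (F e)}) ->
  {for y, continuous (fun y => \sum_(e <- r) F e y)}.
Proof.
move=> cF; elim: r => [|e r IH].
  rewrite (_ : (fun y => _) = cst 0); first exact: cst_continuous.
  by apply/funext => z; rewrite big_nil.
rewrite (_ : (fun y => _) = (fun y => F e y + \sum_(i <- r) F i y)).
  exact: (continuousD (cF e) IH).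
by apply/funext => z; rewrite big_cons.
Qed.

Let continuous_at_scale (a : R) (F : V -> R) y : {for y, continuous F} ->
  {for y, continuous (fun y => a * F y)}.
Proof. by move=> cF; exact: (continuousM (@cst_continuous _ _ a _) cF). Qed.

(** The Laplacian and the Euclidean length are invariant under the orthogonal
    part of the similarity. *)
Lemma pull_harmonic_field : harmonic_field k L pullU pullU1 pullU2.
Proof.
have [hh _] := hu.
have C1u l : C1_on Omega (fun z => u z 0 l) := (hh l).1.1.
have C2u l q : C1_on Omega (partial q (fun z => u z 0 l)) := (hh l).1.2 q.
constructor.
- move=> i j y hy; apply: is_derive_sumr => l; apply: is_derive_scaler.
  exact: is_derive_affine (C1u l) (box_in y hy).
- move=> i j y hy; apply: is_derive_sumr => l; apply: is_derive_scaler.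
  apply: is_derive_sumr => q; apply: is_derive_scaler.
  exact: is_derive_affine (C2u l q) (box_in y hy).
- move=> i y hy; apply: continuous_at_sum => l; apply: continuous_at_scale.
  apply: (comp_affine_continuous (fun z => u z 0 l)).
  exact: C1_continuous oOmega (C1u l) (box_in y hy).
- move=> i j y hy; apply: continuous_at_sum => l; apply: continuous_at_scale.
  apply: continuous_at_sum => q; apply: continuous_at_scale.
  apply: (comp_affine_continuous (partial q (fun z => u z 0 l))).
  exact: C1_continuous oOmega (C2u l q) (box_in y hy).
- move=> i j y hy; apply: continuous_at_sum => l; apply: continuous_at_scale.
  apply: continuous_at_sum => q; apply: continuous_at_scale.
  apply: continuous_at_sum => p; apply: continuous_at_scale.
  apply: (comp_affine_continuous (partial p (partial q (fun z => u z 0 l)))).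
  by have [] := C2u l q p _ (box_in y hy).
- move=> i y hy; rewrite /pullU2 exchange_big big1//= => l _.
  rewrite -mulr_sumr; set D := (X in _ * X).
  suff -> : D = s ^+ 2 * laplacian (fun z => u z 0 l) (affine y).
    by rewrite (hh l).2 ?mulr0//; exact: box_in.
  rewrite /D exchange_big/= /laplacian mulr_sumr; apply: eq_bigr => q _.
  under eq_bigr do rewrite mulr_sumr.
  rewrite exchange_big/=.
  have E p : \sum_j s * H j q * (s * H j p *
      partial p (partial q (fun z => u z 0 l)) (affine y)) =
      s ^+ 2 * partial p (partial q (fun z => u z 0 l)) (affine y) * (q == p)%:R.
    move: (partial p _ _) => d; rewrite -(Horth q p) mulr_sumr.
    by apply: eq_bigr => j _; ring.
  under eq_bigr => p _ do rewrite E.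
  exact: (sum_delta _ _ (fun p => s ^+ 2 *
    partial p (partial q (fun z => u z 0 l)) (affine y))).
- move=> y hy; apply: le_trans (unit_field_le1 _ (box_in y hy)).
  have E i : pullU i y ^+ 2 = \sum_p \sum_q
      u (affine y) 0 p * u (affine y) 0 q * (H i p * H i q).
    rewrite /pullU expr2 mulr_suml; apply: eq_bigr => p _.
    by rewrite mulr_sumr; apply: eq_bigr => q _; ring.
  rewrite (eq_bigr _ (fun i _ => E i)) exchange_big/=; apply: ler_sum => p _.
  rewrite exchange_big/= (bigD1 p)//= -mulr_sumr Horth eqxx mulr1 big1 ?addr0//.
  by move=> q /negPf qp; rewrite -mulr_sumr Horth eq_sym qp mulr0.
Qed.

Lemma pull_divergence : \sum_i pullU1 i i 0 = s * divergence u x.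
Proof.
have A0 : affine 0 = x by rewrite /affine mul0mx scaler0 addr0.
rewrite /pullU1 A0 exchange_big/= /divergence mulr_sumr; apply: eq_bigr => l _.
under eq_bigr do rewrite mulr_sumr.
rewrite exchange_big/=.
have E q : \sum_i H i l * (s * H i q * partial q (fun z => u z 0 l) x) =
    s * partial q (fun z => u z 0 l) x * (l == q)%:R.
  move: (partial q _ _) => d; rewrite -(Horth l q) mulr_sumr.
  by apply: eq_bigr => i _; ring.
under eq_bigr => q _ do rewrite E.
exact: (sum_delta _ _ (fun q => s * partial q (fun z => u z 0 l) x)).
Qed.

End PullBack.

(** * Approach along the radius *)

Section Geometry.
Context {R : realType} {n : nat}.
Implicit Types (c xi x y e : 'rV[R]_n.+1).

Let shift_sqlen_continuous c : continuous (fun x => sqlen (x - c)).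
Proof.
apply: continuous_sumr => i; apply: continuous_expr.
have -> : (fun y : 'rV[R]_n.+1 => (y - c) 0 i) = (fun y => y 0 i - c 0 i).
  by apply/funext => y; rewrite !mxE.
exact: continuous_subr _ _ (continuous_entry _ _) (continuous_cstr _).
Qed.

Lemma near_sqlen_lt x0 c (a : R) : sqlen (x0 - c) < a ->
  \forall x \near x0, sqlen (x - c) < a.
Proof.
move=> h; have /cvgrPdist_lt/(_ (a - sqlen (x0 - c))) := shift_sqlen_continuous c x0.
rewrite subr_gt0 => /(_ h); have FF : Filter (nbhs x0) by exact: nbhs_filter.
by apply: filterS => x; rewrite ltr_norml => /andP[+ _]; lra.
Qed.

Lemma near_sqlen_gt x0 c (a : R) : a < sqlen (x0 - c) ->
  \forall x \near x0, a < sqlen (x - c).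
Proof.
move=> h; have /cvgrPdist_lt/(_ (sqlen (x0 - c) - a)) := shift_sqlen_continuous c x0.
rewrite subr_gt0 => /(_ h); have FF : Filter (nbhs x0) by exact: nbhs_filter.
by apply: filterS => x; rewrite ltr_norml => /andP[_]; lra.
Qed.

Lemma eballE c (r : R) x : 0 < r -> eball c r x <-> sqlen (x - c) < r ^+ 2.
Proof.
move=> r0; rewrite /eball/= /enorm -/(sqlen (x - c)).
rewrite -[X in _ <-> X < _]sqr_sqrtr ?sqlen_ge0//.
by rewrite ltr_pXn2r// nnegrE ?sqrtr_ge0// ltW.
Qed.

(** The topology is that of the sup norm, but the squared Euclidean distance to
    [c] is continuous. *)
Lemma boundary_eball c (r : R) xi : 0 < r -> boundary (eball c r) xi ->
  sqlen (xi - c) = r ^+ 2.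
Proof.
move=> r0 [hc hi]; apply/eqP; rewrite eq_le; apply/andP; split; rewrite leNgt; apply/negP => h.
  have [y [/(eballE _ _ _ r0) h1 h2]] := hc _ (near_sqlen_gt _ _ _ h).
  by move: h1; rewrite ltNge ltW.
apply: hi; rewrite /interior/=; have := near_sqlen_lt _ _ _ h.
have FF : Filter (nbhs xi) by exact: nbhs_filter.
by apply: filterS => x hx; apply/eballE.
Qed.

Lemma sqlenZ (a : R) y : sqlen (a *: y) = a ^+ 2 * sqlen y.
Proof.
by rewrite /sqlen mulr_sumr; apply: eq_bigr => i _; rewrite mxE exprMn.
Qed.

Lemma sqlen_comb (a b : R) e y :
  sqlen (a *: e + b *: y) =
  a ^+ 2 * sqlen e + 2 * a * b * \sum_j y 0 j * e 0 j + b ^+ 2 * sqlen y.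
Proof.
rewrite /sqlen !mulr_sumr -!big_split/=; apply: eq_bigr => j _.
by rewrite !mxE; ring.
Qed.

End Geometry.

Section Radial.
Context {R : realType} {k : nat}.
Notation V := 'rV[R]_k.+2.

(** The bottom face is orthogonal to the radius, at distance [eta d] from the
    tangent plane, and has size of order [d]; the sphere deviates from its tangent
    plane by a quantity of order [d^2] only. *)
Lemma half_box_in_ball (c e y : V) (r d eta L : R) :
  sqlen e = 1 -> 0 < d -> d <= r -> 0 < eta < 1 -> 1 <= L ->
  d * (1 + k.+2%:R * L ^+ 2) < 2 * r * eta ->
  in_box (lo L) (hi L) y ->
  eball c r (affine (c + (d - r) *: e) ((1 - eta) * d) (householder e) y).
Proof.
move=> e1 d0 dr /andP[eta0 eta1] L1 hd hy.
have r0 : 0 < r by exact: lt_le_trans dr.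
apply/(eballE _ _ _ r0); rewrite /affine addrAC [c + _]addrC addrK.
rewrite sqlen_comb e1 householder_dot// sqlen_householder mulr1.
have y0 : -1 <= y 0 ord0 by have /andP[] := hy ord0.
have q : sqlen y <= k.+2%:R * L ^+ 2.
  have -> : k.+2%:R * L ^+ 2 = \sum_(i < k.+2) L ^+ 2.
    by rewrite sumr_const card_ord -[RHS]mulr_natl.
  apply: ler_sum => i _; rewrite -real_normK ?num_real//.
  have L0 : 0 <= L by exact: le_trans L1.
  rewrite lerXn2r ?nnegrE// ler_norml.
  exact: (half_box_cube L1 _ hy).
set s := (1 - eta) * d; set t := y 0 ord0 in y0 *; set Q := sqlen y in q *.
have s0 : 0 <= s by rewrite mulr_ge0 ?subr_ge0// ltW.
have sd : s <= d by rewrite ler_piMl ?(ltW d0)// gerBl ltW.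
have Q0 : 0 <= Q by exact: sqlen_ge0.
have h1 : 2 * (d - r) * s * t <= 2 * (r - d) * s.
  rewrite -subr_ge0.
  have -> : 2 * (r - d) * s - 2 * (d - r) * s * t = 2 * ((r - d) * s * (1 + t)) by ring.
  by rewrite mulr_ge0// mulr_ge0 ?mulr_ge0 ?subr_ge0//; lra.
have h2 : s ^+ 2 * Q <= d ^+ 2 * (k.+2%:R * L ^+ 2).
  by rewrite ler_pM ?sqr_ge0// lerXn2r// nnegrE// ltW.
have h3 : (d - r) ^+ 2 + 2 * (r - d) * s + d ^+ 2 * (k.+2%:R * L ^+ 2) =
    r ^+ 2 + d * (d * (1 + k.+2%:R * L ^+ 2) - 2 * r * eta) - 2 * (d * s) by rewrite /s; ring.
have h4 : d * (d * (1 + k.+2%:R * L ^+ 2) - 2 * r * eta) < 0.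
  by rewrite pmulr_rlt0// subr_lt0.
have h5 : 0 <= d * s by rewrite mulr_ge0// ltW.
lra.
Qed.

Lemma D_ratio_ge0 : 0 <= @D_ratio R k.
Proof.
rewrite divr_ge0 ?(ltW (wallis0_gt0 _))//; apply: Rintegral_ge0 => t /=.
by rewrite in_itv/= => ht; rewrite mulr_ge0 ?sqrtr_ge0// exprn_ge0// sin_ge0_pihalf.
Qed.

(** Apply the estimate on the half-cube to the pull-back of [u] by the similarity
    of the previous lemmas, whose ratio is [(1 - eta) d]. *)
Lemma ball_estimate (Omega : set V) (xi c : V) (r epsilon : R) :
  open Omega -> 0 < r -> eball c r `<=` Omega -> boundary (eball c r) xi ->
  0 < epsilon ->
  \forall x \near xi, open_radius c xi x -> forall u, harmonic_unit_fields Omega u ->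
    enorm (x - xi) * `|divergence u x| <= D_ratio k + epsilon.
Proof.
move=> oOmega r0 hB hxi e0.
have e30 : 0 < epsilon / 3 by rewrite divr_gt0.
set e3 := epsilon / 3 in e30 *.
have [C1 HC1] := @pole_mass_bound R k e3 e30.
have [a a0 Ha] := @moment0_lower R k.
pose C2 : R := 16 * (1 + k.+3%:R) * k.+2%:R ^+ 3 * 2 ^+ k.+2.
pose C := 2 * `|C1| + `|C2|.
have C0 : 0 <= C by rewrite addr_ge0// mulr_ge0.
(* the size of the half-cube makes the relative error smaller than e3 *)
pose L := Num.max 1 (C / (2 * a * e3)).
have L1 : 1 <= L by rewrite le_max lexx.
have L0 : 0 < L by exact: lt_le_trans L1.
have ae : 0 < 2 * a * e3 by rewrite !mulr_gt0.
have CL : C / L <= 2 * a * e3.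
  rewrite ler_pdivrMr// mulrC -ler_pdivrMr//.
  by rewrite le_max lexx orbT.
pose B := D_ratio k + 2 * e3.
have B0 : 0 < B by rewrite ltr_wpDl ?D_ratio_ge0// mulr_gt0.
(* lowering the pole by the factor 1 - eta costs at most another e3 *)
pose eta := e3 / (B + e3).
have Be0 : 0 < B + e3 by rewrite addr_gt0.
have eta0 : 0 < eta by rewrite divr_gt0.
have eta1 : eta < 1 by rewrite ltr_pdivrMr// mul1r ltrDr.
have etaB : B = (1 - eta) * (B + e3).
  by rewrite /eta; field; rewrite gt_eqF.
pose dmax := 2 * r * eta / (1 + k.+2%:R * L ^+ 2).
have den : 0 < 1 + k.+2%:R * L ^+ 2 by rewrite ltr_pwDl// mulr_ge0// sqr_ge0.
have dmax0 : 0 < dmax.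
  by apply: divr_gt0 => //; apply: mulr_gt0 => //; exact: mulr_gt0.
have sxi := boundary_eball _ _ _ r0 hxi.
have near_d : \forall x \near xi, sqlen (x - xi) < dmax ^+ 2.
  apply: near_sqlen_lt; rewrite subrr /sqlen big1 ?exprn_gt0//.
  by move=> i _; rewrite mxE expr0n.
have FF : Filter (nbhs xi) by exact: nbhs_filter.
apply: (@filterS _ (nbhs xi) FF _ _ _ near_d) => x xd [tau /andP[tau0 tau1] xE] u hu.
pose e := r^-1 *: (c - xi).
have rn0 : r != 0 by rewrite gt_eqF.
have e1 : sqlen e = 1.
  have -> : e = (- r^-1) *: (xi - c) by rewrite /e scaleNr -scalerN opprB.
  by rewrite sqlenZ sxi sqrrN exprVn mulVf// expf_neq0.
pose d := (1 - tau) * r.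
have d0 : 0 < d by rewrite mulr_gt0// subr_gt0.
have dr : d <= r by rewrite ler_piMl ?(ltW r0)// gerBl.
have cxi : xi - c = - r *: e.
  by rewrite /e scalerA mulNr divff// scaleN1r opprB.
have xe : x - xi = d *: e.
  rewrite xE cxi -[xi](subrK c) cxi; apply/rowP => j; rewrite !mxE /d; ring.
have xce : x = c + (d - r) *: e.
  rewrite xE cxi; apply/rowP => j; rewrite !mxE /d; ring.
have dE : enorm (x - xi) = d.
  by rewrite /enorm -/(sqlen _) xe sqlenZ e1 mulr1 sqrtr_sqr gtr0_norm.
have dlt : d < dmax.
  by rewrite -(@ltr_pXn2r _ 2)// ?nnegrE ?(ltW d0) ?(ltW dmax0)//; move: xd; rewrite xe sqlenZ e1 mulr1.
pose s := (1 - eta) * d.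
have s0 : 0 < s by rewrite mulr_gt0// subr_gt0.
have box_in y : in_box (lo L) (hi L) y -> Omega (affine x s (householder e) y).
  move=> hy; apply: hB; rewrite xce; apply: (half_box_in_ball c e y r d eta L) => //.
  - by rewrite eta0.
  - by move: dlt; rewrite /dmax ltr_pdivlMr.
have HF := pull_harmonic_field Omega u x s L (householder e) oOmega hu
  (householder_orth e) box_in.
have := half_box_estimate L1 HF.
rewrite (pull_divergence u x s (householder e) (householder_orth e)).
set A := cube_int L (kap k.+2 1) => H.
have AE : @cube_int R k.+1 L (kap (k.+2 + 2 * 0)%N 1) = A by rewrite muln0 addn0.
have aA : a <= A by rewrite -AE; exact: Ha.
have A0 : 0 < A by exact: lt_le_trans aA.
have PA : cube_int L (pole_mass k) <= (D_ratio k + e3) * A + C1 / L.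
  by rewrite -AE; exact: HC1.
have CC : 2 * (C1 / L) + C2 / L <= C / L.
  by rewrite mulrA -mulrDl ler_pM2r ?invr_gt0// lerD ?ler_norm// ler_pM2l// ler_norm.
have CA : C / L <= 2 * A * e3.
  by apply: (le_trans CL); rewrite ler_pM2r// ler_pM2l.
have {}H : `|s * divergence u x| * (2 * A) <= B * (2 * A).
  have -> : B * (2 * A) = 2 * ((D_ratio k + e3) * A) + 2 * A * e3 by rewrite /B; ring.
  rewrite (le_trans H)// -/C2.
  have : 2 * cube_int L (pole_mass k) <= 2 * ((D_ratio k + e3) * A + C1 / L).
    by rewrite ler_pM2l.
  rewrite mulrDr; lra.
have {}H : s * `|divergence u x| <= B.
  have A2 : 0 < 2 * A by rewrite mulr_gt0.
  by move: H; rewrite ler_pM2r// normrM gtr0_norm.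
rewrite dE; have eta1' : 0 < 1 - eta by rewrite subr_gt0.
have : d * `|divergence u x| <= B + e3.
  by rewrite -(ler_pM2l eta1') -etaB mulrA.
by rewrite /B /e3; lra.
Qed.

End Radial.

Theorem proposition6 (R : realType) (n : nat) (hn : (2 <= n)%N)
    (Omega : set 'rV[R]_n) (hOmega : domain Omega)
    (xi : 'rV[R]_n) (hxi : boundary Omega xi)
    (c : 'rV[R]_n) (r : R) (hr : 0 < r)
    (hB : eball c r `<=` Omega) (hxiB : boundary (eball c r) xi) :
  (limf_esup
     (fun x : 'rV[R]_n =>
        ereal_sup [set (enorm (x - xi) * `|divergence u x|)%:E
                  | u in harmonic_unit_fields Omega])
     (within (open_radius c xi) (nbhs xi))
   <= (D_const R n)%:E)%E.
Proof.
case: n hn Omega hOmega xi hxi c hB hxiB => [//|[//|k]] _ Omega [oOmega _ _] xi _ c hB hxiB.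
rewrite D_constE; apply/lee_addgt0Pr => e e0.
have near_xi := ball_estimate Omega xi c r e oOmega hr hB hxiB e0.
rewrite limf_esupE; set F := (fun x : 'rV[R]_k.+2 => ereal_sup _).
pose W := [set x | open_radius c xi x -> forall u, harmonic_unit_fields Omega u ->
    enorm (x - xi) * `|divergence u x| <= D_ratio k + e].
apply: (@le_trans _ _ (ereal_sup (F @` (W `&` open_radius c xi)))).
  apply: ereal_inf_lbound; exists (W `&` open_radius c xi) => //.
  rewrite /within/=; have FF : Filter (nbhs xi) by exact: nbhs_filter.
  by apply: (@filterS _ (nbhs xi) FF _ _ _ near_xi) => x Wx hx; split.
apply: ge_ereal_sup => _ [x [Wx hx] <-].
apply: ge_ereal_sup => _ [u hu <-].
by rewrite -EFinD lee_fin; exact: Wx.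
Qed.
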